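(* Let $\alpha\in[0,1)$ and $T_0:=\frac{4}{2-\alpha}$. Then the sequence $(e^{i\omega_{\alpha,n}t})_{n\in\mathbb Z}$ is a Riesz basis of $L^2(0,T_0;\mathbb C)$.
   Context: For $\alpha\in[0,1)$, let $j_{\nu,n}$ denote the $n$-th positive zero of the Bessel function of the first kind $J_\nu$. Set $\lambda_{\alpha,n}:=\bigl(\frac{2-\alpha}{2}\bigr)^2j_{\frac{1}{2-\alpha},n}^2$ for $n\ge1$ (these are the positive eigenvalues of $-(x^\alpha\Phi')'=\lambda\Phi$ on $(0,1)$ with $(x^\alpha\Phi')(0)=0=\Phi'(1)$), and $\omega_{\alpha,0}:=0$, $\omega_{\alpha,n}:=\sqrt{\lambda_{\alpha,n}}$ for $n\ge1$, $\omega_{\alpha,n}:=-\sqrt{\lambda_{\alpha,|n|}}$ for $n\le-1$. *)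

(* Defs.v *)
From HB Require Import structures.
From mathcomp Require Import all_boot all_order all_algebra.
From mathcomp Require Import complex.
From mathcomp Require Import all_classical all_reals all_analysis.

Set Implicit Arguments.
Unset Strict Implicit.
Unset Printing Implicit Defensive.

Import Order.TTheory GRing.Theory Num.Theory.
Import numFieldNormedType.Exports.

Local Open Scope classical_set_scope.
Local Open Scope ring_scope.
Local Open Scope complex_scope.

(* Euler's integral, meaningful for s > 0. *)
Definition Gamma (R : realType) (s : R) : R :=
  \int[@lebesgue_measure R]_(t in `]0, +oo[) (t `^ (s - 1) * expR (- t)).

(* The Bessel function of the first kind J_nu, for real order nu > -1 (so that
   Gamma is only used at positive arguments) and x > 0. *)
Definition besselJ (R : realType) (nu x : R) : R :=
  limn (series (fun m : nat =>
    (-1) ^+ m / (m`!%:R * Gamma (m%:R + nu + 1)) * (x / 2) `^ (2 * m%:R + nu))).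

(* j_{nu,n} for n >= 1: the positive zero of J_nu that has exactly n - 1
   positive zeros below it. It is unique if it exists; the value 0 is a
   placeholder for the case where there is no such zero. *)
Definition bessel_zero (R : realType) (nu : R) (n : nat) : R :=
  xget 0 [set z : R | [/\ 0 < z, besselJ nu z = 0
    & [set x : R | 0 < x < z /\ besselJ nu x = 0] #= `I_n.-1]%card].

Definition lambda (R : realType) (alpha : R) (n : nat) : R :=
  ((2 - alpha) / 2) ^+ 2 * bessel_zero (2 - alpha)^-1 n ^+ 2.

Definition omega (R : realType) (alpha : R) (n : int) : R :=
  if n == 0 then 0
  else if 0 < n then Num.sqrt (lambda alpha `|n|%N)
  else - Num.sqrt (lambda alpha `|n|%N).

Definition expi (R : realType) (theta : R) : R[i] := cos theta +i* sin theta.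

(* The Hilbert space L^2(mu; C). Its elements are represented by functions
   T -> R[i], two functions representing the same element when they are equal
   mu-almost everywhere. *)
Section L2.
Context d (T : measurableType d) (R : realType).
Variable mu : {measure set T -> \bar R}.
Implicit Types f g : T -> R[i].

Definition L2 f : Prop :=
  (fun x => complex.Re (f x)) \in Lfun mu 2%:E /\ (fun x => complex.Im (f x)) \in Lfun mu 2%:E.

Definition L2dot f g : R[i] :=
  (\int[mu]_x complex.Re (f x * (g x)^*)) +i*
  (\int[mu]_x complex.Im (f x * (g x)^*)).

Definition L2norm f : R := Num.sqrt (complex.Re (L2dot f f)).

(* Orthonormal, with dense linear span. *)
Definition orthonormal_basis (I : eqType) (e : I -> T -> R[i]) : Prop :=
  [/\ forall i, L2 (e i),
      forall i j, L2dot (e i) (e j) = (i == j)%:R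
    & forall f, L2 f -> forall eps : R, 0 < eps ->
        exists (s : seq I) (c : I -> R[i]),
          L2norm (fun x => f x - \sum_(i <- s) c i * e i x) < eps].

(* U induces a bounded linear operator of L^2(mu; C); its values outside L2 are
   irrelevant. *)
Definition bounded_operator (U : (T -> R[i]) -> (T -> R[i])) : Prop :=
  [/\ forall f, L2 f -> L2 (U f),
      forall f g, L2 f -> L2 g -> f = g %[ae mu] -> U f = U g %[ae mu],
      forall (a : R[i]) f g, L2 f -> L2 g ->
        U (fun x => a * f x + g x) = (fun x => a * U f x + U g x) %[ae mu]
    & exists C : R, forall f, L2 f -> L2norm (U f) <= C * L2norm f].

Definition L2_isomorphism (U : (T -> R[i]) -> (T -> R[i])) : Prop :=
  bounded_operator U /\
  exists V, [/\ bounded_operator V,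
      forall f, L2 f -> V (U f) = f %[ae mu]
    & forall f, L2 f -> U (V f) = f %[ae mu]].

(* A Riesz basis is the image of an orthonormal basis under a bounded linear
   bijection with bounded inverse. *)
Definition riesz_basis (I : eqType) (f : I -> T -> R[i]) : Prop :=
  (forall i, L2 (f i)) /\
  exists e : I -> T -> R[i], orthonormal_basis e /\
  exists U, L2_isomorphism U /\ forall i, U (e i) = f i %[ae mu].

End L2.

Definition lebesgue_on (R : realType) (a b : R) :
    {measure set (measurableTypeR R) -> \bar R} :=
  mrestr (@lebesgue_measure R) (measurable_itv `]a, b[).

(* Main.v *)
Require Import Defs.
From HB Require Import structures.
From mathcomp Require Import all_boot all_order all_algebra.
From mathcomp Require Import complex.
From mathcomp Require Import all_classical all_reals all_analysis.
From mathcomp Require Import measurable_realfun zify ring lra.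

Set Implicit Arguments.
Unset Strict Implicit.
Unset Printing Implicit Defensive.

Import Order.TTheory GRing.Theory Num.Theory.
Import numFieldNormedType.Exports.

Local Open Scope classical_set_scope.
Local Open Scope ring_scope.
Local Open Scope complex_scope.

(** Put nu = 1 / (2 - alpha), which lies in [1/2, 1), and let j_n be the n-th
    positive zero of J_nu, so that omega_n T0 / 2 = j_n. After centring the
    interval, x = 2 t / T0 - 1, the system is a small perturbation of the
    trigonometric one: with beta_n = omega_n T0 / 2 - pi n,
      expi (omega_n t) = sqrt T0 * e_n t * expi (beta_n x),
      e_n t = T0^(-1/2) expi (2 pi n t / T0 + beta_n),
    where (e_n) is an orthonormal basis of L^2(0, T0) because it differs from
    the Fourier basis by unimodular constants. Kadec's 1/4 theorem says that
    such a perturbation is a Riesz basis when sup |beta_n| < pi / 4. So there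
    are two things to prove: Kadec's theorem, and 0 <= j_n - n pi <= b for some
    b < pi / 4 (as omega is odd, only n >= 1 matters).

    Zeros of J_nu. Write J_nu x = K x^nu phi x with phi entire and even. The
    function u = sqrt x * J_nu solves u'' + (1 - mu / x^2) u = 0 with
    mu = nu^2 - 1/4 >= 0; its Pruefer angle theta, tan theta = u / u',
    satisfies theta' = 1 - mu sin^2 theta / x^2 and theta 0 = 0, and the zeros
    of J_nu are the points where theta = n pi, n >= 1 (bessel_zero_phase). The
    defect x - theta x is nonnegative and nondecreasing, and its value at j_n is
    j_n - n pi. For nu = 1 the defect is at most pi / 4 (defect_le_pi4). This is
    the delicate point, since pi / 4 is its exact limit; instead of asymptotic
    expansions the argument uses the closed form 2 / sqrt (1 + p^2) of the
    Laplace transform of 2 J_0. For nu < 1 the angle theta_nu stays above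
    theta_1 by a positive constant far out (compare_gap), so that the
    supremum of the defect is strictly smaller than pi / 4 (defect_lt_pi4).

    Kadec's theorem. One has to bound the norm of
    sum c_n e_n (expi (beta_n x) - 1) by lam * norm of c with lam < 1. The
    factors cos (beta x) - 1 and sin (beta x) are handled by summation by parts:
    both satisfy |g s x - g s' x| <= G s - G s' for 0 <= s' <= s <= pi / 4 and
    |x| <= 1, where G s = 1 - cos s, respectively G s = sin s. Ordering the
    nodes by |beta_n| and telescoping (multiplier_telescope) bounds the
    corresponding sums by G b, whence lam = 1 - cos b + sin b, which is smaller
    than 1 exactly because b < pi / 4 (kadec_bound). The rest is Hilbert space
    theory: the operator sending e_n to the perturbed system is built as a limit
    of partial sums and inverted by a Neumann iteration (partial_synth_limit,
    neumann_inverse), L^2 is complete (L2_complete), and trigonometric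
    polynomials are dense in it (trig_basis), by truncation, approximation by
    continuous functions, and Fejer means computed from equispaced samples. *)

(** * Differential calculus on the line *)

Section Calculus.
Variable R : realType.
Implicit Types (f g F G : R -> R) (x y a b c d : R).

(** The rules der_ below state the derivative as an expression built from those
    of the parts, so that proof search can assemble it; der_eq then leaves a
    single algebraic identity. *)
Lemma der_eq f x d d' : is_derive x 1 f d -> d = d' -> is_derive x 1 f d'.
Proof. by move=> h <-. Qed.

Lemma der_cst c x : is_derive x 1 (fun _ : R => c) 0.
Proof. exact: is_derive_cst. Qed.

Lemma der_id x : is_derive x 1 (fun y : R => y) 1.
Proof. exact: is_derive_id. Qed.

Lemma der_add f g x d d' : is_derive x 1 f d -> is_derive x 1 g d' ->
  is_derive x 1 (fun y => f y + g y) (d + d').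
Proof. by move=> h1 h2; exact: (@is_deriveD _ _ _ f g x 1 d d' h1 h2). Qed.

Lemma der_opp f x d : is_derive x 1 f d -> is_derive x 1 (fun y => - f y) (- d).
Proof. by move=> h1; exact: (@is_deriveN _ _ _ f x 1 d h1). Qed.

Lemma der_mul f g x d d' : is_derive x 1 f d -> is_derive x 1 g d' ->
  is_derive x 1 (fun y => f y * g y) (d * g x + f x * d').
Proof.
move=> h1 h2; apply: der_eq (@is_deriveM _ _ f g x 1 d d' h1 h2) _.
by rewrite /GRing.scale /=; ring.
Qed.

Lemma der_comp f g x d d' : is_derive (g x) 1 f d -> is_derive x 1 g d' ->
  is_derive x 1 (fun y => f (g y)) (d * d').
Proof. by move=> h1 h2; exact: (@is_derive1_comp _ f g x d d' h1 h2). Qed.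

Lemma der_exp f x d n : is_derive x 1 f d ->
  is_derive x 1 (fun y => f y ^+ n) (n%:R * f x ^+ n.-1 * d).
Proof.
move=> h; have -> : (fun y => f y ^+ n) = f ^+ n by apply/funext => y; rewrite fctE.
exact: (@is_deriveX _ _ f n x 1 d h).
Qed.

Lemma der_inv f x d : f x != 0 -> is_derive x 1 f d ->
  is_derive x 1 (fun y => (f y)^-1) (- d / f x ^+ 2).
Proof.
move=> f0 h; apply: der_eq (@is_deriveV _ f x d 1 f0 h) _.
by rewrite /GRing.scale /=; field.
Qed.

Lemma der_cos x : is_derive x 1 (@cos R) (- sin x).
Proof. exact: is_derive_cos. Qed.
Lemma der_sin x : is_derive x 1 (@sin R) (cos x).
Proof. exact: is_derive_sin. Qed.
Lemma der_expR x : is_derive x 1 (@expR R) (expR x).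
Proof. exact: is_derive_expR. Qed.

Lemma der_cont f x d : is_derive x 1 f d -> {for x, continuous f}.
Proof. by case=> h _; apply/differentiable_continuous/derivable1_diffP. Qed.

Lemma der_within f df a b :
  (forall x, a <= x <= b -> is_derive x 1 f (df x)) ->
  {within `[a, b], continuous f}.
Proof.
move=> h; apply: derivable_within_continuous => x; rewrite in_itv/= => xab.
by case: (h x xab).
Qed.

Lemma der_MVT f df a b : a < b ->
  (forall x, a <= x <= b -> is_derive x 1 f (df x)) ->
  exists2 c, a < c < b & f b - f a = df c * (b - a).
Proof.
move=> ab h; have [|c] := @MVT R f df a b ab _ (der_within h).
  by move=> x; rewrite in_itv/= => /andP[ax xb]; apply: h; rewrite !ltW.
by rewrite in_itv/= => cab ->; exists c.
Qed.

Lemma der_ge0_le f df a b : a <= b ->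
  (forall x, a <= x <= b -> is_derive x 1 f (df x)) ->
  (forall x, a < x < b -> 0 <= df x) -> f a <= f b.
Proof.
rewrite le_eqVlt => /predU1P[->//|ab] h h0.
have [c cab E] := der_MVT ab h.
by rewrite -subr_ge0 E mulr_ge0 ?h0 // subr_ge0 ltW.
Qed.

Lemma der_gt0_lt f df a b : a < b ->
  (forall x, a <= x <= b -> is_derive x 1 f (df x)) ->
  (forall x, a < x < b -> 0 < df x) -> f a < f b.
Proof.
move=> ab h h0.
have [c cab E] := der_MVT ab h.
by rewrite -subr_gt0 E mulr_gt0 ?h0 // subr_gt0.
Qed.

Lemma der_le0_le f df a b : a <= b ->
  (forall x, a <= x <= b -> is_derive x 1 f (df x)) ->
  (forall x, a < x < b -> df x <= 0) -> f b <= f a.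
Proof.
move=> ab h h0; rewrite -lerN2.
apply: (@der_ge0_le (fun y => - f y) (fun y => - df y)) => // x xab.
  exact/der_opp/h.
by rewrite oppr_ge0 h0.
Qed.

Lemma der_eq0_eq f df a b : a <= b ->
  (forall x, a <= x <= b -> is_derive x 1 f (df x)) ->
  (forall x, a < x < b -> df x = 0) -> f a = f b.
Proof.
move=> ab h h0; apply/le_anti/andP; split.
  by apply: der_ge0_le ab h _ => x /h0 ->.
by apply: der_le0_le ab h _ => x /h0 ->.
Qed.

(** The half-line is open on the left: F is differentiable at every point
    strictly to the right of a, as needed to start a differential equation at an
    interior point c. *)
Lemma antiderivative f a : (forall x, a <= x -> {for x, continuous f}) ->
  forall c, a < c -> exists F, F c = 0 /\ forall x, a < x -> is_derive x 1 F (f x).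
Proof.
move=> cf c ac.
pose F x : R := \int[lebesgue_measure]_(t in `[a, x]) f t.
exists (fun x => F x - F c); split; first by rewrite subrr.
move=> x ax.
have xu : x < x + 1 by rewrite ltrDl.
have fi : lebesgue_measure.-integrable `[a, x + 1] (EFin \o f).
  apply: continuous_compact_integrable; first exact: segment_compact.
  apply: continuous_in_subspaceT => y; rewrite inE /= in_itv/= => /andP[ay _].
  exact: cf.
have [dF F'] := @continuous_FTC1_closed R f a x (x + 1) xu fi ax (cf _ (ltW ax)).
apply: der_eq; first apply: der_add (der_cst _ _).
  apply: DeriveDef; [exact: dF|by rewrite -derive1E; exact: F'].
by rewrite addr0.
Qed.

Lemma cont_IVT f a b v : a <= b -> (forall x, a <= x <= b -> {for x, continuous f}) ->
  f a <= v <= f b \/ f b <= v <= f a -> exists2 c, a <= c <= b & f c = v.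
Proof.
move=> ab cf h.
have [||c] := @IVT R f a b v ab.
- apply: continuous_in_subspaceT => y; rewrite inE /= in_itv/=; exact: cf.
- case: h => /andP[h1 h2]; rewrite ge_min le_max ?h1 ?h2 ?orbT //=.
by rewrite in_itv/= => cab <-; exists c.
Qed.

End Calculus.

Ltac derive_step :=
  first [ eassumption
        | notypeclasses refine (der_cst _ _) | notypeclasses refine (der_id _)
        | notypeclasses refine (der_add _ _) | notypeclasses refine (der_opp _)
        | notypeclasses refine (der_exp _ _) | notypeclasses refine (der_mul _ _)
        | notypeclasses refine (der_comp (der_cos _) _)
        | notypeclasses refine (der_comp (der_sin _) _)
        | notypeclasses refine (der_comp (der_expR _) _)].
Ltac derive := notypeclasses refine (der_eq _ _); [repeat derive_step|rewrite /=].

Lemma integrable_scale d (X : measurableType d) (R : realType) (mu : {measure set X -> \bar R})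
    (f : X -> R) (D : set X) (M : R) : measurable D ->
  mu.-integrable D (EFin \o f) -> mu.-integrable D (EFin \o (fun x => M * f x)).
Proof.
move=> mD fi; rewrite (_ : _ \o _ = (fun x => M%:E * (EFin \o f) x)%E).
  exact: integrableZl.
by apply/funext => x /=; rewrite EFinM.
Qed.

(** * The entire function behind J_nu and its differential equation *)

Section PowerSeries.
Variable R : realType.
Implicit Types (c : R^nat) (x z : R).

Definition powser c z : R := limn (pseries c z).

(** Coefficients dominated by those of exp: the power series is entire, and the
    class is stable under differentiation. *)
Definition fact_bounded c := forall m, `|c m| <= (m`!%:R)^-1.

Lemma fact_bounded_cvg c z : fact_bounded c -> cvgn (pseries c z).
Proof.
move=> cb; apply: normed_cvg; rewrite /pseries.
apply: (series_le_cvg (v_ := exp_coeff `|z|)).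
- by move=> n; exact: normr_ge0.
- by move=> n; exact: exp_coeff_ge0.
- by move=> n /=; rewrite normrM normrX /exp_coeff /= mulrC ler_wpM2l // exprn_ge0.
- exact: is_cvg_series_exp_coeff.
Qed.

Lemma fact_bounded_diffs c : fact_bounded c -> fact_bounded (pseries_diffs c).
Proof.
move=> cb m; rewrite /pseries_diffs normrM ger0_norm // -ler_pdivlMl ?ltr0n //.
by rewrite (le_trans (cb _)) // factS natrM invfM.
Qed.

Lemma der_powser c z : fact_bounded c ->
  is_derive z 1 (powser c) (powser (pseries_diffs c) z).
Proof.
move=> cb; have cb1 := fact_bounded_diffs cb; have cb2 := fact_bounded_diffs cb1.
apply: (@pseries_snd_diffs _ _ (`|z| + 1)); try exact: fact_bounded_cvg.
by rewrite [ltRHS]ger0_norm ?addr_ge0 // ltrDl.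
Qed.

Lemma powser0 c : powser c 0 = c 0%N.
Proof.
apply: lim_near_cst => //; near=> n.
have n0 : (0 < n)%N by near: n; exact: nbhs_infty_gt.
rewrite /pseries /series /= big_mkord -(prednK n0).
rewrite big_ord_recl expr0 mulr1 big1 ?addr0 // => i _.
by rewrite expr0n mulr0.
Unshelve. all: by end_near. Qed.

End PowerSeries.

Section BesselODE.
Variable (R : realType) (nu : R).
Hypothesis nu_ge0 : 0 <= nu.
Implicit Types x z : R.

(** The rising factorial (nu + 1)(nu + 2)...(nu + m), which is Gamma (m + nu +
    1) / Gamma (nu + 1). *)
Definition poch m : R := \prod_(j < m) (nu + 1 + j%:R).

(** Coefficients, in the variable z = x^2, of Gamma (nu + 1) (2 / x)^nu J_nu x.
    *)
Definition bcoef (m : nat) : R := (-1) ^+ m / (4 ^+ m * m`!%:R * poch m).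

Lemma poch_ge1 m : 1 <= poch m.
Proof.
rewrite /poch; elim: m => [|m IH]; first by rewrite big_ord0.
rewrite big_ord_recr /= mulr_ege1 //.
have := ler0n R m; move: nu_ge0; lra.
Qed.

Lemma bcoef_bounded : fact_bounded bcoef.
Proof.
move=> m; rewrite /bcoef normrM normrX normrN1 expr1n mul1r.
have p0 : 0 < poch m by rewrite (lt_le_trans ltr01) // poch_ge1.
have f0 : 0 < m`!%:R :> R by rewrite ltr0n fact_gt0.
rewrite gtr0_norm ?invr_gt0 ?mulr_gt0 ?exprn_gt0 //.
rewrite lef_pV2 ?posrE ?mulr_gt0 ?exprn_gt0 // -[leLHS]mul1r mulrAC ler_pM2r //.
by rewrite mulr_ege1 ?poch_ge1 // exprn_ege1 // ler1n.
Qed.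

Lemma bcoefS m : 4 * m.+1%:R * (m%:R + nu + 1) * bcoef m.+1 = - bcoef m.
Proof.
rewrite /bcoef /poch big_ord_recr /= -/(poch m) factS natrM !exprS.
have p0 : poch m != 0 by rewrite gt_eqF // (lt_le_trans ltr01) // poch_ge1.
have f0 : m`!%:R != 0 :> R by rewrite pnatr_eq0 -lt0n fact_gt0.
have m1 : m%:R + 1 != 0 :> R by rewrite natr1 pnatr_eq0.
have mn : nu + 1 + m%:R != 0 by rewrite gt_eqF //; have := ler0n R m; move: nu_ge0; lra.
have q0 : 4 ^+ m != 0 :> R by rewrite expf_neq0 // pnatr_eq0.
have -> : m.+1%:R = m%:R + 1 :> R by rewrite natr1.
by move: (4 ^+ m) q0 => q q0; field; rewrite p0 mn f0 q0 m1.
Qed.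

(** The normalised Bessel function, phi x = Gamma (nu + 1) (2 / x)^nu J_nu x.
    Its derivative is x chi x and chi1 is the derivative of chi; factoring out x
    in this way keeps all three entire, with no singularity at 0. *)
Definition phi x := powser bcoef (x ^+ 2).
Definition chi x := 2 * powser (pseries_diffs bcoef) (x ^+ 2).
Definition chi1 x := 4 * x * powser (pseries_diffs (pseries_diffs bcoef)) (x ^+ 2).

Lemma der_phi x : is_derive x 1 phi (x * chi x).
Proof.
apply: der_eq; first apply: der_comp (der_powser _ bcoef_bounded) (der_exp 2 (der_id _)).
by rewrite /chi /=; ring.
Qed.

Lemma der_chi x : is_derive x 1 chi (chi1 x).
Proof.
apply: der_eq; first apply: der_mul (der_cst _ _) (der_comp
  (der_powser _ (fact_bounded_diffs bcoef_bounded)) (der_exp 2 (der_id _))).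
by rewrite /chi1 /=; ring.
Qed.

(** Bessel equation for phi, divided by x. It holds coefficientwise in z = x^2,
    by bcoefS, and passes to the limit of the partial sums. *)
Lemma bessel_ode x : x * chi1 x + (2 * nu + 2) * chi x + phi x = 0.
Proof.
set z := x ^+ 2.
have b1 := fact_bounded_diffs bcoef_bounded; have b2 := fact_bounded_diffs b1.
have E n : 4 * z * pseries (pseries_diffs (pseries_diffs bcoef)) z n +
    4 * (nu + 1) * pseries (pseries_diffs bcoef) z n.+1 + pseries bcoef z n.+1 = 0.
  rewrite /pseries /series /= !mulr_sumr [X in X + _ + _](_ : _ =
     \sum_(0 <= m < n.+1) 4 * (m.+1%:R * m%:R * bcoef m.+1) * z ^+ m).
    rewrite -!big_split big1 //= => m _; rewrite /pseries_diffs.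
    have : bcoef m = - (4 * m.+1%:R * (m%:R + nu + 1) * bcoef m.+1) by rewrite bcoefS opprK.
    by move=> ->; ring.
  rewrite [RHS]big_nat_recl // mulr0 mul0r mulr0 mul0r add0r.
  apply: eq_bigr => m _; rewrite /pseries_diffs exprS; ring.
have L : (4 * z * pseries (pseries_diffs (pseries_diffs bcoef)) z n +
    4 * (nu + 1) * pseries (pseries_diffs bcoef) z n.+1 + pseries bcoef z n.+1) @[n --> \oo] -->
   4 * z * powser (pseries_diffs (pseries_diffs bcoef)) z +
    4 * (nu + 1) * powser (pseries_diffs bcoef) z + powser bcoef z.
  apply: cvgD; first apply: cvgD.
  - by apply: cvgM; [exact: cvg_cst|exact: fact_bounded_cvg].
  - apply: cvgM; first exact: cvg_cst.
    by rewrite (cvg_shiftS (pseries (pseries_diffs bcoef) z)); exact: fact_bounded_cvg.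
  - by rewrite (cvg_shiftS (pseries bcoef z)); exact: fact_bounded_cvg bcoef_bounded.
have : 4 * z * powser (pseries_diffs (pseries_diffs bcoef)) z +
    4 * (nu + 1) * powser (pseries_diffs bcoef) z + powser bcoef z = 0.
  apply/esym; move: L; under eq_fun do rewrite E; move=> /cvg_lim <- //.
  by rewrite lim_cst.
by rewrite /chi1 /chi /phi -/z => <-; rewrite /z; ring.
Qed.

Lemma phi0 : phi 0 = 1.
Proof.
by rewrite /phi expr0n powser0 /bcoef /poch big_ord0 !expr0 fact0 !mul1r invr1.
Qed.

End BesselODE.

(** * Trigonometric facts and the Pruefer angle of the Bessel equation *)

Section Trigonometry.
Variable R : realType.
Implicit Types (x y a w : R) (n : nat).

Lemma sin_natpi n : sin (n%:R * pi) = 0 :> R.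
Proof.
elim: n => [|n IH]; first by rewrite mul0r sin0.
by rewrite -natr1 mulrDl mul1r sinD sinpi IH mulr0 mul0r addr0.
Qed.

Lemma sin_eq0_natpi x : 0 < x -> sin x = 0 ->
  exists2 n, (0 < n)%N & x = n%:R * pi.
Proof.
move=> x0 sx0; have pi0 := pi_gt0 R.
have /andP[h1 h2] := Num.Theory.truncn_itv (ltW (divr_gt0 x0 pi0)).
set n := Num.truncn (x / pi) in h1 h2.
have le1 : n%:R * pi <= x by rewrite -ler_pdivlMr.
have lt2 : x < n%:R * pi + pi by rewrite -{2}[pi]mul1r -mulrDl natr1 -ltr_pdivrMr.
have E : x = n%:R * pi.
  apply/eqP; rewrite eq_le le1 andbT leNgt; apply/negP => lt1.
  have := @sin_gt0_pi R (x - n%:R * pi); rewrite subr_gt0 lt1 ltrBlDl lt2 => /(_ isT).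
  by rewrite sinB sx0 sin_natpi mul0r mulr0 subr0 ltxx.
exists n => //; rewrite lt0n; apply/eqP => n0; move: x0.
by rewrite E n0 mul0r ltxx.
Qed.

Lemma sin_le_between a w : 0 <= a -> a <= w -> w <= pi - a -> sin a <= sin w.
Proof.
move=> a0 aw wa; rewrite -subr_ge0.
have -> : sin w - sin a = 2 * (sin ((w - a) / 2) * cos ((w + a) / 2)).
  have -> : sin w = sin ((w + a) / 2 + (w - a) / 2) by congr sin; field.
  have -> : sin a = sin ((w + a) / 2 - (w - a) / 2) by congr sin; field.
  by rewrite sinD sinB; ring.
rewrite !mulr_ge0 //; first by apply: sin_ge0_pi; lra.
by apply: cos_ge0_pihalf; lra.
Qed.

Lemma cos_pi4 : cos (pi / 4) = sin (pi / 4) :> R.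
Proof.
have -> : sin (pi / 4) = sin (pi / 2 - pi / 4) :> R by congr sin; field.
by rewrite sinB sin_pihalf cos_pihalf mul1r mul0r subr0.
Qed.

(** Turns comparisons of sin and cos below pi / 4 into the sign of a single
    sine. *)
Lemma cos_sub_sin y : cos (pi / 4) * (cos y - sin y) = sin (pi / 4 - y).
Proof.
by rewrite sinB -cos_pi4; ring.
Qed.

End Trigonometry.

Section Energy.
Variable (R : realType) (nu : R).
Hypothesis nu_ge : 1/2 <= nu.
Hypothesis nu_le1 : nu <= 1.
Implicit Types x : R.

Let nu_ge0 : 0 <= nu. Proof. by move: nu_ge; lra. Qed.

Local Notation phi := (phi nu).
Local Notation chi := (chi nu).
Local Notation chi1 := (chi1 nu).

Let dphi := der_phi nu_ge0.
Let dchi := der_chi nu_ge0.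

Lemma x_chi1 x : x * chi1 x = - (2 * nu + 2) * chi x - phi x.
Proof. by have := bessel_ode nu_ge0 x; lra. Qed.

(** phi^2 + phi'^2. It decreases, which bounds phi and phi' by 1, while x^6
    times it increases, so that phi and phi' have no common zero. *)
Definition energy x := phi x ^+ 2 + (x * chi x) ^+ 2.

Lemma der_energy x : is_derive x 1 energy (- (2 * (2 * nu + 1)) * x * chi x ^+ 2).
Proof.
have h1 := dphi x; have h2 := dchi x.
rewrite /energy; derive; rewrite /= !expr1.
have -> : 1 * chi x + x * chi1 x = - (2 * nu + 1) * chi x - phi x by rewrite x_chi1; ring.
ring.
Qed.

Lemma energy_le1 x : 0 <= x -> energy x <= 1.
Proof.
move=> x0; have -> : 1 = energy 0 by rewrite /energy phi0; ring.
apply: (der_le0_le x0) => [y _|y /andP[y0 _]]; first exact: der_energy.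
have k : 0 <= 2 * (2 * nu + 1) by move: nu_ge; lra.
by rewrite -mulrA mulNr oppr_le0 mulr_ge0 // mulr_ge0 ?sqr_ge0 // ltW.
Qed.

Lemma phi_le1 x : 0 <= x -> `|phi x| <= 1.
Proof.
move=> /energy_le1; rewrite /energy => h.
rewrite -(ler_pXn2r (n := 2)) ?nnegrE // expr1n real_normK ?num_real //.
by have := sqr_ge0 (x * chi x); lra.
Qed.

Lemma xchi_le1 x : 0 <= x -> `|x * chi x| <= 1.
Proof.
move=> /energy_le1; rewrite /energy => h.
rewrite -(ler_pXn2r (n := 2)) ?nnegrE // expr1n real_normK ?num_real //.
by have := sqr_ge0 (phi x); lra.
Qed.

Lemma phi_ge x : 0 <= x -> 1 - x <= phi x.
Proof.
move=> x0; suff : phi 0 + 0 <= phi x + x by rewrite phi0; lra.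
apply: (@der_ge0_le _ (fun y => phi y + y) (fun y => y * chi y + 1)) => // y /andP[y0 _].
  by have h := dphi y; derive.
by have := xchi_le1 (ltW y0); rewrite ler_norml; lra.
Qed.

Lemma energy_gt0 x : 0 <= x -> 0 < energy x.
Proof.
move=> x0; rewrite ltNge; apply/negP => Ex.
have xgt0 : 0 < x.
  rewrite lt_neqAle x0 andbT; apply/eqP => x00; move: Ex.
  by rewrite -x00 /energy phi0 mul0r expr1n expr0n /= addr0 ler10.
pose y := Num.min x (1/2).
have y0 : 0 < y by rewrite /y lt_min xgt0 /=; lra.
have yx : y <= x by rewrite /y ge_min lexx.
have y2 : y <= 1/2 by rewrite /y ge_min lexx orbT.
have : y ^+ 6 * energy y <= x ^+ 6 * energy x.
  apply: (@der_ge0_le _ (fun y => y ^+ 6 * energy y)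
     (fun y => y ^+ 5 * (6 * phi y ^+ 2 + (4 - 4 * nu) * (y * chi y) ^+ 2))) => // z /andP[yz _].
    by have h := der_energy z; derive; rewrite /energy /=; ring.
  have z0 : 0 <= z by rewrite (le_trans (ltW y0)) // ltW.
  have := sqr_ge0 (phi z); have := sqr_ge0 (z * chi z) => h1 h2.
  by rewrite mulr_ge0 ?exprn_ge0 // addr_ge0 // mulr_ge0 //; move: nu_le1; lra.
have : 0 < y ^+ 6 * energy y.
  rewrite mulr_gt0 ?exprn_gt0 // /energy ltr_wpDr ?sqr_ge0 // exprn_gt0 //.
  by have := phi_ge (ltW y0); lra.
have : x ^+ 6 * energy x <= 0 by rewrite mulr_ge0_le0 ?exprn_ge0.
lra.
Qed.

(** With u = sqrt x * J_nu, the pair (u, u') is proportional to (x phi x,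
    prufer_g x). The common factor x^(nu - 1/2) has been removed so that both
    components are smooth at 0. *)
Definition prufer_g x := (nu + 1/2) * phi x + x ^+ 2 * chi x.
Definition prufer_r x := (x * phi x) ^+ 2 + prufer_g x ^+ 2.

Lemma prufer_r_gt0 x : 0 < prufer_r x.
Proof.
have [->|x0] := eqVneq x 0.
  rewrite /prufer_r /prufer_g phi0 mul0r expr0n /= mul0r addr0 mulr1 add0r exprn_gt0 //.
  by move: nu_ge; lra.
rewrite lt_neqAle addr_ge0 ?sqr_ge0 // andbT eq_sym; apply/negP.
rewrite paddr_eq0 ?sqr_ge0 // !sqrf_eq0 mulf_eq0 (negbTE x0) /= => /andP[/eqP p0].
rewrite /prufer_g p0 mulr0 add0r mulf_eq0 sqrf_eq0 (negbTE x0) /= => /eqP c0.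
have : energy `|x| = 0.
  rewrite /energy; have -> : phi `|x| = phi x by rewrite /phi real_normK ?num_real.
  have -> : chi `|x| = chi x by rewrite /chi real_normK ?num_real.
  by rewrite p0 c0; ring.
by have := energy_gt0 (normr_ge0 x) => /[swap] ->; rewrite ltxx.
Qed.

(** The constant mu of the normal form u'' + (1 - mu / x^2) u = 0. *)
Definition coupling := nu ^+ 2 - 1/4.

(** The derivative of the Pruefer angle. In this form it is continuous at 0,
    whereas 1 - mu sin^2 theta / x^2 is not defined there. *)
Definition prufer_slope x := 1 - coupling * phi x ^+ 2 / prufer_r x.

Lemma coupling_ge0 : 0 <= coupling.
Proof. by rewrite /coupling; move: nu_ge => *; nra. Qed.
Lemma coupling_le : coupling <= 3/4.
Proof. by rewrite /coupling; move: nu_ge nu_le1 => *; nra. Qed.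

Lemma der_prufer_g x : is_derive x 1 prufer_g (x * ((1/2 - nu) * chi x - phi x)).
Proof.
have h1 := dphi x; have h2 := dchi x.
rewrite /prufer_g; derive => /=.
rewrite (_ : x ^+ 2 * chi1 x = x * (x * chi1 x)); last by ring.
by rewrite x_chi1; field.
Qed.

Lemma der_prufer_r x : exists d, is_derive x 1 prufer_r d.
Proof.
by eexists; have h1 := dphi x; have h2 := der_prufer_g x; rewrite /prufer_r; repeat derive_step.
Qed.

Lemma prufer_slope_cont x : {for x, continuous prufer_slope}.
Proof.
have [d h2] := der_prufer_r x; have h1 := dphi x.
have r0 : prufer_r x != 0 by rewrite gt_eqF // prufer_r_gt0.
exact: (der_cont (der_add (der_cst 1 x) (der_opp
  (der_mul (der_mul (der_cst coupling x) (der_exp 2 h1)) (der_inv r0 h2))))).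
Qed.

(** The differential equation is required a little to the left of 0 as well, so
    that the derivative at 0 is two-sided. *)
Definition is_phase (th : R -> R) :=
  th 0 = 0 /\ forall x, -1 < x -> is_derive x 1 th (prufer_slope x).

Lemma phase_exists : exists th, is_phase th.
Proof.
have [|F [F0 dF]] := @antiderivative R prufer_slope (-1) _ 0 (ltrN10 R).
  by move=> x _; exact: prufer_slope_cont.
by exists F.
Qed.

Section Phase.
Variable th : R -> R.
Hypothesis thP : is_phase th.

Let dth x : 0 <= x -> is_derive x 1 th (prufer_slope x).
Proof. by move=> x0; apply: thP.2; rewrite (lt_le_trans (ltrN10 R)). Qed.

(** The cross product D of (x phi, g) with (sin theta, cos theta) vanishes at 0,
    and D^2 / r has zero derivative, so D vanishes identically. *)
Lemma phase_tan x : 0 <= x -> x * phi x * cos (th x) = prufer_g x * sin (th x).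
Proof.
move=> x0; apply/eqP; rewrite -subr_eq0 -sqrf_eq0; apply/eqP.
pose D y := y * phi y * cos (th y) - prufer_g y * sin (th y).
suff : D x ^+ 2 * (prufer_r x)^-1 = 0.
  by move/eqP; rewrite mulf_eq0 invr_eq0 (gt_eqF (prufer_r_gt0 x)) orbF => /eqP.
have <- : D 0 ^+ 2 * (prufer_r 0)^-1 = 0.
  by rewrite /D thP.1 sin0 cos0 mul0r mul0r mulr0 subrr expr0n mul0r.
apply/esym/(@der_eq0_eq _ (fun y => D y ^+ 2 * (prufer_r y)^-1) (fun=> 0)) => // y /andP[y0 _].
have h1 := dphi y; have h2 := der_prufer_g y; have h3 := dth y0.
have r0 : prufer_r y != 0 by rewrite gt_eqF // prufer_r_gt0.
rewrite /D; notypeclasses refine (der_eq _ _).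
  notypeclasses refine (der_mul (der_exp 2 _) (der_inv r0 _)); first by repeat derive_step.
  by rewrite /prufer_r; repeat derive_step.
rewrite /= /prufer_slope /coupling /prufer_r /prufer_g in r0 *.
field.
rewrite (_ : _ + _ = 4 * ((y * phi y) ^+ 2 + ((nu + 1 / 2) * phi y + y ^+ 2 * chi y) ^+ 2)).
  by rewrite mulf_neq0.
by field.
Qed.

Lemma phase_sin2 x : 0 <= x -> sin (th x) ^+ 2 * prufer_r x = (x * phi x) ^+ 2.
Proof.
move=> /phase_tan h; have c2 := cos2Dsin2 (th x).
rewrite /prufer_r mulrDr -!exprMn [X in _ + X ^+ 2]mulrC -h exprMn -[RHS]mul1r -c2.
ring.
Qed.

Lemma slope_sin x : 0 < x -> prufer_slope x = 1 - coupling / x ^+ 2 * sin (th x) ^+ 2.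
Proof.
move=> x0; have r0 : prufer_r x != 0 by rewrite gt_eqF // prufer_r_gt0.
have -> : sin (th x) ^+ 2 = (x * phi x) ^+ 2 / prufer_r x by rewrite -phase_sin2 ?ltW // mulfK.
by rewrite /prufer_slope; field; rewrite r0 gt_eqF.
Qed.

Lemma phi_eq0_sin x : 0 < x -> (phi x = 0 <-> sin (th x) = 0).
Proof.
move=> x0; have H := phase_sin2 (ltW x0); split=> h.
  move: H; rewrite h mulr0 expr0n /= => /eqP.
  by rewrite mulf_eq0 (gt_eqF (prufer_r_gt0 x)) orbF sqrf_eq0 => /eqP.
move: H; rewrite h expr0n mul0r => /esym/eqP.
by rewrite sqrf_eq0 mulf_eq0 gt_eqF //= => /eqP.
Qed.

Lemma slope_le1 x : prufer_slope x <= 1.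
Proof.
rewrite /prufer_slope gerBl.
exact: (divr_ge0 (mulr_ge0 coupling_ge0 (sqr_ge0 _)) (ltW (prufer_r_gt0 _))).
Qed.

(** x - theta x is nondecreasing because theta' <= 1. *)
Lemma defect_homo x y : 0 <= x -> x <= y -> x - th x <= y - th y.
Proof.
move=> x0 xy; apply: (@der_ge0_le _ (fun z => z - th z) (fun z => 1 - prufer_slope z)) => // z /andP[xz _].
  by have h := dth (le_trans x0 xz); derive.
by rewrite subr_ge0 slope_le1.
Qed.

Lemma phase_le x : 0 <= x -> th x <= x.
Proof. by move=> x0; have := defect_homo (lexx 0) x0; rewrite thP.1; lra. Qed.

Lemma phi_gt0 x : 0 <= x -> x < 1 -> 0 < phi x.
Proof. by move=> /phi_ge; lra. Qed.

(** Near 0 the pair (x phi, g) is dominated by g, which is about (nu + 1/2), and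
    mu < (nu + 1/2)^2; this makes theta' positive on [0, 1/10]. *)
Lemma phase_gt0_early : 0 < th (1/10).
Proof.
rewrite -[ltLHS]thP.1.
apply: (@der_gt0_lt _ th prufer_slope); [lra|by move=> x /andP[x0 _]; exact: dth|].
move=> x /andP[x0 x1]; rewrite /prufer_slope subr_gt0 ltr_pdivrMr ?prufer_r_gt0 // mul1r.
rewrite /prufer_r ltr_wpDl ?sqr_ge0 //.
have p1 := phi_ge (ltW x0); have /ler_normlP[_ p2] := phi_le1 (ltW x0).
have /ler_normlP[q1 _] := xchi_le1 (ltW x0).
have q : - (1/10) <= x ^+ 2 * chi x by nra.
have g1 : (nu + 1/2) * (9/10) - 1/10 <= prufer_g x.
  by rewrite /prufer_g; move: nu_ge => n1; nra.
have p3 : phi x ^+ 2 <= 1 by nra.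
have c0 := coupling_ge0.
have : coupling < ((nu + 1/2) * (9/10) - 1/10) ^+ 2.
  by rewrite /coupling; move: nu_ge nu_le1 => n1 n2; nra.
have : ((nu + 1/2) * (9/10) - 1/10) ^+ 2 <= prufer_g x ^+ 2.
  by rewrite ler_pXn2r ?nnegrE //; move: nu_ge; lra.
nra.
Qed.

(** Between 1/10 and 9/10 the angle cannot return to 0, since phi has no zero
    below 1. *)
Lemma phase_gt0 : 0 < th (9/10).
Proof.
rewrite ltNge; apply/negP => h.
have [|||c /andP[c1 c2] cth] := @cont_IVT _ th (1/10) (9/10) 0.
- by lra.
- by move=> x /andP[x0 _]; apply: (der_cont (dth _)); lra.
- by right; rewrite h ltW // phase_gt0_early.
have c0 : 0 < c by lra.
have : phi c = 0 by apply/phi_eq0_sin => //; rewrite cth sin0.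
by have := @phi_gt0 c (ltW c0); lra.
Qed.

(** mu <= 3/4 < (9/10)^2, which is why the zeros are located beyond 9/10. *)
Lemma slope_gt0 x : 9/10 <= x -> 0 < prufer_slope x.
Proof.
move=> x1; have x0 : 0 < x by lra.
rewrite slope_sin // subr_gt0.
have s1 : sin (th x) ^+ 2 <= 1 by have := sqr_ge0 (cos (th x)); have := cos2Dsin2 (th x); lra.
rewrite mulrAC ltr_pdivrMr ?exprn_gt0 // mul1r.
have := coupling_le; have := coupling_ge0; have := sqr_ge0 (sin (th x)) => a b c.
by nra.
Qed.

Lemma phase_lt x y : 9/10 <= x -> x < y -> th x < th y.
Proof.
move=> x1 xy; apply: (@der_gt0_lt _ th prufer_slope) => // z /andP[xz _].
  by apply: dth; lra.
by apply: slope_gt0; lra.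
Qed.

(** The constant is 9/10 + (3/4) / (9/10): beyond 9/10 one integrates 1 - theta'
    <= mu / x^2 to infinity. *)
Lemma defect_le x : 0 <= x -> x - th x <= 26/15.
Proof.
move=> x0; have [x1|/ltW x1] := leP x (9/10).
  by have := defect_homo x0 x1; have := phase_gt0; lra.
have : x - th x + coupling * x^-1 <= 9/10 - th (9/10) + coupling * (9/10)^-1.
  apply: (@der_le0_le _ (fun z => z - th z + coupling * z^-1)
    (fun z => 1 - prufer_slope z + coupling * (-1 / z ^+ 2))) => // z /andP[z1 z2].
    have z0 : 0 <= z by lra.
    have h := dth z0; have zn0 : z != 0 by lra.
    notypeclasses refine (der_eq (der_add (der_add (der_id z) (der_opp h))
      (der_mul (der_cst coupling z) (der_inv zn0 (der_id z)))) _).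
    by rewrite mul0r add0r.
  have z0 : 0 < z by lra.
  rewrite slope_sin //.
  have s1 : sin (th z) ^+ 2 <= 1 by have := sqr_ge0 (cos (th z)); have := cos2Dsin2 (th z); lra.
  have : 0 <= coupling / z ^+ 2 by rewrite divr_ge0 ?coupling_ge0 ?sqr_ge0.
  move=> k0; rewrite (_ : _ + _ = coupling / z ^+ 2 * (sin (th z) ^+ 2 - 1)); last by ring.
  by rewrite mulr_ge0_le0 // subr_le0.
have : 0 <= coupling * x^-1 by rewrite mulr_ge0 ?coupling_ge0 ?invr_ge0.
have := coupling_le; have := phase_gt0; lra.
Qed.

(** theta is at most 9/10 at 9/10, and exceeds n pi at n pi + 2 because the
    defect is smaller than 2. *)
Lemma phase_hits n : (0 < n)%N -> exists2 z, 9/10 < z & th z = n%:R * pi.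
Proof.
move=> n0; have p2 := pi_ge2 R.
have n1 : 1 <= n%:R :> R by rewrite ler1n.
have pn : pi <= n%:R * pi :> R by rewrite ler_peMl // pi_ge0.
have t1 : th (9/10) <= 9/10 by apply: phase_le; lra.
have t2 : n%:R * pi + 2 - th (n%:R * pi + 2) <= 26/15 by apply: defect_le; lra.
have [|||c /andP[c1 c2] cth] := @cont_IVT _ th (9/10) (n%:R * pi + 2) (n%:R * pi).
- by lra.
- by move=> x /andP[x0 _]; apply: (der_cont (dth _)); lra.
- by left; apply/andP; split; lra.
exists c => //; rewrite lt_neqAle c1 andbT; apply/eqP => E; move: cth; rewrite -E; lra.
Qed.

Lemma phi_eq0 x : 0 < x -> phi x = 0 -> 9/10 < x /\ exists2 n, (0 < n)%N & th x = n%:R * pi.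
Proof.
move=> x0 px; have x1 : 9/10 < x.
  by rewrite ltNge; apply/negP => h; have := @phi_gt0 x (ltW x0); rewrite px; lra.
split=> //; apply: sin_eq0_natpi; last by apply/phi_eq0_sin.
by have := phase_gt0; have := @phase_lt (9/10) x (lexx _) x1; lra.
Qed.

End Phase.
End Energy.

(** * Laplace transforms on the half-line *)

Section HalfLine.
Variable R : realType.
Local Notation leb := (@lebesgue_measure R).
Implicit Types (k F f : R -> R) (x a M e d : R).

Lemma der_expRN a x : is_derive x 1 (fun y => expR (- (a * y))) (- (a * expR (- (a * x)))).
Proof. by derive; ring. Qed.

Lemma cvg_expRN a : 0 < a -> expR (- (a * x)) @[x --> +oo] --> (0 : R).
Proof.
move=> a0; apply: (@cvg_comp _ _ _ (fun x => a * x) (fun y => expR (- y)) _ (pinfty_nbhs R) _ _ (@cvgr_expR R)).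
by apply: gt0_cvgMry => //; exact: cvg_id.
Qed.

Lemma within_halfline f : (forall x, {for x, continuous f}) ->
  {within `[(0:R), +oo[, continuous f}.
Proof. by move=> cf; apply: continuous_subspaceT => x; exact: cf. Qed.

Lemma measurable_halfline f : {within `[(0:R), +oo[, continuous f} ->
  measurable_fun `[(0:R), +oo[ f.
Proof. by move=> cf; exact: subspace_continuous_measurable_fun. Qed.

Lemma integral_expRN a : 0 < a ->
  leb.-integrable `[(0:R), +oo[ (fun x => (expR (- (a * x)))%:E) /\
  \int[leb]_(x in `[(0:R), +oo[) expR (- (a * x)) = a^-1.
Proof.
move=> a0; pose F x := - a^-1 * expR (- (a * x)).
have dF x : is_derive x 1 F (expR (- (a * x))).
  apply: der_eq (der_mul (der_cst (- a^-1) x) (der_expRN a x)) _.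
  by field; lra.
have cf : {within `[(0:R), +oo[, continuous (fun x => expR (- (a * x)))}.
  by apply: within_halfline => x; exact: der_cont (der_expRN a x).
have E : (\int[leb]_(x in `[0%R, +oo[) (expR (- (a * x)))%:E = (a^-1)%:E)%E.
  rewrite (@ge0_continuous_FTC2y _ _ F _ 0).
  - by rewrite /F mulr0 oppr0 expR0 mulr1 -EFinB sub0r opprK.
  - by move=> x _; exact: expR_ge0.
  - exact: cf.
  - rewrite -(mulr0 (- a^-1)); apply: cvgM; [exact: cvg_cst|exact: cvg_expRN].
  - by move=> x _; case: (dF x).
  - by apply: cvg_at_right_filter; exact: (der_cont (dF 0)).
  - by move=> x _; rewrite derive1E; case: (dF x).
split; last by rewrite /Rintegral E.
apply/integrableP; split; first by apply/measurable_EFinP; exact: measurable_halfline.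
under eq_integral => x _ do rewrite gee0_abs ?lee_fin ?expR_ge0 //.
by rewrite E ltry.
Qed.

Lemma integrable_expbound f a M : 0 < a -> {within `[(0:R), +oo[, continuous f} ->
  (forall x, 0 <= x -> `|f x| <= M * expR (- (a * x))) ->
  leb.-integrable `[(0:R), +oo[ (EFin \o f).
Proof.
move=> a0 cf fM; have [ie _] := integral_expRN a0.
apply: (@le_integrable _ _ _ leb _ _ _ (fun x => (M * expR (- (a * x)))%:E)) => //.
- by apply/measurable_EFinP; exact: measurable_halfline.
- move=> x; rewrite /= in_itv/= andbT => x0; rewrite lee_fin.
  by rewrite (le_trans (fM x x0)) // ler_norm.
- exact: (integrable_scale M _ ie).
Qed.

(** The fundamental theorem for integrands without sign: adding M exp (- a x)
    makes the integrand nonnegative, for which the one-signed version applies.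
    *)
Lemma halfline_FTC F f a M : 0 < a -> {within `[(0:R), +oo[, continuous f} ->
  (forall x, 0 <= x -> `|f x| <= M * expR (- (a * x))) ->
  F x @[x --> +oo] --> 0 -> (forall x, 0 < x -> is_derive x 1 F (f x)) ->
  F x @[x --> 0^'+] --> F 0 ->
  \int[leb]_(x in `[(0:R), +oo[) f x = - F 0.
Proof.
move=> a0 cf fM Fy dF F0.
have [ie E] := integral_expRN a0.
have ifM := integrable_expbound a0 cf fM.
have cM : {within `[(0:R), +oo[, continuous (fun x => M * expR (- (a * x)))}.
  apply: within_halfline => x.
  exact: (der_cont (der_mul (der_cst M x) (der_expRN a x))).
have iM : leb.-integrable `[(0:R), +oo[ (EFin \o (fun x => M * expR (- (a * x)))).
  exact: (integrable_scale M _ ie).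
pose G x := F x + - (M / a) * expR (- (a * x)).
have dG x : 0 < x -> is_derive x 1 G (f x + M * expR (- (a * x))).
  move=> x0; notypeclasses refine (der_eq (der_add (dF x x0)
    (der_mul (der_cst (- (M / a)) x) (der_expRN a x))) _).
  by field; lra.
have : \int[leb]_(x in `[(0:R), +oo[) (f x + M * expR (- (a * x))) = 0 - G 0.
  apply: Rintegral_ge0_continuous_FTC2y => //.
  - by move=> x /fM; rewrite ler_norml; lra.
  - by move=> x; apply: cvgD; [exact: cf|exact: cM].
  - rewrite -[0](addr0 0); apply: cvgD => //; rewrite -(mulr0 (- (M / a))).
    by apply: cvgM; [exact: cvg_cst|exact: cvg_expRN].
  - by move=> x x0; case: (dG x x0).
  - apply: cvgD => //; apply: cvg_at_right_filter.
    exact: (der_cont (der_mul (der_cst (- (M / a)) 0) (der_expRN a 0))).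
  - by move=> x; rewrite in_itv/= andbT => x0; rewrite derive1E; case: (dG x x0).
rewrite RintegralD // RintegralZl // E /G mulr0 oppr0 expR0 mulr1; lra.
Qed.

(** Subexponential growth: exactly what makes the Laplace integral converge for
    every positive argument. *)
Definition slow k := forall d, 0 < d -> exists M, forall x, 0 <= x -> `|k x| <= M * expR (d * x).

Lemma slow_bounded k C : (forall x, 0 <= x -> `|k x| <= C) -> slow k.
Proof.
move=> kC d d0; exists C => x x0; rewrite (le_trans (kC x x0)) //.
rewrite ler_peMr ?(le_trans (normr_ge0 _) (kC x x0)) //.
by rewrite -expR0 ler_expR mulr_ge0 // ltW.
Qed.

Lemma slow_id : slow (fun x => x).
Proof.
move=> d d0; exists d^-1 => x x0; rewrite ger0_norm // -ler_pdivrMl ?invr_gt0 // invrK.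
by rewrite (le_trans _ (expR_ge1Dx _)) // lerDr.
Qed.

Lemma slow_add k l : slow k -> slow l -> slow (fun x => k x + l x).
Proof.
move=> sk sl d d0; have [M1 h1] := sk d d0; have [M2 h2] := sl d d0.
exists (M1 + M2) => x x0; rewrite (le_trans (ler_normD _ _)) // mulrDl.
by rewrite lerD ?h1 ?h2.
Qed.

Lemma slow_opp k : slow k -> slow (fun x => - k x).
Proof.
by move=> sk d d0; have [M1 h1] := sk d d0; exists M1 => x x0; rewrite normrN h1.
Qed.

Lemma slow_mul k l : slow k -> slow l -> slow (fun x => k x * l x).
Proof.
move=> sk sl d d0; have d2 : 0 < d / 2 by lra.
have [M1 h1] := sk _ d2; have [M2 h2] := sl _ d2.
exists (M1 * M2) => x x0; rewrite normrM.
have -> : M1 * M2 * expR (d * x) = (M1 * expR (d / 2 * x)) * (M2 * expR (d / 2 * x)).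
  have -> : d * x = d / 2 * x + d / 2 * x by field.
  by rewrite expRD; ring.
by rewrite ler_pM ?h1 ?h2.
Qed.

Lemma slow_cos : slow (@cos R).
Proof. by apply: (@slow_bounded _ 1) => x _; exact: cos_max. Qed.
Lemma slow_sin : slow (@sin R).
Proof. by apply: (@slow_bounded _ 1) => x _; exact: sin_max. Qed.

(** Continuous of subexponential growth; stable under sums and products, so that
    the hypotheses of the Laplace rules are checked by following the expression.
    *)
Definition tame k := (forall x, {for x, continuous k}) /\ slow k.

Lemma tame_id : tame (fun x => x).
Proof. by split; [move=> x; exact: der_cont (der_id x)|exact: slow_id]. Qed.
Lemma tame_cos : tame (@cos R).
Proof. by split; [move=> x; exact: der_cont (der_cos x)|exact: slow_cos]. Qed.
Lemma tame_sin : tame (@sin R).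
Proof. by split; [move=> x; exact: der_cont (der_sin x)|exact: slow_sin]. Qed.
Lemma tame_add k l : tame k -> tame l -> tame (fun x => k x + l x).
Proof.
move=> [ck sk] [cl sl]; split; last exact: slow_add.
by move=> x; exact: continuousD (ck x) (cl x).
Qed.
Lemma tame_opp k : tame k -> tame (fun x => - k x).
Proof.
move=> [ck sk]; split; last exact: slow_opp.
by move=> x; exact: continuousN (ck x).
Qed.
Lemma tame_mul k l : tame k -> tame l -> tame (fun x => k x * l x).
Proof.
move=> [ck sk] [cl sl]; split; last exact: slow_mul.
by move=> x; exact: continuousM (ck x) (cl x).
Qed.

Definition laplace k e := \int[leb]_(x in `[(0:R), +oo[) (k x * expR (- (e * x))).

Lemma slow_expbound k e : slow k -> 0 < e -> exists M, forall x, 0 <= x ->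
  `|k x * expR (- (e * x))| <= M * expR (- (e / 2 * x)).
Proof.
move=> sk e0; have e2 : 0 < e / 2 by lra.
have [M h] := sk _ e2; exists M => x x0; rewrite normrM (ger0_norm (expR_ge0 _)).
have -> : - (e / 2 * x) = e / 2 * x + - (e * x) by field.
by rewrite expRD mulrA ler_wpM2r ?expR_ge0 ?h.
Qed.

Lemma cont_laplace k e : (forall x, {for x, continuous k}) ->
  {within `[(0:R), +oo[, continuous (fun x => k x * expR (- (e * x)))}.
Proof.
move=> ck; apply: within_halfline => x; apply: continuousM; first exact: ck.
exact: (der_cont (der_expRN e x)).
Qed.

Lemma laplace_integrable k e : tame k -> 0 < e ->
  leb.-integrable `[(0:R), +oo[ (EFin \o (fun x => k x * expR (- (e * x)))).
Proof.
move=> [ck sk] e0; have [M h] := slow_expbound sk e0.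
by apply: (integrable_expbound _ (cont_laplace ck) h); lra.
Qed.

Lemma laplaceD k l e : tame k -> tame l -> 0 < e ->
  laplace (fun x => k x + l x) e = laplace k e + laplace l e.
Proof.
move=> tk tl e0; rewrite /laplace -RintegralD //; last 2 first.
- exact: laplace_integrable.
- exact: laplace_integrable.
by apply: eq_Rintegral => x _; rewrite mulrDl.
Qed.

Lemma laplaceN k e : tame k -> 0 < e ->
  laplace (fun x => - k x) e = - laplace k e.
Proof.
move=> tk e0; rewrite /laplace -mulN1r -RintegralZl //; last exact: laplace_integrable.
by apply: eq_Rintegral => x _; rewrite mulNr mulN1r.
Qed.

Lemma laplace_derivative k k1 e : (forall x, is_derive x 1 k (k1 x)) ->
  tame k -> tame k1 -> 0 < e ->
  laplace k1 e = e * laplace k e - k 0.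
Proof.
move=> dk tk tk1 e0; have [ck sk] := tk; have [ck1 sk1] := tk1.
have e2 : 0 < e / 2 by lra.
pose F x := k x * expR (- (e * x)).
pose f x := (k1 x - e * k x) * expR (- (e * x)).
have cl x : {for x, continuous (fun x => k1 x - e * k x)}.
  by apply: continuousB; [exact: ck1|apply: continuousM; [exact: cst_continuous|exact: ck]].
have sl : slow (fun x => k1 x - e * k x).
  apply: (slow_add sk1 (slow_opp (slow_mul _ sk))).
  by apply: (@slow_bounded _ `|e|) => x _.
have dF x : is_derive x 1 F (f x).
  by apply: der_eq (der_mul (dk x) (der_expRN e x)) _; rewrite /f; ring.
have [M hM] := slow_expbound sl e0.
have [N hN] := slow_expbound sk e0.
have Fy : F x @[x --> +oo] --> 0.
  apply: norm_cvg0.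
  apply: (@squeeze_cvgr _ _ _ _ (cst 0) (fun x => N * expR (- (e / 2 * x)))).
  - near=> x; rewrite normr_ge0 /= hN //; near: x; exact: nbhs_pinfty_ge.
  - exact: cvg_cst.
  - by rewrite -(mulr0 N); apply: cvgM; [exact: cvg_cst|exact: cvg_expRN].
have : \int[leb]_(x in `[(0:R), +oo[) f x = - F 0.
  apply: (@halfline_FTC F f (e / 2) M) => //.
  - exact: cont_laplace.
  - by apply: cvg_at_right_filter; exact: (der_cont (dF 0)).
have -> : \int[leb]_(x in `[(0:R), +oo[) f x = laplace k1 e - e * laplace k e.
  rewrite /laplace -RintegralZl //; last exact: laplace_integrable.
  rewrite -RintegralB //; first by apply: eq_Rintegral => x _; rewrite /f; ring.
  - exact: laplace_integrable.
  - by apply: integrable_scale => //; exact: laplace_integrable.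
by rewrite /F mulr0 oppr0 expR0 mulr1; lra.
Unshelve. all: by end_near. Qed.

(** Differentiation under the integral sign: on (e / 2, e + 1) the derivative of
    the integrand is dominated by |x k x| exp (- e x / 2). *)
Lemma der_laplace k e : tame k -> 0 < e ->
  is_derive e 1 (laplace k) (- laplace (fun x => x * k x) e).
Proof.
move=> tk e0; have [ck sk] := tk.
have txk := tame_mul tame_id tk; have [cxk sxk] := txk.
have e2 : 0 < e / 2 by lra.
pose f (e x : R) := k x * expR (- (e * x)).
have df (d x : R) : is_derive d 1 (f ^~ x) (- (x * k x * expR (- (d * x)))).
  rewrite /f; derive; ring.
have Ie : `]e / 2, e + 1[%classic e by rewrite /= in_itv/=; apply/andP; split; lra.
have intf d : `]e / 2, e + 1[%classic d -> leb.-integrable `[(0:R), +oo[ (EFin \o f d).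
  by rewrite /= in_itv/= => /andP[d0 _]; apply: laplace_integrable => //; lra.
have derf (d x : R) : `]e / 2, e + 1[%classic d -> `[(0:R), +oo[%classic x -> derivable (f ^~ x) d 1.
  by move=> _ _; case: (df d x).
pose G x := `|x * k x| * expR (- (e / 2 * x)).
have G0 x : 0 <= G x by rewrite mulr_ge0 ?expR_ge0.
have intG : leb.-integrable `[(0:R), +oo[ (EFin \o G).
  apply: laplace_integrable e2; split; first by move=> x; exact: (cvg_norm (cxk x)).
  by move=> d d0; have [M h] := sxk d d0; exists M => x x0; rewrite normr_id h.
have Gub (d x : R) : `]e / 2, e + 1[%classic d -> `[(0:R), +oo[%classic x -> `|partial1of2 f d x| <= G x.
  rewrite /= !in_itv/= andbT => /andP[d1 _] x0; rewrite partial1of2E.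
  have [_ ->] := df d x.
  rewrite normrN normrM (ger0_norm (expR_ge0 _)) /G ler_wpM2l // ler_expR lerN2.
  by rewrite ler_wpM2r // ltW.
apply: DeriveDef.
  exact: (derivable_under_integral _ Ie intf derf G0 intG Gub).
rewrite -derive1E (differentiation_under_integral _ Ie intf derf G0 intG Gub) //.
rewrite /laplace -mulN1r -RintegralZl //; last exact: laplace_integrable.
apply: eq_Rintegral => x _; rewrite partial1of2E; have [_ ->] := df e x.
by rewrite mulN1r.
Qed.

Lemma laplace_cvg0 k : tame k ->
  laplace k e @[e --> +oo] --> 0.
Proof.
move=> tk; have [ck sk] := tk; have [M h] := sk 1 ltr01.
apply: norm_cvg0.
apply: (@squeeze_cvgr _ _ _ _ (cst 0) (fun e => M * (e - 1)^-1)).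
- near=> e; rewrite normr_ge0 /=.
  have e1 : 1 < e by near: e; exact: nbhs_pinfty_gt.
  have e0 : 0 < e - 1 by lra.
  have e00 : 0 < e by lra.
  have ik := laplace_integrable tk e00.
  rewrite (le_trans (le_normr_Rintegral _ ik)) //.
  have [ie <-] := integral_expRN e0.
  rewrite -RintegralZl //; apply: le_Rintegral => //.
  + by apply/integrable_norm.
  + exact: integrable_scale.
  + move=> x; rewrite /= in_itv/= andbT => x0.
    rewrite normrM (ger0_norm (expR_ge0 _)).
    have -> : - ((e - 1) * x) = 1 * x + - (e * x) by ring.
    by rewrite expRD mulrA ler_wpM2r ?expR_ge0 ?h.
- exact: cvg_cst.
- rewrite -(mulr0 M); apply: cvgM; first exact: cvg_cst.
  apply/gtr0_cvgV0; first by near=> e; rewrite subr_gt0; near: e; exact: nbhs_pinfty_gt.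
  exact: cvg_addrr.
Unshelve. all: by end_near. Qed.

End HalfLine.

(** * Order 1: the defect of the angle is at most pi / 4 *)

Section OrderOne.
Variable R : realType.
Implicit Types x e : R.

Local Notation phi := (@phi R 1).
Local Notation chi := (@chi R 1).
Local Notation chi1 := (@chi1 R 1).
Local Notation g := (@prufer_g R 1).
Local Notation r2 := (@prufer_r R 1).

Let one_ge : 1/2 <= 1 :> R. Proof. lra. Qed.
Let dphi : forall x, is_derive x 1 phi (x * chi x) := der_phi ler01.
Let dchi : forall x, is_derive x 1 chi (chi1 x) := der_chi ler01.

(** For nu = 1, phi x = 2 J_1 x / x, so that two_J0 and two_xJ1 are 2 J_0 and 2
    x J_1. They satisfy (x J_1)' = x J_0 and J_0' = - J_1, which is all that the
    Laplace computation uses. *)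
Definition two_J0 x := 2 * phi x + x ^+ 2 * chi x.
Definition two_xJ1 x := x ^+ 2 * phi x.

Lemma der_two_xJ1 x : is_derive x 1 two_xJ1 (x * two_J0 x).
Proof. have h := dphi x; rewrite /two_xJ1 /two_J0; derive; ring. Qed.

Lemma der_two_J0 x : is_derive x 1 two_J0 (- (x * phi x)).
Proof.
have h1 := dphi x; have h2 := dchi x; rewrite /two_J0; derive.
rewrite [x ^+ 2]expr2 -(mulrA x x (chi1 x)) (x_chi1 one_ge); ring.
Qed.

Let tphi : tame phi.
Proof.
split; first by move=> x; exact: der_cont (dphi x).
by apply: (@slow_bounded _ _ 1) => x; exact: phi_le1.
Qed.

Let txchi : tame (fun x => x * chi x).
Proof.
split; first by move=> x; exact: der_cont (der_mul (der_id x) (dchi x)).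
by apply: (@slow_bounded _ _ 1) => x; exact: xchi_le1.
Qed.

Let tid := @tame_id R.
Let tcos := @tame_cos R.
Let tsin := @tame_sin R.

Let tv : tame two_J0.
Proof.
have -> : two_J0 = (fun x => (phi x + phi x) + x * (x * chi x)).
  by apply/funext => x; rewrite /two_J0; ring.
exact: tame_add (tame_add tphi tphi) (tame_mul tid txchi).
Qed.

Let tw : tame two_xJ1.
Proof.
have -> : two_xJ1 = (fun x => x * x * phi x) by apply/funext => x; rewrite /two_xJ1; ring.
exact: tame_mul (tame_mul tid tid) tphi.
Qed.

Let w0 : two_xJ1 0 = 0. Proof. by rewrite /two_xJ1; ring. Qed.

Ltac tam := lazymatch goal with
  | |- tame (fun x => @?k x + @?l x) => refine (@tame_add _ k l _ _); tam
  | |- tame (fun x => @?k x * @?l x) => refine (@tame_mul _ k l _ _); tam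
  | |- tame (fun x => - @?k x) => refine (@tame_opp _ k _); tam
  | |- tame (fun x => two_J0 x) => exact tv
  | |- tame (fun x => two_xJ1 x) => exact tw
  | |- tame (fun x => cos x) => exact tcos
  | |- tame (fun x => sin x) => exact tsin
  | |- tame (fun x => x) => exact tid
  | |- tame _ => exact tphi
  end.

Definition laplace_cos e := laplace (fun x => two_J0 x * cos x) e.
Definition laplace_sin e := laplace (fun x => two_J0 x * sin x) e.

(** Integration by parts in the transforms of two_J0 and two_xJ1 times cos or
    sin. Write C for laplace_cos and S for laplace_sin. The first two equations
    give the derivatives of C and S; together the four say that V = C + i S, the
    transform of 2 J_0 at p = e - i, satisfies V' = - p V / (1 + p^2). *)
Lemma laplace_system e : 0 < e ->
  let P := laplace (fun x => two_xJ1 x * cos x) e in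
  let Q := laplace (fun x => two_xJ1 x * sin x) e in
  [/\ laplace (fun x => x * (two_J0 x * cos x)) e = e * P + Q,
      laplace (fun x => x * (two_J0 x * sin x)) e = e * Q - P,
      laplace_cos e = e ^+ 2 * P + 2 * e * Q & laplace_sin e = e ^+ 2 * Q - 2 * e * P].
Proof.
move=> e0 P Q.
set X := laplace (fun x => x * (two_J0 x * cos x)) e.
set Y := laplace (fun x => x * (two_J0 x * sin x)) e.
have E1 : X - Q = e * P.
  have := @laplace_derivative _ (fun x => two_xJ1 x * cos x)
    (fun x => x * (two_J0 x * cos x) + - (two_xJ1 x * sin x)) e.
  rewrite laplaceD ?laplaceN //; [|tam|tam|tam].
  rewrite /= w0 !mul0r subr0 -/X -/P -/Q; apply => //; [|tam|tam].
  by move=> x; have h := der_two_xJ1 x; derive; ring.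
have E2 : Y + P = e * Q.
  have := @laplace_derivative _ (fun x => two_xJ1 x * sin x)
    (fun x => x * (two_J0 x * sin x) + two_xJ1 x * cos x) e.
  rewrite laplaceD //; [|tam|tam].
  rewrite /= w0 !mul0r subr0 -/Y -/P -/Q; apply => //; [|tam|tam].
  by move=> x; have h := der_two_xJ1 x; derive; ring.
have dxv x : is_derive x 1 (fun x => x * two_J0 x) (two_J0 x - two_xJ1 x).
  by have h := der_two_J0 x; derive; rewrite /two_xJ1; ring.
have E3 : laplace_cos e - P - Y = e * X.
  have := @laplace_derivative _ (fun x => x * (two_J0 x * cos x))
    (fun x => two_J0 x * cos x + - (two_xJ1 x * cos x) + - (x * (two_J0 x * sin x))) e.
  rewrite laplaceD ?laplaceN //; [|tam|tam|tam].
  rewrite laplaceD ?laplaceN //; [|tam|tam|tam].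
  rewrite -/X -/P -/Y /= !mul0r subr0; apply => //; [|tam|tam].
  by move=> x; have h := der_two_J0 x; derive; rewrite /two_xJ1; ring.
have E4 : laplace_sin e - Q + X = e * Y.
  have := @laplace_derivative _ (fun x => x * (two_J0 x * sin x))
    (fun x => two_J0 x * sin x + - (two_xJ1 x * sin x) + x * (two_J0 x * cos x)) e.
  rewrite laplaceD //; [|tam|tam].
  rewrite laplaceD ?laplaceN //; [|tam|tam|tam].
  rewrite -/X -/Q -/Y /= !mul0r subr0; apply => //; [|tam|tam].
  by move=> x; have h := der_two_J0 x; derive; rewrite /two_xJ1; ring.
have EX : X = e * P + Q by lra.
have EY : Y = e * Q - P by lra.
split => //.
- have -> : laplace_cos e = P + Y + e * X by lra.
  by rewrite EX EY; ring.
- have -> : laplace_sin e = Q - X + e * Y by lra.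
  by rewrite EX EY; ring.
Qed.

(** Real and imaginary parts of V^2 (1 + p^2), where V = laplace_cos + i
    laplace_sin and p = e - i, hence 1 + p^2 = e^2 - 2 i e. They are constant by
    the equation for V. *)
Definition invariant_re e :=
  (laplace_cos e ^+ 2 - laplace_sin e ^+ 2) * e ^+ 2 + 4 * e * (laplace_cos e * laplace_sin e).
Definition invariant_im e :=
  2 * (laplace_cos e * laplace_sin e) * e ^+ 2 - 2 * e * (laplace_cos e ^+ 2 - laplace_sin e ^+ 2).

Lemma der_laplace_cos_sin e : 0 < e ->
  is_derive e 1 laplace_cos (- laplace (fun x => x * (two_J0 x * cos x)) e) /\
  is_derive e 1 laplace_sin (- laplace (fun x => x * (two_J0 x * sin x)) e).
Proof. by move=> e0; split; apply: der_laplace => //; [tam|tam]. Qed.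

Lemma invariant_const e e' : 0 < e -> e <= e' ->
  invariant_re e = invariant_re e' /\ invariant_im e = invariant_im e'.
Proof.
move=> e0 ee'; split.
  apply: (@der_eq0_eq _ invariant_re (fun=> 0)) => // d /andP[d0 _].
  have {}d0 : 0 < d by exact: lt_le_trans d0.
  have [h1 h2] := der_laplace_cos_sin d0; have [E1 E2 E3 E4] := laplace_system d0.
  by rewrite /invariant_re; derive; rewrite E1 E2 E3 E4; ring.
apply: (@der_eq0_eq _ invariant_im (fun=> 0)) => // d /andP[d0 _].
have {}d0 : 0 < d by exact: lt_le_trans d0.
have [h1 h2] := der_laplace_cos_sin d0; have [E1 E2 E3 E4] := laplace_system d0.
by rewrite /invariant_im; derive; rewrite E1 E2 E3 E4; ring.
Qed.

Let v0 : two_J0 0 = 2. Proof. by rewrite /two_J0 phi0; ring. Qed.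

Lemma cvg_laplace_cos : e * laplace_cos e @[e --> +oo] --> (2 : R).
Proof.
pose k x := - (x * phi x) * cos x + - (two_J0 x * sin x).
have E : \forall e \near +oo, 2 + laplace k e = e * laplace_cos e.
  near=> e; have e0 : 0 < e by near: e; exact: nbhs_pinfty_gt.
  have D x : is_derive x 1 (fun x => two_J0 x * cos x) (k x).
    by have h := der_two_J0 x; derive; rewrite /k; ring.
  have := laplace_derivative D _ _ e0; rewrite v0 cos0 => ->; [rewrite /laplace_cos; lra|tam|by rewrite /k; tam].
apply: (@cvg_trans _ ((2 + laplace k e) @[e --> +oo])); first exact: near_eq_cvg.
have L : 2 + laplace k e @[e --> +oo] --> (2 + 0 : R).
  by apply: cvgD; [exact: cvg_cst|by apply: laplace_cvg0; rewrite /k; tam].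
by rewrite addr0 in L.
Unshelve. all: by end_near. Qed.

Lemma cvg_laplace_sin : e * laplace_sin e @[e --> +oo] --> (0 : R).
Proof.
pose k x := - (x * phi x) * sin x + two_J0 x * cos x.
have E : \forall e \near +oo, laplace k e = e * laplace_sin e.
  near=> e; have e0 : 0 < e by near: e; exact: nbhs_pinfty_gt.
  have D x : is_derive x 1 (fun x => two_J0 x * sin x) (k x).
    by have h := der_two_J0 x; derive; rewrite /k; ring.
  have := laplace_derivative D _ _ e0; rewrite sin0 mulr0 subr0; apply; [tam|by rewrite /k; tam].
apply: (@cvg_trans _ (laplace k e @[e --> +oo])); first exact: near_eq_cvg.
by apply: laplace_cvg0; rewrite /k; tam.
Unshelve. all: by end_near. Qed.

(** As e tends to infinity, e V tends to two_J0 0 = 2, which fixes the constant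
    V^2 (1 + p^2) = 4. *)
Lemma invariant_value e : 0 < e -> invariant_re e = 4 /\ invariant_im e = 0.
Proof.
move=> e0.
have ci : e^-1 @[e --> +oo] --> (0 : R).
  apply/gtr0_cvgV0; last exact: cvg_id.
  by near=> t; near: t; exact: nbhs_pinfty_gt.
have cC := cvg_laplace_cos; have cS := cvg_laplace_sin.
have c1 : (e * laplace_cos e) ^+ 2 - (e * laplace_sin e) ^+ 2 + 4 * (e^-1 * ((e * laplace_cos e) * (e * laplace_sin e))) @[e --> +oo]
    --> (2 * 2 - 0 * 0 + 4 * (0 * (2 * 0)) : R).
  apply: cvgD; first by apply: cvgB; rewrite /=; under eq_fun do rewrite expr2; apply: cvgM.
  apply: cvgM; first exact: cvg_cst.
  by apply: cvgM => //; apply: cvgM.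
have c2 : 2 * ((e * laplace_cos e) * (e * laplace_sin e)) - 2 * (e^-1 * ((e * laplace_cos e) ^+ 2 - (e * laplace_sin e) ^+ 2)) @[e --> +oo]
    --> (2 * (2 * 0) - 2 * (0 * (2 * 2 - 0 * 0)) : R).
  apply: cvgB; apply: cvgM; try exact: cvg_cst; apply: cvgM => //.
  by apply: cvgB; rewrite /=; under eq_fun do rewrite expr2; apply: cvgM.
have e1 : 4 = 2 * 2 - 0 * 0 + 4 * (0 * (2 * 0)) :> R by ring.
have e2 : 0 = 2 * (2 * 0) - 2 * (0 * (2 * 2 - 0 * 0)) :> R by ring.
rewrite -e1 in c1; rewrite -e2 in c2; split.
- apply/esym; apply: (cvg_unique (@Rhausdorff R) c1).
  apply: cvg_near_cst; near=> t.
  have te : e <= t by near: t; apply: nbhs_pinfty_ge; exact: num_real.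
  have t0 : 0 < t by exact: lt_le_trans te.
  have [-> _] := invariant_const e0 te; rewrite /invariant_re; field; lra.
- apply/esym; apply: (cvg_unique (@Rhausdorff R) c2).
  apply: cvg_near_cst; near=> t.
  have te : e <= t by near: t; apply: nbhs_pinfty_ge; exact: num_real.
  have t0 : 0 < t by exact: lt_le_trans te.
  have [_ ->] := invariant_const e0 te; rewrite /invariant_im; field; lra.
Unshelve. all: by end_near. Qed.

(** With C = laplace_cos and S = laplace_sin, eliminating C S between the two
    invariants gives (C^2 - S^2)(e^2 + 4) = 4, hence |S| < |C|; in particular C
    never vanishes, and it is positive for large e, so it is positive
    everywhere. *)
Lemma laplace_sin_lt_cos e : 0 < e -> laplace_sin e < laplace_cos e.
Proof.
have pos d : 0 < d -> laplace_sin d ^+ 2 < laplace_cos d ^+ 2.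
  move=> d0; have [h1 h2] := invariant_value d0.
  have E : laplace_cos d * laplace_sin d * d = laplace_cos d ^+ 2 - laplace_sin d ^+ 2.
    by apply: (@mulfI _ (2 * d)); [lra|move: h2; rewrite /invariant_im; lra].
  have : (laplace_cos d ^+ 2 - laplace_sin d ^+ 2) * (d ^+ 2 + 4) = 4.
    by rewrite -[RHS]h1 /invariant_re mulrDr -{2}E; ring.
  move=> h; rewrite -subr_gt0 ltNge; apply/negP => n.
  by have := sqr_ge0 d; nra.
move=> e0.
have : exists2 t, e <= t & 0 < laplace_cos t.
  have [t [te tC]] : exists t, e <= t /\ 1 < t * laplace_cos t.
    near (pinfty_nbhs R) => t; exists t; split.
      by near: t; apply: nbhs_pinfty_ge; exact: num_real.
    near: t; apply: (cvgr_gt _ cvg_laplace_cos); lra.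
  exists t => //; have t0 : 0 < t by exact: lt_le_trans te.
  by rewrite -(pmulr_rgt0 _ t0); lra.
move=> [t te Ct].
have Ce : 0 < laplace_cos e.
  rewrite ltNge; apply/negP => Ce.
  have [|||d /andP[d1 d2] Cd] := @cont_IVT _ laplace_cos e t 0.
  - by [].
  - move=> x /andP[ex _]; have [h _] := der_laplace_cos_sin (lt_le_trans e0 ex).
    exact: der_cont h.
  - by left; rewrite Ce ltW.
  - have := pos d (lt_le_trans e0 d1); rewrite Cd expr0n /=.
    by move: (sqr_ge0 (laplace_sin d)) => /le_lt_trans h /h; rewrite ltxx.
have := pos e e0; rewrite -subr_gt0 subr_sqr; nra.
Unshelve. all: by end_near. Qed.

(** A primitive of 2 J_0 (cos - sin) in closed form. *)
Definition bessel_prim x := x * two_J0 x * (cos x - sin x) + two_xJ1 x * (sin x + cos x).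

Lemma der_bessel_prim x : is_derive x 1 bessel_prim (two_J0 x * cos x + - (two_J0 x * sin x)).
Proof.
have h1 := der_two_J0 x; have h2 := der_two_xJ1 x; rewrite /bessel_prim; derive; rewrite /two_xJ1; ring.
Qed.

(** e times this transform is laplace_cos - laplace_sin. *)
Lemma laplace_bessel_prim_gt0 e : 0 < e -> 0 < laplace bessel_prim e.
Proof.
move=> e0; have SC := laplace_sin_lt_cos e0.
have h : laplace (fun x => two_J0 x * cos x + - (two_J0 x * sin x)) e = e * laplace bessel_prim e - bessel_prim 0.
  apply: laplace_derivative => //; [exact: der_bessel_prim|by rewrite /bessel_prim; tam|tam].
move: h; rewrite laplaceD ?laplaceN //; [|tam|tam|tam].
rewrite -/(laplace_cos e) -/(laplace_sin e) /bessel_prim /two_xJ1 expr0n !mul0r addr0 subr0 => h.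
by rewrite -(pmulr_rgt0 _ e0) -h subr_gt0.
Qed.

(** In polar coordinates this says that x times the amplitude does not fall
    below its value at 1, the only lower bound on the amplitude that is needed.
    *)
Lemma prufer_r_growth x : 1 <= x -> r2 1 <= x ^+ 2 * r2 x.
Proof.
move=> x1; rewrite -[leLHS]mul1r -{1}(expr1n _ 2).
apply: (@der_ge0_le _ (fun y => y ^+ 2 * r2 y)
  (fun y => y * r2 y + (3/2) * (y * phi y) * g y)) => // y /andP[y1 _].
  have h1 := dphi y; have h2 := der_prufer_g one_ge y.
  by rewrite /prufer_r; derive; rewrite /prufer_g; field.
have := sqr_ge0 (y * phi y + g y); have r0 := prufer_r_gt0 one_ge (lexx 1) y.
by move: r0; rewrite /prufer_r => r0 s; nra.
Qed.

Section Phase.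
Variable th : R -> R.
Hypothesis thP : is_phase 1 th.

(** The signed length of (x phi, g) along the direction of the angle; it never
    vanishes and starts positive, so it is the positive square root of prufer_r.
    *)
Definition amplitude x := x * phi x * sin (th x) + g x * cos (th x).

Lemma polar x : 0 <= x ->
  [/\ x * phi x = amplitude x * sin (th x), g x = amplitude x * cos (th x) & amplitude x ^+ 2 = r2 x].
Proof.
move=> x0; have t := phase_tan one_ge (lexx 1) thP x0; have c := cos2Dsin2 (th x).
have E1 : x * phi x = amplitude x * sin (th x).
  rewrite /amplitude mulrDl -!mulrA (mulrC (cos _)) mulrA [X in _ + X]mulrA -t.
  by rewrite -[LHS]mulr1 -c; ring.
have E2 : g x = amplitude x * cos (th x).
  rewrite /amplitude mulrDl (mulrAC (x * phi x)) t -[LHS]mulr1 -c; ring.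
split => //; rewrite /prufer_r E1 E2 -[LHS]mulr1 -c; ring.
Qed.

Lemma amplitude_gt0 x : 0 <= x -> 0 < amplitude x.
Proof.
move=> x0; rewrite ltNge; apply/negP => rx.
have [|||d /andP[d1 d2] rd] := @cont_IVT _ amplitude 0 x 0.
- by [].
- move=> y /andP[y0 _].
  have h1 := dphi y; have h2 := der_prufer_g one_ge y.
  have h3 := thP.2 y (lt_le_trans (ltrN10 R) y0).
  have : exists d, is_derive y 1 amplitude d by eexists; rewrite /amplitude; repeat derive_step.
  by case=> d; exact: der_cont.
- right; rewrite rx /amplitude mul0r mul0r add0r thP.1 cos0 mulr1 /prufer_g phi0 expr0n /= mul0r.
  by lra.
- have [_ _] := polar d1; have := prufer_r_gt0 one_ge (lexx 1) d.
  by rewrite rd expr0n /= => /[swap] <-; rewrite ltxx.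
Qed.

(** In polar coordinates the main term is x cos + x sin of the defect, so the
    sign of bessel_prim at infinity tells on which side of pi / 4 the defect
    lies. *)
Lemma bessel_prim_polar x : 0 <= x -> bessel_prim x = amplitude x *
  (x * (cos (x - th x) - sin (x - th x)) + sin (th x) / 2 * (cos x - sin x)).
Proof.
move=> x0; have [E1 E2 _] := polar x0.
have -> : bessel_prim x = x * ((g x) * (cos x - sin x) + x * phi x * (sin x + cos x)) +
   (x * phi x) / 2 * (cos x - sin x).
  by rewrite /bessel_prim /two_J0 /two_xJ1 /prufer_g; field.
by rewrite E1 E2 cosB sinB; field.
Qed.

(** If the defect exceeded pi / 4 somewhere, then, being nondecreasing and at
    most 26/15, from there on it would lie strictly between pi / 4 and 5 pi / 4.
    Then bessel_prim would be at most a negative constant beyond some point, so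
    its Laplace transform would be negative near 0, against
    laplace_bessel_prim_gt0. *)
Lemma defect_le_pi4 x : 0 <= x -> x - th x <= pi / 4.
Proof.
move=> x0; rewrite leNgt; apply/negP => hx.
have p2 := pi_ge2 R.
(* 23/30 = 5/2 - 26/15 keeps the defect minus pi / 4 below pi - eta, using pi >= 2 *)
pose eta := Num.min (x - th x - pi / 4) (23/30).
have eta0 : 0 < eta by rewrite lt_min; apply/andP; split; lra.
have eta1 : eta <= x - th x - pi / 4 by rewrite ge_min lexx.
have eta2 : eta <= 23/30 by rewrite ge_min lexx orbT.
have se : 0 < sin eta by apply: sin_gt0_pi; lra.
have s4 : 1/2 <= sin (pi / 4) :> R.
  have s0 : 0 <= sin (pi / 4) :> R by apply: sin_ge0_pi; lra.
  by have := cos2Dsin2 (pi / 4 : R); rewrite cos_pi4; nra.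
(* beyond 2 / sin eta the main term of bessel_prim_polar dominates the other one *)
pose X := Num.max (Num.max x 1) (2 / sin eta).
have tail y : X <= y -> bessel_prim y <= - (sin eta / 4 * Num.sqrt (r2 1)).
  rewrite !ge_max => /andP[/andP[xy y1] ys].
  have y0 : 0 <= y by lra.
  have d1 := defect_homo one_ge (lexx 1) thP x0 xy.
  have d2 := defect_le one_ge (lexx 1) thP y0.
  have sz : sin eta <= sin (y - th y - pi / 4).
    by apply: sin_le_between; lra.
  have E : cos (y - th y) - sin (y - th y) = - (2 * sin (pi / 4) * sin (y - th y - pi / 4)).
    rewrite -[in LHS](subrK (pi / 4) (y - th y)).
    by rewrite (cosD (y - th y - pi / 4)) (sinD (y - th y - pi / 4) (pi / 4)) cos_pi4; ring.
  have yse : 2 <= y * sin eta by rewrite -ler_pdivrMr.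
  have b1 : sin (th y) / 2 * (cos y - sin y) <= 1.
    have := sin_max (th y); have := sin_max y; have := cos_max y.
    by rewrite !ler_norml => /andP[? ?] /andP[? ?] /andP[? ?]; nra.
  have b2 : sin eta <= 2 * sin (pi / 4) * sin (y - th y - pi / 4) by nra.
  have b : y * (cos (y - th y) - sin (y - th y)) + sin (th y) / 2 * (cos y - sin y)
     <= - (y * sin eta / 2) by rewrite E; nra.
  have rr : Num.sqrt (r2 1) <= y * amplitude y.
    rewrite -(ger0_norm (mulr_ge0 y0 (ltW (amplitude_gt0 y0)))) -sqrtr_sqr ler_wsqrtr //.
    by have [_ _ r] := polar y0; rewrite exprMn r prufer_r_growth.
  rewrite (bessel_prim_polar y0); have r0 := amplitude_gt0 y0.
  apply: (@le_trans _ _ (amplitude y * - (y * sin eta / 2))); first by rewrite ler_wpM2l // ltW.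
  by rewrite mulrN lerN2; nra.
pose c := sin eta / 4 * Num.sqrt (r2 1).
have c0 : 0 < c by rewrite mulr_gt0 ?sqrtr_gt0 ?prufer_r_gt0 //; lra.
have X0 : 0 <= X by rewrite !le_max ler01 orbT.
(* beyond X the left side is nonpositive; on [0, X] continuity provides M, for any positive weight *)
have [M M0 HM] : exists2 M, 0 <= M & forall y, 0 <= y -> bessel_prim y + c <= M * expR (- (1 * y)).
  have dHe (y : R) : is_derive y 1 (fun y : R => (bessel_prim y + c) * expR y)
     ((two_J0 y * cos y + - (two_J0 y * sin y)) * expR y + (bessel_prim y + c) * expR y).
    by have h := der_bessel_prim y; derive; ring.
  have [d d0 dmax] : exists2 d, 0 <= d & forall y, 0 <= y <= X ->
      (bessel_prim y + c) * expR y <= (bessel_prim d + c) * expR d.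
    have [|d] := @EVT_max R (fun y => (bessel_prim y + c) * expR y) 0 X X0.
      by apply: (@der_within _ _ _ 0 X) => y _; exact: dHe.
    by rewrite in_itv/= => /andP[d0 _] dm; exists d => // y yX; apply: dm; rewrite in_itv.
  exists (Num.max 0 ((bessel_prim d + c) * expR d)); first by rewrite le_max lexx.
  move=> y y0; rewrite mul1r expRN -ler_pdivrMr ?invr_gt0 ?expR_gt0 // invrK le_max.
  have [yX|/ltW yX] := leP y X; first by rewrite dmax ?orbT // y0.
  rewrite mulr_le0_ge0 ?expR_ge0 //; have := tail y yX; rewrite -/c; lra.
have bound e : 0 < e -> 0 < M - c / e.
  move=> e0; have [ie Ee] := integral_expRN e0.
  have e1 : 0 < 1 + e by lra.
  have [ie1 Ee1] := integral_expRN e1.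
  have tH : tame bessel_prim by rewrite /bessel_prim; tam.
  have iH := laplace_integrable tH e0.
  apply: (lt_le_trans (laplace_bessel_prim_gt0 e0)).
  have : laplace bessel_prim e <= M / (1 + e) - c / e.
    rewrite -Ee -Ee1 -!RintegralZl // -RintegralB //; [|exact: integrable_scale..].
    apply: le_Rintegral => //.
      rewrite (_ : _ \o _ = (fun x => (M * expR (- ((1 + e) * x)))%:E - (c * expR (- (e * x)))%:E)%E) //.
      by apply: integrableB => //; exact: integrable_scale.
    move=> y; rewrite /= in_itv/= andbT => /HM h.
    have -> : - ((1 + e) * y) = - (1 * y) + - (e * y) by ring.
    by rewrite expRD mulrA -mulrBl ler_wpM2r ?expR_ge0 //; lra.
  have : M / (1 + e) <= M by rewrite ler_pdivrMr // ler_peMr //; lra.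
  lra.
(* at e = c / (M + 1) the bound M - c / e equals - 1 *)
have := bound (c / (M + 1)); rewrite invf_div mulrCA divff ?gt_eqF // mulr1.
by rewrite divr_gt0 //; [move=> /(_ isT)|]; lra.
Qed.

End Phase.
End OrderOne.

(** * Comparison of orders: a strict bound for nu smaller than 1 *)

(** Locates the first failure of positivity, for the continuation argument of
    compare_gap. *)
Lemma first_nonpos (R : realType) (f : R -> R) a b :
  a <= b -> 0 < f a -> f b <= 0 -> (forall x, a <= x <= b -> {for x, continuous f}) ->
  exists c, [/\ a < c, c <= b, f c <= 0 & forall y, a <= y < c -> 0 < f y].
Proof.
move=> ab fa fb cf.
pose A := [set y | a <= y <= b /\ f y <= 0].
have Ab : A b by rewrite /A /= ab lexx.
have lA : has_lbound A by exists a => y [/andP[]].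
have iA : has_inf A by split => //; exists b.
have ac : a <= inf A by apply: lb_le_inf; [exists b|move=> y [/andP[]]].
have cb : inf A <= b by exact: ge_inf.
have cc := cf _ (introT andP (conj ac cb)).
have fc : f (inf A) <= 0.
  rewrite leNgt; apply/negP => fc0.
  have : \forall x \near inf A, 0 < f x by exact: (cvgr_gt _ cc).
  move=> /nbhs_ballP[e /= e0 He].
  have [y Ay ylt] := inf_adherent e0 iA.
  have [_ fy] := Ay.
  have : 0 < f y.
    apply: He; rewrite /ball /= ler0_norm ?subr_le0; last exact: ge_inf.
    by rewrite opprB ltrBlDl.
  by move/lt_le_trans => /(_ _ fy); rewrite ltxx.
exists (inf A); split => //.
  rewrite lt_neqAle ac andbT; apply/eqP => E; move: fc; rewrite -E.
  by move/(lt_le_trans fa); rewrite ltxx.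
move=> y /andP[ay yc]; rewrite ltNge; apply/negP => fy.
have : inf A <= y by apply: ge_inf => //; split=> //; rewrite ay (ltW (lt_le_trans yc cb)).
by rewrite leNgt yc.
Qed.

(** sin^2 has derivative sin (2 t), at most 1. *)
Lemma sin2_lip (R : realType) (a b : R) : b <= a -> sin a ^+ 2 - sin b ^+ 2 <= a - b.
Proof.
move=> ba; suff : b - sin b ^+ 2 <= a - sin a ^+ 2 by lra.
apply: (@der_ge0_le _ (fun t => t - sin t ^+ 2) (fun t => 1 - 2 * sin t * cos t)) => // t _.
  by derive; ring.
by have := sqr_ge0 (sin t - cos t); have := cos2Dsin2 t; nra.
Qed.

Section Comparison.
Variables (R : realType) (nu : R).
Hypothesis nu_ge : 1/2 <= nu.
Hypothesis nu_lt1 : nu < 1.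
Variables th th1 : R -> R.
Hypothesis thP : is_phase nu th.
Hypothesis th1P : is_phase 1 th1.

Let nu_le1 : nu <= 1 := ltW nu_lt1.
Let one_ge : 1/2 <= 1 :> R. Proof. lra. Qed.
Let D (x : R) := th x - th1 x.

Let dD (x : R) : 0 <= x -> is_derive x 1 D (prufer_slope nu x - prufer_slope 1 x).
Proof.
move=> x0; have x1 : -1 < x by lra.
have h1 := thP.2 x x1; have h2 := th1P.2 x x1.
by rewrite /D; derive.
Qed.

Let slope0 (n : R) : 1/2 <= n -> prufer_slope n 0 = (n + 1/2)^-1.
Proof.
move=> n1; have n0 : n + 1/2 != 0 by lra.
rewrite /prufer_slope /prufer_r /prufer_g /coupling phi0; field.
by move: n0; lra.
Qed.

(** Near 0 the slopes are 1 / (nu + 1/2) and 1 / (3/2), and the former is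
    larger. *)
Lemma compare_start : exists x0, [/\ 0 < x0, x0 <= 1 & 0 < D x0].
Proof.
pose f x := prufer_slope nu x - prufer_slope 1 x.
have cf : {for 0, continuous f}.
  by apply: continuousB; [exact: prufer_slope_cont|apply: prufer_slope_cont; rewrite ?lexx].
have f0 : 0 < f 0.
  by rewrite /f !slope0 // subr_gt0 ltf_pV2 ?posrE; move: nu_ge nu_lt1; lra.
have : \forall x \near (0 : R), 0 < f x by exact: (cvgr_gt _ cf).
move=> /nbhs_ballP[e /= e0 He].
exists (Num.min (e / 2) 1); set x0 := Num.min _ _.
have x00 : 0 < x0 by rewrite lt_min ltr01 andbT; lra.
have x0e : x0 <= e / 2 by rewrite ge_min lexx.
split => //; first by rewrite ge_min lexx orbT.
have -> : 0 = D 0 by rewrite /D thP.1 th1P.1 subrr.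
apply: (der_gt0_lt x00) => [x /andP[x1 _]|x /andP[x1 x2]]; first exact: dD.
apply: He; rewrite /ball /= sub0r normrN gtr0_norm //.
by apply: (lt_trans x2); lra.
Qed.

(** Let D = theta_nu - theta_1. Since the order nu has the smaller coupling and
    sin^2 is 1-Lipschitz, D' >= - K D / x^2 as long as D >= 0, where K = 3/4; so
    D exp (- K / x) increases and D stays above a positive constant. *)
Lemma compare_gap : exists2 d, 0 < d & exists2 x0, 0 < x0 & forall x, x0 <= x -> d <= D x.
Proof.
have [x0 [x00 x01 Dx0]] := compare_start.
pose K : R := coupling 1.
have K0 : 0 <= K by apply: coupling_ge0.
have KE : coupling nu <= K by rewrite /K /coupling; move: nu_ge nu_le1 => *; nra.
pose z x := D x * expR (- (K * x^-1)).
pose dz x := expR (- (K * x^-1)) * (prufer_slope nu x - prufer_slope 1 x + K / x ^+ 2 * D x).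
have dzP (x : R) : 0 < x -> is_derive x 1 z (dz x).
  move=> xg; have xn0 : x != 0 by rewrite gt_eqF.
  notypeclasses refine (der_eq (der_mul (dD (ltW xg)) (der_comp (der_expR _)
    (der_opp (der_mul (der_cst K x) (der_inv xn0 (der_id x)))))) _).
  by rewrite /dz /=; field.
have dz0 (x : R) : 0 < x -> 0 <= D x -> 0 <= dz x.
  move=> xg Dx; rewrite mulr_ge0 ?expR_ge0 //.
  rewrite (slope_sin nu_ge nu_le1 thP xg) (slope_sin one_ge (lexx 1) th1P xg) -/K.
  have -> : 1 - coupling nu / x ^+ 2 * sin (th x) ^+ 2 - (1 - K / x ^+ 2 * sin (th1 x) ^+ 2) +
     K / x ^+ 2 * D x = (x ^+ 2)^-1 * (K * (D x - (sin (th x) ^+ 2 - sin (th1 x) ^+ 2)) +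
       (K - coupling nu) * sin (th x) ^+ 2) by field; rewrite gt_eqF.
  apply: mulr_ge0; first by rewrite invr_ge0 sqr_ge0.
  apply: addr_ge0; apply: mulr_ge0 => //; last 2 first.
  - by rewrite subr_ge0.
  - exact: sqr_ge0.
  by rewrite subr_ge0 /D; apply: sin2_lip; rewrite -subr_ge0.
have mono (x y : R) : x0 <= x -> x <= y -> (forall t, x < t < y -> 0 <= D t) -> z x <= z y.
  move=> hx xy h; apply: (der_ge0_le xy) => t; last first.
    by move=> /[dup] /andP[t1 _] /h; apply: dz0; apply: lt_trans t1; exact: lt_le_trans hx.
  by move=> /andP[t1 _]; apply: dzP; apply: lt_le_trans t1; exact: lt_le_trans hx.
have zx0 : 0 < z x0 by rewrite mulr_gt0 ?expR_gt0.
have Dpos (x : R) : x0 <= x -> 0 < D x.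
  move=> hx; rewrite ltNge; apply/negP => Dx.
  have [|c [c1 c2 Dc Dy]] := first_nonpos hx Dx0 Dx.
    by move=> y /andP[y1 _]; apply: der_cont (dD _); apply: le_trans y1; exact: ltW.
  have : z x0 <= z c.
    by apply: mono => //; [exact: ltW|move=> t /andP[t1 t2]; rewrite ltW // Dy // t2 ltW].
  have : z c <= 0 by rewrite mulr_le0_ge0 ?expR_ge0.
  by move=> h1 /le_trans /(_ h1); rewrite leNgt zx0.
exists (z x0) => //; exists x0 => // x hx.
have xg : 0 < x by exact: lt_le_trans hx.
apply: (@le_trans _ _ (z x)).
  by apply: mono => // t /andP[t1 _]; rewrite ltW // Dpos // ltW.
rewrite /z ler_piMr //; first by rewrite ltW // Dpos.
by rewrite expR_le1 oppr_le0 mulr_ge0 // invr_ge0 ltW.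
Qed.

End Comparison.

(** Far out, the defect of order nu is at most that of order 1 minus the gap; it
    is nondecreasing, so the bound holds everywhere. *)
Lemma defect_lt_pi4 (R : realType) (nu : R) th : 1/2 <= nu -> nu < 1 -> is_phase nu th ->
  exists2 b, b < pi / 4 & forall x, 0 <= x -> x - th x <= b.
Proof.
move=> n1 n2 thP; have o : 1/2 <= 1 :> R by lra.
have [th1 th1P] := @phase_exists R 1 o (lexx 1).
have [d d0 [x0 x00 h]] := compare_gap n1 n2 thP th1P.
exists (pi / 4 - d); first by rewrite ltrBlDr ltrDl.
move=> x xg; pose y := Num.max x x0.
have xy : x <= y by rewrite le_max lexx.
have x0y : x0 <= y by rewrite le_max lexx orbT.
have := defect_homo n1 (ltW n2) thP xg xy.
have := defect_le_pi4 th1P (le_trans xg xy).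
by have := h y x0y; lra.
Qed.

(** * The Gamma function and the zeros of J_nu *)

Section GammaFunction.
Variable R : realType.
Local Notation leb := (@lebesgue_measure R).
Implicit Types (s t : R).

Let gam s t := t `^ (s - 1) * expR (- t).

Lemma powR_at0 s : 0 < s -> t `^ s @[t --> 0^'+] --> (0 : R) `^ s.
Proof. by move=> s0; rewrite powR0 ?gt_eqF //; exact: powR_cvg0. Qed.

Lemma powR_cont s t : 0 < t -> {for t, continuous (fun t => t `^ s)}.
Proof. by move=> t0; exact: (der_cont (is_derive1_powR s t0)). Qed.

Lemma powR_halfline s : 0 < s -> {within `[(0:R), +oo[, continuous (fun t => t `^ s)}.
Proof.
move=> s0; apply/continuous_within_itvcyP; split; last exact: powR_at0.
by move=> t; rewrite in_itv/= andbT => t0; exact: powR_cont.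
Qed.

Lemma slow_exprn n : slow (fun t : R => t ^+ n).
Proof.
elim: n => [|n IH]; first by apply: (@slow_bounded _ _ 1) => x _; rewrite expr0 normr1.
under eq_fun do rewrite exprS.
exact: slow_mul (@slow_id R) IH.
Qed.

Lemma slow_powR s : 0 < s -> slow (fun t : R => t `^ s).
Proof.
move=> s0 d d0; set n := (Num.truncn s).+1.
have sn : s <= n%:R by rewrite ltW // Num.Theory.truncnS_gt.
have sl1 : slow (fun _ : R => (1:R)) by apply: (@slow_bounded _ _ 1) => x _; rewrite normr1.
have [M h] := slow_add sl1 (slow_exprn n) d0.
exists M => t t0; apply: le_trans (h t t0).
rewrite ger0_norm ?powR_ge0 // ger0_norm ?addr_ge0 ?exprn_ge0 //.
have [t1|t1] := leP t 1.
  apply: (@le_trans _ _ 1); last by rewrite lerDl exprn_ge0.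
  have <- : 1 `^ s = 1 :> R by rewrite powR1.
  by apply: ge0_ler_powR; rewrite ?nnegrE // ltW.
apply: (@le_trans _ _ (t ^+ n)); last by rewrite lerDr.
by rewrite -powR_mulrn //; apply: ler_powR => //; exact: ltW.
Qed.

Let expN t : expR (- t) = expR (- (1 * t)). Proof. by rewrite mul1r. Qed.

Let dexpN t : is_derive t 1 (fun t => expR (- t)) (- expR (- t)).
Proof. by derive; ring. Qed.

Let cexpN : {within `[(0:R), +oo[, continuous (fun t => expR (- t))}.
Proof. by apply: within_halfline => t; exact: der_cont (dexpN t). Qed.

Lemma gamma_integrable s : 1 < s -> leb.-integrable `[(0:R), +oo[ (EFin \o gam s).
Proof.
move=> s1; have s0 : 0 < s - 1 by rewrite subr_gt0.
have [M h] := slow_expbound (slow_powR s0) ltr01.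
apply: (@integrable_expbound _ _ (1/2) M); first lra.
- move=> t; apply: cvgM; first exact: powR_halfline.
  exact: cexpN.
- by move=> t t0; rewrite /gam expN; exact: h.
Qed.

Lemma GammaE s : 1 < s -> Gamma s = \int[leb]_(t in `[(0:R), +oo[) gam s t.
Proof.
move=> s1; rewrite /Gamma Rintegral_itv_obnd_cbnd //.
apply: (integrableS _ _ _ (gamma_integrable s1)) => //.
by apply: subset_itvr; rewrite bnd_simp.
Qed.

(** For s > 1 the integrand is continuous at 0, so that integration by parts
    applies on the closed half-line. *)
Lemma GammaS s : 1 < s -> Gamma (s + 1) = s * Gamma s.
Proof.
move=> s1; have s0 : 0 < s by lra.
have sm : 0 < s - 1 by lra.
have ss1 : 1 < s + 1 by lra.
have i1 := gamma_integrable s1; have i2 := gamma_integrable ss1.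
have [M1 h1] := slow_expbound (slow_powR sm) ltr01.
have [M2 h2] := slow_expbound (slow_powR s0) ltr01.
pose F t := t `^ s * expR (- t).
pose f t := s * gam s t - gam (s + 1) t.
have : \int[leb]_(t in `[(0:R), +oo[) f t = - F 0.
  apply: (@halfline_FTC _ F f (1/2) (s * M1 + M2)); first lra.
  - move=> t; apply: cvgB; first apply: cvgM; first exact: cvg_cst.
      by apply: cvgM; [exact: powR_halfline|exact: cexpN].
    by apply: cvgM; [apply: powR_halfline; lra|exact: cexpN].
  - move=> t t0; rewrite /f (le_trans (ler_normB _ _)) // mulrDl lerD //.
      rewrite normrM (gtr0_norm s0) -mulrA ler_wpM2l ?(ltW s0) //.
      by rewrite /gam expN h1.
    by rewrite /gam expN addrK h2.
  - apply: norm_cvg0.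
    apply: (@squeeze_cvgr _ _ _ _ (cst 0) (fun x => M2 * expR (- (1 / 2 * x)))).
    + near=> x; rewrite normr_ge0 /= /F expN; apply: h2; near: x; exact: nbhs_pinfty_ge.
    + exact: cvg_cst.
    + by rewrite -(mulr0 M2); apply: cvgM; [exact: cvg_cst|apply: cvg_expRN; lra].
  - move=> t t0; have d1 := is_derive1_powR s t0.
    apply: der_eq (der_mul d1 (dexpN t)) _.
    by rewrite /f /gam addrK; ring.
  - apply: cvgM; first exact: powR_at0.
    by apply: cvg_at_right_filter; exact: (der_cont (dexpN 0)).
rewrite /F powR0 ?gt_eqF // mul0r oppr0 /f RintegralB //; last exact: integrable_scale.
rewrite RintegralZl // -!GammaE //; lra.
Unshelve. all: by end_near. Qed.

Lemma Gamma_gt0 s : 1 < s -> 0 < Gamma s.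
Proof.
move=> s1; have i1 := gamma_integrable s1.
have sm : 0 < s - 1 by lra.
rewrite GammaE //.
have g0 t : 0 <= gam s t by rewrite mulr_ge0 ?powR_ge0 ?expR_ge0.
have i12 : leb.-integrable `[(1:R), 2] (EFin \o gam s).
  by apply: (integrableS _ _ _ i1) => // t; rewrite /= !in_itv /= andbT => /andP[t1 _]; lra.
apply: (@lt_le_trans _ _ (\int[leb]_(t in `[(1:R), 2]) gam s t)); last first.
  rewrite /Rintegral fine_le ?integrable_fin_num //.
  apply: ge0_subset_integral => //.
  - by case/integrableP: i1.
  - by move=> x _; rewrite lee_fin.
  - by move=> t; rewrite /= !in_itv /= andbT => /andP[t1 _]; lra.
apply: (@lt_le_trans _ _ (\int[leb]_(t in `[(1:R), 2]) expR (- 2))).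
  rewrite Rintegral_cst //= lebesgue_measure_itv /= lte_fin.
  by rewrite ltr1n /= mulr_gt0 ?expR_gt0 //; lra.
apply: le_Rintegral => //.
  apply: continuous_compact_integrable; first exact: segment_compact.
  by apply: continuous_subspaceT => x; exact: cvg_cst.
move=> t; rewrite /= in_itv/= => /andP[t1 t2].
rewrite /gam -[leLHS]mul1r ler_pM ?expR_ge0 //; last by rewrite ler_expR lerN2.
rewrite -[leLHS](powRr0 t); apply: ler_powR; [exact: t1|lra].
Qed.

End GammaFunction.

Section BesselZeros.
Variables (R : realType) (nu : R).
Hypothesis nu_ge : 1/2 <= nu.
Hypothesis nu_lt1 : nu < 1.
Implicit Types x z : R.

Let nu_ge0 : 0 <= nu. Proof. by move: nu_ge; lra. Qed.
Let nu_le1 : nu <= 1 := ltW nu_lt1.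

Lemma Gamma_poch m : Gamma (m%:R + nu + 1) = Gamma (nu + 1) * poch nu m.
Proof.
elim: m => [|m IH]; first by rewrite /poch big_ord0 mulr1 add0r.
have -> : m.+1%:R + nu + 1 = (m%:R + nu + 1) + 1 by rewrite -natr1; ring.
rewrite (@GammaS _ (m%:R + nu + 1)); last by have := ler0n R m; move: nu_ge; lra.
by rewrite IH /poch big_ord_recr /=; ring.
Qed.

(** The recursion for Gamma turns its values into rising factorials, and the
    series of J_nu becomes that of phi up to a factor. *)
Lemma besselJ_phi x : 0 < x ->
  besselJ nu x = (x / 2) `^ nu / Gamma (nu + 1) * phi nu x.
Proof.
move=> x0; have x2 : 0 < x / 2 by lra.
have G0 : 0 < Gamma (nu + 1) by apply: Gamma_gt0; move: nu_ge; lra.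
rewrite /besselJ /phi /powser; set K := (x / 2) `^ nu / Gamma (nu + 1).
have -> : (series (fun m => (-1) ^+ m / (m`!%:R * Gamma (m%:R + nu + 1)) *
    (x / 2) `^ (2 * m%:R + nu))) = (fun n => K * pseries (bcoef nu) (x ^+ 2) n).
  apply/funext => n; rewrite /pseries /series /= mulr_sumr; apply: eq_bigr => m _.
  rewrite Gamma_poch powRD; last by apply/implyP => _; rewrite gt_eqF.
  have -> : (x / 2) `^ (2 * m%:R) = (x ^+ 2) ^+ m / 4 ^+ m.
    rewrite -natrM powR_mulrn ?ltW // exprM -expr_div_n; congr (_ ^+ _).
    by field.
  rewrite /bcoef /K.
  have f0 : m`!%:R != 0 :> R by rewrite pnatr_eq0 -lt0n fact_gt0.
  have p0 : poch nu m != 0 by rewrite gt_eqF // (lt_le_trans ltr01) // poch_ge1.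
  have q0 : 4 ^+ m != 0 :> R by rewrite expf_neq0 // pnatr_eq0.
  move: (4 ^+ m) ((x ^+ 2) ^+ m) ((-1) ^+ m) q0 => q y e q0.
  by field; rewrite p0 f0 q0 gt_eqF.
apply/cvg_lim => //; apply: cvgM; first exact: cvg_cst.
exact: fact_bounded_cvg (bcoef_bounded nu_ge0).
Qed.

Lemma besselJ_eq0 x : 0 < x -> (besselJ nu x = 0 <-> phi nu x = 0).
Proof.
move=> x0; rewrite besselJ_phi //.
have K0 : (x / 2) `^ nu / Gamma (nu + 1) != 0.
  by rewrite gt_eqF // divr_gt0 ?powR_gt0 ?Gamma_gt0 //; [lra|move: nu_ge; lra].
by split=> [/eqP|->]; rewrite ?mulr0 // mulf_eq0 (negbTE K0) => /eqP.
Qed.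

Section Phase.
Variable th : R -> R.
Hypothesis thP : is_phase nu th.

(** Beyond 9/10 the angle increases strictly, so it meets each n pi once, and
    below 9/10 there is no zero: the zeros are enumerated increasingly without
    omission. *)
Lemma zeros_enum : exists2 zn : nat -> R,
  forall n, [/\ 0 < zn n, besselJ nu (zn n) = 0 & th (zn n) = n.+1%:R * pi] &
  forall n x, (0 < x < zn n /\ besselJ nu x = 0) <-> exists2 k, (k < n)%N & x = zn k.
Proof.
have /choice[zn znP] : forall n, exists z, 9/10 < z /\ th z = n.+1%:R * pi.
  by move=> n; have [z z1 z2] := phase_hits nu_ge nu_le1 thP (ltn0Sn n); exists z.
have zn0 n : 0 < zn n by have [] := znP n; lra.
have Jz n : besselJ nu (zn n) = 0.
  apply/besselJ_eq0 => //; apply/(phi_eq0_sin nu_ge nu_le1 thP) => //.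
  by have [_ ->] := znP n; exact: sin_natpi.
have p0 := pi_gt0 R.
have mono x y : 9/10 < x -> 9/10 < y -> th x < th y -> x < y.
  move=> x9 y9 h; rewrite ltNge le_eqVlt; apply/negP => /predU1P[E|E].
    by move: h; rewrite E ltxx.
  have := phase_lt nu_ge nu_le1 thP (ltW y9) E; lra.
exists zn => [n|n x]; first by have [] := znP n.
split=> [[/andP[x0 xz] Jx]|[k kn ->]].
  have /(phi_eq0 nu_ge nu_le1 thP x0)[x9 [m m0 E]] : phi nu x = 0 by apply/besselJ_eq0.
  have [zn9 zE] := znP n.
  have := phase_lt nu_ge nu_le1 thP (ltW x9) xz.
  rewrite E zE ltr_pM2r // ltr_nat ltnS => mn.
  have [z9 zE'] := znP m.-1; rewrite prednK // in zE'.
  exists m.-1; first by rewrite prednK.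
  apply/eqP; rewrite eq_le !leNgt; apply/andP; split; apply/negP => h.
    have := phase_lt nu_ge nu_le1 thP (ltW z9) h; rewrite E zE' ltxx //.
  by have := phase_lt nu_ge nu_le1 thP (ltW x9) h; rewrite E zE' ltxx.
have [k9 kE] := znP k; have [n9 nE] := znP n.
split; last exact: Jz.
by rewrite zn0 /=; apply: mono => //; rewrite kE nE ltr_pM2r // ltr_nat ltnS.
Qed.

(** The defining property of bessel_zero counts the zeros below it, and the
    angle counts them too. *)
Lemma bessel_zero_phase n : (0 < n)%N ->
  0 < bessel_zero nu n /\ th (bessel_zero nu n) = n%:R * pi.
Proof.
move=> n0; have [zn znP below] := zeros_enum.
have p0 := pi_gt0 R.
have cardz m : ([set x : R | (0 < x < zn m)%R /\ besselJ nu x = 0] #= `I_m)%card.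
  have -> : [set x : R | (0 < x < zn m)%R /\ besselJ nu x = 0] = zn @` `I_m.
    apply/seteqP; split=> [x /= /below[k km ->]|x /= [k km <-]]; first by exists k.
    by apply/below; exists k.
  apply: inj_card_eq => i j _ _ E.
  have [_ _ ei] := znP i; have [_ _ ej] := znP j.
  move: ei; rewrite E ej => /(mulIf (lt0r_neq0 p0))/eqP.
  by rewrite eqr_nat eqSS => /eqP.
have /= : [set z : R | [/\ (0 < z)%R, besselJ nu z = 0
    & [set x : R | (0 < x < z)%R /\ besselJ nu x = 0] #= `I_n.-1]%card] (bessel_zero nu n).
  apply: xgetPex; exists (zn n.-1); have [h1 h2 _] := znP n.-1.
  by split=> //; exact: cardz.
move=> [z0 Jz cz]; split => //.
have /(phi_eq0 nu_ge nu_le1 thP z0)[z9 [m m0 E]] : phi nu (bessel_zero nu n) = 0.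
  by apply/besselJ_eq0.
suff mn : m = n by rewrite E mn.
have Ez : bessel_zero nu n = zn m.-1.
  have [h1 _ h3] := znP m.-1; rewrite prednK // in h3.
  have z9' : 9/10 < zn m.-1.
    have [_ J _] := znP m.-1.
    have /(phi_eq0 nu_ge nu_le1 thP h1)[] // : phi nu (zn m.-1) = 0 by apply/besselJ_eq0.
  apply/eqP; rewrite eq_le !leNgt; apply/andP; split; apply/negP => h.
    by have := phase_lt nu_ge nu_le1 thP (ltW z9') h; rewrite E h3 ltxx.
  by have := phase_lt nu_ge nu_le1 thP (ltW z9) h; rewrite E h3 ltxx.
have : (`I_m.-1 #= `I_n.-1)%card.
  apply: card_eq_trans cz; rewrite card_eq_sym Ez; exact: cardz.
by move=> /card_eq_II h; rewrite -(prednK m0) h prednK.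
Qed.

End Phase.

Theorem bessel_zero_bounds : exists2 b : R, b < pi / 4 &
  forall n, (0 < n)%N -> 0 < bessel_zero nu n /\
    0 <= bessel_zero nu n - n%:R * pi <= b.
Proof.
have [th thP] := phase_exists nu_ge nu_le1.
have [b b4 hb] := defect_lt_pi4 nu_ge nu_lt1 thP.
exists b => // n n0; have [z0 E] := bessel_zero_phase thP n0; split => //.
rewrite -E; apply/andP; split; last by apply: hb; exact: ltW.
by rewrite subr_ge0; apply: (phase_le nu_ge nu_le1 thP); exact: ltW.
Qed.

End BesselZeros.

(** * Semi-inner products and orthonormal families *)

Section ComplexParts.
Variable R : realType.
Implicit Types a b : R[i].

Lemma ReD a b : complex.Re (a + b) = complex.Re a + complex.Re b. Proof. by case: a b => ? ? []. Qed.
Lemma ImD a b : complex.Im (a + b) = complex.Im a + complex.Im b. Proof. by case: a b => ? ? []. Qed.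
Lemma ReN a : complex.Re (- a) = - complex.Re a. Proof. by case: a. Qed.
Lemma ImN a : complex.Im (- a) = - complex.Im a. Proof. by case: a. Qed.
Lemma ReM a b : complex.Re (a * b) = complex.Re a * complex.Re b - complex.Im a * complex.Im b.
Proof. by case: a b => ? ? []. Qed.
Lemma ImM a b : complex.Im (a * b) = complex.Re a * complex.Im b + complex.Im a * complex.Re b.
Proof. by case: a b => ? ? []. Qed.
Lemma ReJ a : complex.Re (a^*) = complex.Re a. Proof. by case: a. Qed.
Lemma ImJ a : complex.Im (a^*) = - complex.Im a. Proof. by case: a. Qed.
Lemma Re_sum (J : Type) (s : seq J) (F : J -> R[i]) :
  complex.Re (\sum_(j <- s) F j) = \sum_(j <- s) complex.Re (F j).
Proof. by elim/big_rec2: _ => // j x y _ <-; rewrite ReD. Qed.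
Lemma Im_sum (J : Type) (s : seq J) (F : J -> R[i]) :
  complex.Im (\sum_(j <- s) F j) = \sum_(j <- s) complex.Im (F j).
Proof. by elim/big_rec2: _ => // j x y _ <-; rewrite ImD. Qed.

Definition abs2 a : R := complex.Re a ^+ 2 + complex.Im a ^+ 2.

Lemma abs2_ge0 a : 0 <= abs2 a. Proof. by rewrite addr_ge0 ?sqr_ge0. Qed.
Lemma abs2M a b : abs2 (a * b) = abs2 a * abs2 b.
Proof. by rewrite /abs2 ReM ImM; ring. Qed.
Lemma Re_mulJ a : complex.Re (a * a^*) = abs2 a.
Proof. by rewrite ReM ReJ ImJ /abs2; ring. Qed.
End ComplexParts.

Section SemiInner.
Variables (R : realType) (V : lmodType R[i]) (dot : V -> V -> R[i]).
Implicit Types (u v w f g : V) (a : R[i]).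

(** Only semidefinite: elements of L^2 are represented by functions rather than
    by classes, so that nonzero vectors may have norm 0. *)
Record semi_inner : Prop := SemiInner {
  dotDl : forall u v w, dot (u + v) w = dot u w + dot v w;
  dotZl : forall a u w, dot (a *: u) w = a * dot u w;
  dotC : forall u v, dot v u = (dot u v)^*;
  dot_ge0 : forall u, 0 <= complex.Re (dot u u) }.

Hypothesis dotP : semi_inner.

Definition nrm u : R := Num.sqrt (complex.Re (dot u u)).

Lemma dotDr u v w : dot w (u + v) = dot w u + dot w v.
Proof. by rewrite (dotC dotP (u + v) w) (dotDl dotP) rmorphD /= -!(dotC dotP). Qed.

Lemma dotZr a u w : dot w (a *: u) = a^* * dot w u.
Proof. by rewrite (dotC dotP (a *: u) w) (dotZl dotP) rmorphM /= -(dotC dotP). Qed.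

Lemma dot0l w : dot 0 w = 0.
Proof. by rewrite -(scale0r (0 : V)) (dotZl dotP) mul0r. Qed.

Lemma dotNl u w : dot (- u) w = - dot u w.
Proof. by rewrite -scaleN1r (dotZl dotP) mulN1r. Qed.

Lemma dotNr u w : dot w (- u) = - dot w u.
Proof. by rewrite -scaleN1r dotZr rmorphN1 mulN1r. Qed.

Lemma dotBl u v w : dot (u - v) w = dot u w - dot v w.
Proof. by rewrite (dotDl dotP) dotNl. Qed.

Lemma dot_suml (J : Type) (s : seq J) (F : J -> V) w :
  dot (\sum_(j <- s) F j) w = \sum_(j <- s) dot (F j) w.
Proof.
by elim/big_rec2: _ => [|j x y _ <-]; [exact: dot0l|rewrite (dotDl dotP)].
Qed.

Lemma nrm_ge0 u : 0 <= nrm u. Proof. exact: sqrtr_ge0. Qed.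

Lemma nrm2 u : nrm u ^+ 2 = complex.Re (dot u u).
Proof. by rewrite sqr_sqrtr // (dot_ge0 dotP). Qed.

Lemma nrm2D u v : nrm (u + v) ^+ 2 = nrm u ^+ 2 + nrm v ^+ 2 + 2 * complex.Re (dot u v).
Proof.
by rewrite !nrm2 (dotDl dotP) !dotDr (dotC dotP u v) !ReD ReJ; ring.
Qed.

Lemma nrm2Z a u : nrm (a *: u) ^+ 2 = abs2 a * nrm u ^+ 2.
Proof.
by rewrite !nrm2 (dotZl dotP) dotZr mulrA ReM Re_mulJ ImM ReJ ImJ; ring.
Qed.

Lemma nrmZ (k : R) u : nrm (k%:C *: u) = `|k| * nrm u.
Proof.
apply/eqP; rewrite -(eqrXn2 (n := 2)) ?mulr_ge0 ?nrm_ge0 // nrm2Z exprMn.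
by rewrite real_normK ?num_real // /abs2 /= expr0n addr0.
Qed.

Lemma nrmN u : nrm (- u) = nrm u.
Proof. by rewrite /nrm dotNl dotNr opprK. Qed.

Lemma nrm0 : nrm 0 = 0.
Proof. by rewrite /nrm dot0l sqrtr0. Qed.

Lemma nrmC u v : nrm (u - v) = nrm (v - u).
Proof. by rewrite -nrmN opprB. Qed.

(** The quadratic polynomial in t giving the squared norm of v - t u is
    nonnegative. *)
Lemma Re_dot_le u v : complex.Re (dot u v) <= nrm u * nrm v.
Proof.
set p := complex.Re _.
have q (t : R) : 0 <= t ^+ 2 * nrm u ^+ 2 + nrm v ^+ 2 - 2 * t * p.
  have := sqr_ge0 (nrm ((- t)%:C *: u + v)); rewrite nrm2D nrmZ exprMn real_normK ?num_real //.
  rewrite sqrrN (dotZl dotP) ReM /= mul0r subr0 -/p; lra.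
rewrite leNgt; apply/negP => h.
have a0 := nrm_ge0 u; have b0 := nrm_ge0 v.
have p0 : 0 < p by apply: le_lt_trans h; exact: mulr_ge0.
have [a1|a1] := eqVneq (nrm u) 0.
  have := q ((nrm v ^+ 2 + 1) / (2 * p)); rewrite a1 expr0n mulr0 add0r.
  have -> : 2 * ((nrm v ^+ 2 + 1) / (2 * p)) * p = nrm v ^+ 2 + 1 by field; rewrite gt_eqF.
  lra.
have := q (p / nrm u ^+ 2).
have -> : (p / nrm u ^+ 2) ^+ 2 * nrm u ^+ 2 + nrm v ^+ 2 - 2 * (p / nrm u ^+ 2) * p =
  nrm v ^+ 2 - p ^+ 2 / nrm u ^+ 2 by field.
rewrite subr_ge0 ler_pdivrMr ?exprn_gt0 ?lt0r ?a1 // -exprMn mulrC.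
rewrite ler_pXn2r ?nnegrE ?mulr_ge0 // ?(ltW p0) // => /(lt_le_trans h).
by rewrite ltxx.
Qed.

Lemma nrmD u v : nrm (u + v) <= nrm u + nrm v.
Proof.
rewrite -(ler_pXn2r (n := 2)) ?nnegrE ?addr_ge0 ?nrm_ge0 //.
by rewrite nrm2D sqrrD; have := Re_dot_le u v; lra.
Qed.

Lemma nrmB u v : nrm (u - v) <= nrm u + nrm v.
Proof. by rewrite -(nrmN v); exact: nrmD. Qed.

Lemma nrm_tri u v w : nrm (u - w) <= nrm (u - v) + nrm (v - w).
Proof. by rewrite (_ : u - w = (u - v) + (v - w)) ?nrmD // addrA subrK. Qed.

Lemma nrm_le_sub u v : nrm u <= nrm v + nrm (u - v).
Proof. by rewrite -{1}(subrK v u) addrC nrmD. Qed.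

Lemma null_eq u v : nrm (u - v) = 0 -> nrm u = nrm v.
Proof.
move=> h; apply/le_anti; have := nrm_le_sub u v; have := nrm_le_sub v u.
by rewrite (nrmC v u) h !addr0 => -> ->.
Qed.

(** Limits are determined only up to vectors of norm 0; this is how identities
    are obtained from them. *)
Lemma nrm_null (k : R) u : 0 <= k -> (forall e, 0 < e -> nrm u <= k * e) -> nrm u = 0.
Proof.
move=> k0 h; apply/le_anti; rewrite nrm_ge0 andbT leNgt; apply/negP => u0.
have k1 : 0 < k + 1 by lra.
have := h (nrm u / (k + 1)); rewrite divr_gt0 // => /(_ isT).
by rewrite mulrCA ler_pMr // ler_pdivlMr // mul1r; lra.
Qed.

Definition cvg_nrm (x : nat -> V) l := forall e, 0 < e ->
  exists N, forall n, (N <= n)%N -> nrm (x n - l) < e.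
Definition cauchy_nrm (x : nat -> V) := forall e, 0 < e ->
  exists N, forall m n, (N <= m)%N -> (m <= n)%N -> nrm (x n - x m) < e.

Section Orthonormal.
Variables (I : eqType) (b : I -> V).
Hypothesis bP : forall i j, dot (b i) (b j) = (i == j)%:R.

Lemma dot_comb (s : seq I) (c : I -> R[i]) j : uniq s ->
  dot (\sum_(i <- s) c i *: b i) (b j) = if j \in s then c j else 0.
Proof.
move=> us; rewrite dot_suml.
under eq_bigr do rewrite (dotZl dotP) bP.
case: ifPn => js.
  rewrite (bigD1_seq j) //= eqxx mulr1 big1 ?addr0 // => i /negbTE ->; exact: mulr0.
rewrite big_seq big1 // => i si; case: eqP => [E|_]; last exact: mulr0.
by move: js; rewrite -E si.
Qed.

Lemma nrm2_comb (s : seq I) (c : I -> R[i]) : uniq s ->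
  nrm (\sum_(i <- s) c i *: b i) ^+ 2 = \sum_(i <- s) abs2 (c i).
Proof.
move=> us; rewrite nrm2; set w := (X in dot _ X).
rewrite dot_suml Re_sum; rewrite big_seq [RHS]big_seq; apply: eq_bigr => i si.
rewrite (dotZl dotP) (dotC dotP w) dot_comb // si; exact: Re_mulJ.
Qed.

(** Projection on the span of the vectors b i, i in s, when s has no repetition.
    *)
Definition proj (s : seq I) f := \sum_(i <- s) dot f (b i) *: b i.

Lemma proj_orth s f : uniq s -> nrm (f - proj s f) ^+ 2 = nrm f ^+ 2 - nrm (proj s f) ^+ 2.
Proof.
move=> us; have E : dot f (proj s f) = dot (proj s f) (proj s f).
  rewrite (dotC dotP (proj s f) f) [in RHS](dotC dotP (proj s f)); congr (_^*).
  rewrite {1 3}/proj !dot_suml big_seq [RHS]big_seq; apply: eq_bigr => i si.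
  rewrite !(dotZl dotP); congr (_ * _).
  by rewrite (dotC dotP (proj s f)) dot_comb // si -(dotC dotP).
rewrite nrm2D nrmN dotNr ReN E -nrm2; ring.
Qed.

Lemma nrm_proj s f : uniq s -> nrm (proj s f) <= nrm f.
Proof.
move=> us; rewrite -(ler_pXn2r (n := 2)) ?nnegrE ?nrm_ge0 //.
by rewrite -subr_ge0 -proj_orth // sqr_ge0.
Qed.

Lemma nrm_sub_proj s f : uniq s -> nrm (f - proj s f) <= nrm f.
Proof.
move=> us; rewrite -(ler_pXn2r (n := 2)) ?nnegrE ?nrm_ge0 // proj_orth //.
by rewrite gerBl sqr_ge0.
Qed.

Lemma projB s f g : proj s (f - g) = proj s f - proj s g.
Proof.
rewrite /proj -sumrB; apply: eq_bigr => i _.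
by rewrite dotBl scalerBl.
Qed.

Lemma proj_comb s (t : seq I) c : uniq s -> {subset t <= s} ->
  proj s (\sum_(i <- t) c i *: b i) = \sum_(i <- t) c i *: b i.
Proof.
move=> us ts; rewrite /proj.
under eq_bigr => i _ do rewrite dot_suml scaler_suml.
rewrite exchange_big /= big_seq [RHS]big_seq; apply: eq_bigr => j tj.
rewrite (bigD1_seq j) ?ts //= (dotZl dotP) bP eqxx mulr1 big1 ?addr0 // => i ij.
by rewrite (dotZl dotP) bP eq_sym (negbTE ij) mulr0 scale0r.
Qed.

Lemma best_approx s t c f : uniq s -> {subset t <= s} ->
  nrm (f - proj s f) <= nrm (f - \sum_(i <- t) c i *: b i).
Proof.
move=> us ts; set g := \sum_(i <- t) _.
have -> : f - proj s f = (f - g) - proj s (f - g).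
  by rewrite projB (proj_comb _ us ts) -/g opprB addrA subrK.
exact: nrm_sub_proj.
Qed.

End Orthonormal.
End SemiInner.

(** * Small perturbations of an orthonormal basis *)

Section Perturbation.
Variables (R : realType) (V : lmodType R[i]) (dot : V -> V -> R[i]).
Hypothesis dotP : semi_inner dot.
Local Notation nrm := (nrm dot).
Implicit Types (f g : V).

(** Linear up to vectors of norm 0. *)
Definition null_linear (U : V -> V) := forall a f g, nrm (U (a *: f + g) - (a *: U f + U g)) = 0.
Definition nrm_bounded (U : V -> V) := exists C : R, forall f, nrm (U f) <= C * nrm f.

Lemma null_linearB U f g : null_linear U -> nrm (U (f - g) - (U f - U g)) = 0.
Proof.
move=> lU; have := lU (-1) g f; rewrite !scaleN1r.
by rewrite (addrC (- g)) (addrC (- U g)).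
Qed.

Hypothesis complete : forall x : nat -> V, cauchy_nrm dot x -> exists l, cvg_nrm dot x l.

Variables (I : eqType) (b fam : I -> V) (W : nat -> seq I).
Hypothesis bP : forall i j, dot (b i) (b j) = (i == j)%:R.
Hypothesis b_total : forall f (e : R), 0 < e ->
  exists (s : seq I) (c : I -> R[i]), nrm (f - \sum_(i <- s) c i *: b i) < e.
Hypothesis W_uniq : forall n, uniq (W n).
Hypothesis W_mono : forall m n, (m <= n)%N -> {subset W m <= W n}.
Hypothesis W_exhaust : forall i, exists n, i \in W n.

Variables k lam : R.
Hypothesis k_gt0 : 0 < k.
Hypothesis lam_ge0 : 0 <= lam.
Hypothesis close : forall (s : seq I) (c : I -> R[i]), uniq s ->
  nrm (\sum_(i <- s) c i *: (fam i - k%:C *: b i)) <= lam * k * nrm (\sum_(i <- s) c i *: b i).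

(** Expand f on the basis along the finite window W n, and replace the basis
    vectors by the perturbed ones. The windows exhaust the index set. *)
Definition partial_synth n f := \sum_(i <- W n) dot f (b i) *: fam i.

Lemma W_seq (s : seq I) : exists n, {subset s <= W n}.
Proof.
elim: s => [|i s [n sn]]; first by exists 0%N.
have [m im] := W_exhaust i; exists (maxn m n) => j; rewrite inE => /predU1P[->|js].
  exact: W_mono (leq_maxl m n) _ im.
exact: W_mono (leq_maxr m n) _ (sn _ js).
Qed.

Lemma proj_cvg f (e : R) : 0 < e ->
  exists N, forall n, (N <= n)%N -> nrm (f - proj dot b (W n) f) < e.
Proof.
move=> e0; have [s [c h]] := b_total f e0; have [N sN] := W_seq s.
exists N => n Nn; apply: le_lt_trans h.
by apply: best_approx => // i /sN; exact: W_mono.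
Qed.

Lemma partial_synth_close n f : nrm (partial_synth n f - k%:C *: proj dot b (W n) f) <= lam * k * nrm f.
Proof.
have -> : partial_synth n f - k%:C *: proj dot b (W n) f =
    \sum_(i <- W n) dot f (b i) *: (fam i - k%:C *: b i).
  rewrite /partial_synth /proj scaler_sumr -sumrB; apply: eq_bigr => i _.
  by rewrite scalerBr !scalerA mulrC.
apply: (le_trans (close _ (W_uniq n))).
by rewrite ler_wpM2l ?mulr_ge0 ?(ltW k_gt0) // -/(proj dot b (W n) f) nrm_proj.
Qed.

Lemma partial_synth_bounded n f : nrm (partial_synth n f) <= (1 + lam) * k * nrm f.
Proof.
have K0 := k_gt0; have L0 := lam_ge0.
have := nrm_le_sub dotP (partial_synth n f) (k%:C *: proj dot b (W n) f).
rewrite nrmZ // gtr0_norm //; have := partial_synth_close n f.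
have : k * nrm (proj dot b (W n) f) <= k * nrm f by rewrite ler_pM2l // nrm_proj.
lra.
Qed.

Lemma partial_synth_linear n a f g : partial_synth n (a *: f + g) = a *: partial_synth n f + partial_synth n g.
Proof.
rewrite /partial_synth scaler_sumr -big_split /=; apply: eq_bigr => i _.
by rewrite (dotDl dotP) (dotZl dotP) scalerDl scalerA.
Qed.

Lemma partial_synthB n f g : partial_synth n (f - g) = partial_synth n f - partial_synth n g.
Proof.
by rewrite addrC -scaleN1r partial_synth_linear scaleN1r addrC.
Qed.

Lemma partial_synth_basis n i : i \in W n -> partial_synth n (b i) = fam i.
Proof.
move=> iW; rewrite /partial_synth (bigD1_seq i) //= bP eqxx scale1r big1 ?addr0 // => j ji.
by rewrite bP eq_sym (negbTE ji) scale0r.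
Qed.

(** The later windows reproduce the earlier partial sums on projections, which
    reduces the Cauchy property of the partial sums to convergence of the
    projections. *)
Lemma partial_synth_proj m n f : (m <= n)%N -> partial_synth n (proj dot b (W m) f) = partial_synth m f.
Proof.
move=> mn; rewrite /proj.
have E (s : seq I) : {subset s <= W n} ->
    partial_synth n (\sum_(i <- s) dot f (b i) *: b i) = \sum_(i <- s) dot f (b i) *: fam i.
  elim: s => [|i s IH] sW.
    by rewrite !big_nil /partial_synth big1 // => i _; rewrite dot0l // scale0r.
  rewrite !big_cons partial_synth_linear IH; last by move=> j js; apply: sW; rewrite inE js orbT.
  by rewrite partial_synth_basis //; apply: sW; exact: mem_head.
by apply: E; exact: W_mono.
Qed.

Lemma partial_synth_cvg f : exists l, cvg_nrm dot (partial_synth ^~ f) l.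
Proof.
apply: complete => e e0; have B0 : 0 < (1 + lam) * k by rewrite mulr_gt0 //; move: lam_ge0; lra.
have [N h] := proj_cvg f (divr_gt0 e0 B0).
exists N => m n Nm mn /=; rewrite -(partial_synth_proj f mn) -partial_synthB.
apply: (le_lt_trans (partial_synth_bounded _ _)).
by rewrite -ltr_pdivlMl // mulrC h.
Qed.

Lemma partial_synth_limit : exists U : V -> V,
  [/\ null_linear U, nrm_bounded U,
      forall f, nrm (U f - k%:C *: f) <= lam * k * nrm f &
      forall i, nrm (U (b i) - fam i) = 0].
Proof.
have K0 := k_gt0; have L0 := lam_ge0.
have /choice[U UP] := partial_synth_cvg; exists U.
split.
- move=> a f g.
  have s0 : 0 <= Num.sqrt (abs2 a) by exact: sqrtr_ge0.
  apply: (@nrm_null _ _ dot (2 + Num.sqrt (abs2 a))); first lra.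
  move=> e e0.
  have [N1 h1] := UP (a *: f + g) e e0.
  have [N2 h2] := UP f e e0; have [N3 h3] := UP g e e0.
  set n := maxn N1 (maxn N2 N3).
  have {}h1 := h1 n (leq_maxl _ _).
  have {}h2 := h2 n (leq_trans (leq_maxl _ _) (leq_maxr _ _)).
  have {}h3 := h3 n (leq_trans (leq_maxr _ _) (leq_maxr _ _)).
  have E : U (a *: f + g) - (a *: U f + U g) =
     (a *: (partial_synth n f - U f) + (partial_synth n g - U g)) - (partial_synth n (a *: f + g) - U (a *: f + g)).
    by rewrite partial_synth_linear scalerBr addrACA -opprD opprB [RHS]addrC addrA subrK.
  have zE x : nrm (a *: x) = Num.sqrt (abs2 a) * nrm x.
    apply/eqP; rewrite -(eqrXn2 (n := 2)) ?mulr_ge0 ?nrm_ge0 // nrm2Z // exprMn.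
    by rewrite (sqr_sqrtr (abs2_ge0 a)).
  rewrite E; apply: (le_trans (nrmB dotP _ _)).
  have := nrmD dotP (a *: (partial_synth n f - U f)) (partial_synth n g - U g); rewrite zE.
  have : Num.sqrt (abs2 a) * nrm (partial_synth n f - U f) <= Num.sqrt (abs2 a) * e.
    by rewrite ler_wpM2l // ltW.
  lra.
- exists ((1 + lam) * k) => f; rewrite leNgt; apply/negP => h.
  have [|N hN] := UP f (nrm (U f) - (1 + lam) * k * nrm f); first by rewrite subr_gt0.
  have := hN N (leqnn N).
  have := partial_synth_bounded N f; have := nrm_le_sub dotP (U f) (partial_synth N f).
  by rewrite (nrmC dotP (U f)); lra.
- move=> f; rewrite leNgt; apply/negP => h.
  set d := nrm (U f - k%:C *: f) - lam * k * nrm f.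
  have d0 : 0 < d by rewrite subr_gt0.
  have e0 : 0 < d / (2 + k) by rewrite divr_gt0 //; lra.
  have [N1 h1] := UP f _ e0; have [N2 h2] := proj_cvg f e0.
  set n := maxn N1 N2; have {}h1 := h1 n (leq_maxl _ _); have {}h2 := h2 n (leq_maxr _ _).
  have t1 := nrm_tri dotP (U f) (partial_synth n f) (k%:C *: f).
  have t2 := nrm_tri dotP (partial_synth n f) (k%:C *: proj dot b (W n) f) (k%:C *: f).
  rewrite (nrmC dotP (U f) (partial_synth n f)) in t1.
  rewrite -scalerBr nrmZ // gtr0_norm // (nrmC dotP (proj _ _ _ _)) in t2.
  have t3 := partial_synth_close n f.
  have t4 : k * nrm (f - proj dot b (W n) f) < k * (d / (2 + k)) by rewrite ltr_pM2l.
  have t5 : d = 2 * (d / (2 + k)) + k * (d / (2 + k)) by field; lra.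
  have t6 : nrm (U f - k%:C *: f) = d + lam * k * nrm f by rewrite /d; ring.
  move: t1 t2 t3 t4 t5 t6 h1 e0; move: (d / (2 + k)) => q; lra.
- move=> i; apply: (@nrm_null _ _ dot 1) => // e e0; rewrite mul1r.
  have [N1 h1] := UP (b i) e e0; have [N2 iN] := W_exhaust i.
  have := h1 (maxn N1 N2) (leq_maxl _ _).
  rewrite partial_synth_basis; last exact: W_mono (leq_maxr _ _) _ iN.
  by rewrite (nrmC dotP) => /ltW.
Qed.

End Perturbation.

Section Neumann.
Variables (R : realType) (V : lmodType R[i]) (dot : V -> V -> R[i]).
Hypothesis dotP : semi_inner dot.
Local Notation nrm := (nrm dot).
Implicit Types (f g : V).
Hypothesis complete : forall x : nat -> V, cauchy_nrm dot x -> exists l, cvg_nrm dot x l.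
Variables (U : V -> V) (k lam : R).
Hypothesis k_gt0 : 0 < k.
Hypothesis lam_ge0 : 0 <= lam.
Hypothesis lam_lt1 : lam < 1.
Hypothesis lU : null_linear dot U.
Hypothesis closeU : forall f, nrm (U f - k%:C *: f) <= lam * k * nrm f.

Lemma perturbation_le f : nrm (U f) <= (1 + lam) * k * nrm f.
Proof.
have K0 := k_gt0; have L0 := lam_ge0; have L1 := lam_lt1.
have := nrm_le_sub dotP (U f) (k%:C *: f); rewrite nrmZ // gtr0_norm //.
have := closeU f; lra.
Qed.

Lemma perturbation_ge f : (1 - lam) * k * nrm f <= nrm (U f).
Proof.
have K0 := k_gt0; have L0 := lam_ge0; have L1 := lam_lt1.
have := nrm_le_sub dotP (k%:C *: f) (U f); rewrite nrmZ // gtr0_norm // nrmC //.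
have := closeU f; lra.
Qed.

Lemma nrm_UB f g : nrm (U f - U g) = nrm (U (f - g)).
Proof. by apply/esym/(null_eq dotP); exact: null_linearB. Qed.

Let step g x := x + (k^-1)%:C *: (g - U x).
Let iterate g n := iter n (step g) 0.

Lemma residual_step g x : nrm (g - U (step g x)) <= lam * nrm (g - U x).
Proof.
set r := g - U x.
have kk : (k%:C : R[i]) * (k^-1)%:C = 1.
  by rewrite -rmorphM /= divff ?gt_eqF // rmorph1.
have E : nrm (g - U (step g x)) = nrm (r - (k^-1)%:C *: U r).
  rewrite nrmC // [RHS]nrmC //; apply: (null_eq dotP).
  have <- := lU (k^-1)%:C r x; congr (nrm _).
  rewrite /step -/r (addrC x) opprB {3}/r -(addrA g) subrKA -opprD.
  by rewrite (addrC (U x)).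
rewrite E.
have -> : r - (k^-1)%:C *: U r = - ((k^-1)%:C *: (U r - k%:C *: r)).
  by rewrite scalerBr scalerA mulrC kk scale1r opprB.
rewrite nrmN // nrmZ // ger0_norm ?invr_ge0 ?(ltW k_gt0) //.
by rewrite ler_pdivrMl // mulrCA mulrA closeU.
Qed.

Lemma residual_iter g n : nrm (g - U (iterate g n)) <= lam ^+ n * nrm (g - U 0).
Proof.
elim: n => [|n IH]; first by rewrite expr0 mul1r.
rewrite /iterate iterS; apply: (le_trans (residual_step _ _)).
by rewrite exprS -mulrA ler_wpM2l.
Qed.

Lemma iterate_dist g m n : (m <= n)%N ->
  nrm (iterate g n - iterate g m) <= k^-1 * nrm (g - U 0) * (lam ^+ m / (1 - lam)).
Proof.
have K0 := k_gt0; have L0 := lam_ge0; have L1 := lam_lt1.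
have l1 : 0 < 1 - lam by lra.
have KN : 0 <= k^-1 * nrm (g - U 0) by rewrite mulr_ge0 ?nrm_ge0 // invr_ge0 ltW.
move=> mn; suff : nrm (iterate g n - iterate g m) <=
    k^-1 * nrm (g - U 0) * ((lam ^+ m - lam ^+ n) / (1 - lam)).
  move/le_trans; apply; rewrite ler_wpM2l // ler_pM2r ?invr_gt0 // gerBl exprn_ge0 //.
elim: n mn => [|n IH]; first by rewrite leqn0 => /eqP ->; rewrite !subrr nrm0 // mul0r mulr0.
rewrite leq_eqVlt => /predU1P[<-|]; first by rewrite !subrr nrm0 // mul0r mulr0.
rewrite ltnS => /IH {}IH.
have := nrm_tri dotP (iterate g n.+1) (iterate g n) (iterate g m).
have -> : iterate g n.+1 - iterate g n = (k^-1)%:C *: (g - U (iterate g n)).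
  by rewrite /iterate iterS /step addrC addKr.
rewrite nrmZ // ger0_norm ?invr_ge0 ?(ltW k_gt0) //.
have : k^-1 * nrm (g - U (iterate g n)) <= k^-1 * (lam ^+ n * nrm (g - U 0)).
  by rewrite ler_pM2l ?invr_gt0 // residual_iter.
have -> : k^-1 * nrm (g - U 0) * ((lam ^+ m - lam ^+ n.+1) / (1 - lam)) =
  k^-1 * nrm (g - U 0) * ((lam ^+ m - lam ^+ n) / (1 - lam)) + k^-1 * (lam ^+ n * nrm (g - U 0)).
  by rewrite exprS; field; rewrite !gt_eqF.
lra.
Qed.

Lemma lam_pow_small (C e : R) : 0 < e -> exists N, forall n, (N <= n)%N -> C * lam ^+ n < e.
Proof.
move=> e0.
have : C * lam ^+ n @[n --> \oo] --> (C * 0 : R).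
  apply: cvgM; first exact: cvg_cst.
  by apply: cvg_expr; rewrite ger0_norm.
rewrite mulr0 => /cvgrPdist_lt /(_ e e0)[N _ h]; exists N => n Nn.
by have := h n Nn; rewrite /= sub0r normrN => /(le_lt_trans (ler_norm _)).
Qed.

(** The Neumann iteration x + (g - U x) / k multiplies the norm of the residual
    g - U x by at most lam; the iterates are Cauchy and their limit solves U x =
    g. *)
Lemma perturbation_onto g : exists x, nrm (U x - g) = 0.
Proof.
have K0 := k_gt0; have L0 := lam_ge0; have L1 := lam_lt1.
have l1 : 0 < 1 - lam by lra.
have [|x xP] := @complete (iterate g).
  move=> e e0.
  have [N h] := lam_pow_small (k^-1 * nrm (g - U 0) / (1 - lam)) e0.
  exists N => m n Nm mn; apply: le_lt_trans (h m Nm).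
  by rewrite mulrAC -mulrA iterate_dist.
exists x; rewrite nrmC //.
apply: (@nrm_null _ _ dot (1 + (1 + lam) * k)); first by rewrite addr_ge0 ?mulr_ge0 ?(ltW k_gt0) //; lra.
move=> e e0.
have [N1 h1] := lam_pow_small (nrm (g - U 0)) e0.
have [N2 h2] := xP e e0.
set n := maxn N1 N2; have {}h1 := h1 n (leq_maxl _ _); have {}h2 := h2 n (leq_maxr _ _).
have := nrm_tri dotP g (U (iterate g n)) (U x); rewrite nrm_UB.
have := residual_iter g n; rewrite mulrC => r1.
have := perturbation_le (iterate g n - x).
have : (1 + lam) * k * nrm (iterate g n - x) <= (1 + lam) * k * e.
  by rewrite ler_wpM2l ?(ltW h2) // mulr_ge0 ?(ltW k_gt0) //; lra.
lra.
Qed.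

(** Solutions are unique up to norm 0 by the lower bound, so any choice of
    solutions is linear and bounded. *)
Lemma neumann_inverse : exists V' : V -> V,
  [/\ null_linear dot V', nrm_bounded dot V',
      forall f, nrm (V' (U f) - f) = 0 & forall f, nrm (U (V' f) - f) = 0].
Proof.
have /choice[V' VP] := perturbation_onto.
have B0 : 0 < (1 - lam) * k by rewrite mulr_gt0 // subr_gt0.
have inj f : nrm (U f) = 0 -> nrm f = 0.
  move=> h; have := perturbation_ge f; rewrite h pmulr_rle0 // => h'.
  by apply/le_anti; rewrite h' nrm_ge0.
exists V'; split => //.
- move=> a f g; apply: inj.
  have E1 := null_linearB (V' (a *: f + g)) (a *: V' f + V' g) lU.
  have E2 := lU a (V' f) (V' g).
  apply/le_anti; rewrite nrm_ge0 andbT (null_eq dotP E1).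
  apply: (le_trans (nrm_tri dotP _ (a *: U (V' f) + U (V' g)) _)).
  rewrite [X in _ + X]nrmC // E2 addr0.
  apply: (le_trans (nrm_tri dotP _ (a *: f + g) _)); rewrite VP add0r.
  rewrite opprD addrACA -scalerBr; apply: (le_trans (nrmD dotP _ _)).
  have -> : nrm (g - U (V' g)) = 0 by rewrite nrmC.
  rewrite addr0 -(ler_pXn2r (n := 2)) ?nnegrE ?nrm_ge0 //.
  by rewrite nrm2Z // (nrmC dotP f) VP !expr0n mulr0.
- exists ((1 - lam) * k)^-1 => f; rewrite ler_pdivlMl //.
  by apply: (le_trans (perturbation_ge _)); rewrite (null_eq dotP (VP f)).
- by move=> f; apply: inj; rewrite -nrm_UB VP.
Qed.

End Neumann.

(** * The vector space of square-integrable functions *)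

Section RealL2.
Context d (T : measurableType d) (R : realType).
Variable mu : {measure set T -> \bar R}.
Implicit Types f g : T -> R.

Lemma Lfun2P f : f \in Lfun mu 2%:E <->
  measurable_fun setT f /\ mu.-integrable setT (EFin \o (fun x => f x ^+ 2)).
Proof.
split=> [lf|[mf fi]].
  split; last exact: Lfun2_integrable_sqr.
  by move: lf; rewrite inE => /andP[/[!inE]].
rewrite inE; apply/andP; split; rewrite inE //= /finite_norm unlock /Lnorm poweR_lty //.
move: fi => /integrableP[_]; apply: le_lt_trans; apply: ge0_le_integral => //.
- by move=> x _; rewrite lee_fin powR_ge0.
- apply/measurable_EFinP/(@measurableT_comp _ _ _ _ _ _ (@powR R ^~ 2)) => //.
  exact: measurableT_comp.
- by apply: measurableT_comp => //; apply/measurable_EFinP; exact: measurable_funX.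
- by move=> x _; rewrite /= lee_fin normrX powR_mulrn.
Qed.

Lemma Lfun2_measurable f : f \in Lfun mu 2%:E -> measurable_fun setT f.
Proof. by case/Lfun2P. Qed.

Lemma Lfun2_mul f g : f \in Lfun mu 2%:E -> g \in Lfun mu 2%:E ->
  mu.-integrable setT (EFin \o (fun x => f x * g x)).
Proof. by move=> lf lg; apply/Lfun1_integrable; exact: Lfun2_mul_Lfun1. Qed.

Lemma Lfun2_lin (a b : R) f g : f \in Lfun mu 2%:E -> g \in Lfun mu 2%:E ->
  (fun x => a * f x + b * g x) \in Lfun mu 2%:E.
Proof.
move=> lf lg; have e : (1 <= 2%:E :> \bar R)%E by rewrite lee_fin ler1n.
have := Lfun_submod_closed mu e => -[h0 h].
have bg : (fun x => b * g x) \in Lfun mu 2%:E.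
  rewrite (_ : (fun x => b * g x) = b *: g + 0); first exact: h.
  by apply/funext => x; rewrite addr0.
exact: (h a f (fun x => b * g x) lf bg).
Qed.

Lemma Lfun2B f g : f \in Lfun mu 2%:E -> g \in Lfun mu 2%:E ->
  (fun x => f x - g x) \in Lfun mu 2%:E.
Proof.
by move=> lf lg; have := Lfun2_lin 1 (-1) lf lg; under eq_fun do rewrite mul1r mulN1r.
Qed.

Lemma Rint_lin (a b : R) f g : mu.-integrable setT (EFin \o f) -> mu.-integrable setT (EFin \o g) ->
  mu.-integrable setT (EFin \o (fun x => a * f x + b * g x)) /\
  \int[mu]_x (a * f x + b * g x) = a * \int[mu]_x f x + b * \int[mu]_x g x.
Proof.
move=> fi gi.
have s (c : R) (h : T -> R) : mu.-integrable setT (EFin \o h) ->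
    mu.-integrable setT (EFin \o (fun x => c * h x)).
  exact: integrable_scale.
split; last by rewrite RintegralD // ?RintegralZl //; exact: s.
rewrite (_ : _ \o _ = (EFin \o (fun x => a * f x)%R) \+ (EFin \o (fun x => b * g x)%R))%E //.
by apply: integrableD => //; exact: s.
Qed.

End RealL2.

Section ComplexL2.
Context d (T : measurableType d) (R : realType).
Variable mu : {measure set T -> \bar R}.
Local Notation re := (@complex.Re R).
Local Notation im := (@complex.Im R).
Implicit Types f g : T -> R[i].

(** The subtype L2fun built on this predicate is a complex vector space, to
    which the abstract perturbation theorem applies. *)
Definition L2pred : {pred (T -> R[i])} := fun f => `[< L2 mu f >].

Lemma L2predP f : reflect (L2 mu f) (f \in L2pred).
Proof. exact: asboolP. Qed.

Lemma L2_submod_closed : submod_closed L2pred.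
Proof.
have e : (1 <= 2%:E :> \bar R)%E by rewrite lee_fin ler1n.
have [h0 _] := Lfun_submod_closed mu e.
split; first by apply/L2predP; split; exact: h0.
move=> a f g /L2predP[rf jf] /L2predP[rg jg]; apply/L2predP.
have h1 := Lfun2_lin (re a) (- im a) rf jf; have h2 := Lfun2_lin (re a) (im a) jf rf.
have h3 := Lfun2_lin 1 1 h1 rg; have h4 := Lfun2_lin 1 1 h2 jg.
split.
  rewrite (_ : (fun x => re ((a *: f + g) x)) =
    (fun x => 1 * (re a * re (f x) + - im a * im (f x)) + 1 * re (g x))) //.
  by apply/funext => x; rewrite !fctE ReD [_ *: _]/(a * f x) ReM !mul1r mulNr.
rewrite (_ : (fun x => im ((a *: f + g) x)) =
  (fun x => 1 * (re a * im (f x) + im a * re (f x)) + 1 * im (g x))) //.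
by apply/funext => x; rewrite !fctE ImD [_ *: _]/(a * f x) ImM !mul1r.
Qed.

HB.instance Definition _ := GRing.isSubmodClosed.Build _ _ L2pred L2_submod_closed.

Definition L2fun := {f : T -> R[i] | f \in L2pred}.
HB.instance Definition _ := [isSub of L2fun for @proj1_sig _ _].
HB.instance Definition _ := [Choice of L2fun by <:].
HB.instance Definition _ := [SubChoice_isSubLmodule of L2fun by <:].

End ComplexL2.

(** * Completeness of real L^2 of a finite measure *)

Section RieszFischer.
Context d (T : measurableType d) (R : realType).
Variable mu : {measure set T -> \bar R}.
Hypothesis mu_fin : (mu setT < +oo)%E.
Implicit Types f g : T -> R.

Let L2 f := f \in Lfun mu 2%:E.
Let sqn f := \int[mu]_x (f x ^+ 2).

Let sqn_E f : L2 f -> (sqn f)%:E = (\int[mu]_x (f x ^+ 2)%:E)%E.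
Proof.
by move=> /Lfun2P[_ fi]; rewrite /sqn /Rintegral fineK // integrable_fin_num.
Qed.

Let mu_real : (fine (mu setT))%:E = mu setT.
Proof. by rewrite fineK // ge0_fin_numE. Qed.

(** Integrate |y| <= (y^2 / e + e) / 2; on a space of finite measure this turns
    smallness in L^2 into smallness in L^1. *)
Lemma int_abs_le f (e : R) : 0 < e -> L2 f -> sqn f <= e ^+ 2 ->
  (\int[mu]_x `|f x|%:E <= (e * (1 + fine (mu setT)))%:E)%E.
Proof.
move=> e0 lf fe; have [mf fi] := (Lfun2P mu f).1 lf.
have ic : mu.-integrable setT (EFin \o (fun _ : T => e)).
  apply/integrableP; split; first exact: measurable_cst.
  by rewrite integral_cst // -mu_real -EFinM ltry.
have [i1 E1] := Rint_lin e^-1 1 fi ic.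
have : (\int[mu]_x `|f x|%:E <= \int[mu]_x (e^-1 * f x ^+ 2 + 1 * e)%:E)%E.
  apply: ge0_le_integral => //.
  - by apply/measurable_EFinP; exact: measurableT_comp.
  - by case/integrableP: i1.
  - move=> x _; rewrite lee_fin mul1r -real_normK ?num_real //.
    have -> : e^-1 * `|f x| ^+ 2 + e = e^-1 * (`|f x| - e) ^+ 2 + 2 * `|f x|.
      by field; rewrite gt_eqF.
    have : 0 <= e^-1 * (`|f x| - e) ^+ 2 by rewrite mulr_ge0 ?sqr_ge0 // invr_ge0 ltW.
    by have := normr_ge0 (f x); lra.
move/le_trans; apply.
rewrite -[leLHS]fineK; last exact: integrable_fin_num.
rewrite lee_fin -/(Rintegral _ _ _) E1 -/(sqn f) Rintegral_cst //.
have : e^-1 * sqn f <= e by rewrite ler_pdivrMl // -expr2.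
lra.
Qed.

(** The proof of Riesz and Fischer. Along a fast subsequence v the increments
    have summable L^1 norms, so v converges almost everywhere; Fatou gives the
    L^2 bound for the limit. *)
Lemma L2_complete_real (u : nat -> T -> R) : (forall n, L2 (u n)) ->
  (forall e : R, 0 < e -> exists N, forall m n, (N <= m)%N -> (m <= n)%N ->
     sqn (fun x => u n x - u m x) <= e) ->
  exists2 l, L2 l & forall e : R, 0 < e -> exists N, forall n, (N <= n)%N ->
     sqn (fun x => u n x - l x) <= e.
Proof.
move=> lu cu.
have /choice[N0 N0P] : forall k : nat, exists N, forall m n, (N <= m)%N -> (m <= n)%N ->
    sqn (fun x => u n x - u m x) <= (2^-1 ^+ k) ^+ 2.
  by move=> k; apply: cu; rewrite exprn_gt0 // exprn_gt0 // invr_gt0.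
(* partial sums make the subsequence monotone while staying above N0 *)
pose p k := \sum_(j < k.+1) N0 j.
have pN k : (N0 k <= p k)%N by rewrite /p big_ord_recr /= leq_addl.
have pS k : (p k <= p k.+1)%N by rewrite /p [in X in (_ <= X)%N]big_ord_recr /= leq_addr.
have pm j k : (j <= k)%N -> (p j <= p k)%N.
  by move=> /subnKC <-; elim: (k - j)%N => [|i IH]; rewrite ?addn0 // addnS (leq_trans IH).
pose v k := u (p k).
pose w k x := v k.+1 x - v k x.
have lw k : L2 (w k) by exact: (Lfun2B (lu _) (lu _)).
have mw k : measurable_fun setT (w k) by exact: Lfun2_measurable (lw k).
have mv k : measurable_fun setT (v k) by exact: Lfun2_measurable (lu _).
pose M := 1 + fine (mu setT).
have M0 : 0 <= M by rewrite addr_ge0 // fine_ge0.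
have hw k : (\int[mu]_x `|w k x|%:E <= (2^-1 ^+ k * M)%:E)%E.
  apply: int_abs_le; rewrite ?exprn_gt0 ?invr_gt0 //.
  exact: N0P (pN k) (pS k).
pose G x := (\sum_(k <oo) `|w k x|%:E)%E.
have iG : (\int[mu]_x G x <= (2 * M)%:E)%E.
  rewrite /G integral_nneseries //; last by move=> k; apply/measurable_EFinP; exact: measurableT_comp.
  apply: lime_le; first by apply: is_cvg_nneseries => k _ _; exact: integral_ge0.
  apply: nearW => n.
  apply: (@le_trans _ _ (\sum_(0 <= k < n) (2^-1 ^+ k * M)%:E)%E); first exact: lee_sum.
  rewrite sumEFin lee_fin -mulr_suml ler_wpM2r //.
  suff -> : \sum_(0 <= k < n) (2^-1 : R) ^+ k = 2 - 2 * 2^-1 ^+ n.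
    by rewrite gerBl mulr_ge0 // exprn_ge0 // invr_ge0.
  elim: n => [|n IH]; first by rewrite big_nil expr0; ring.
  by rewrite big_nat_recr //= IH exprS; field.
have mG : measurable_fun setT G.
  apply: ge0_emeasurable_sum => // k _; apply/measurable_EFinP; exact: measurableT_comp.
have G0 x : (0 <= G x)%E by apply: nneseries_ge0.
have GG : mu.-integrable setT G.
  apply/integrableP; split => //.
  under eq_integral => x _ do rewrite gee0_abs //.
  by apply: le_lt_trans iG _; exact: ltry.
have aeG : {ae mu, forall x, G x \is a fin_num}.
  by have := integrable_ae measurableT GG; apply: filterS => x; apply.
pose l x := if G x \is a fin_num then limn (v ^~ x) else 0.
have vcvg x : G x \is a fin_num -> v ^~ x @ \oo --> l x.
  move=> Gx; rewrite /l Gx.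
  have cs : cvgn (series (w ^~ x)).
    apply: normed_cvg; apply: nondecreasing_is_cvgn.
      by apply: nondecreasing_series => // i _ _; exact: normr_ge0.
    exists (fine (G x)) => _ [n _ <-].
    rewrite -lee_fin fineK // /series /= -sumEFin; exact: nneseries_lim_ge.
  have : cvgn (fun n => v 0%N x + series (w ^~ x) n).
    by apply: is_cvgD => //; exact: is_cvg_cst.
  rewrite (_ : (fun n => v 0%N x + series (w ^~ x) n) = v ^~ x) //.
  apply/funext => n.
  by rewrite /series /= /w (telescope_sumr (fun k => v k x)) // addrCA subrr addr0.
have ml : measurable_fun setT l.
  apply: (@measurable_fun_cvg _ _ _ setT (fun k x => if G x \is a fin_num then v k x else 0)).
    move=> k; apply: measurable_fun_ifT => //.
    by apply: (measurable_fun_bool true); exact/emeasurable_fin_num.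
  move=> x _; have [Gx|Gx] := boolP (G x \is a fin_num); first exact: vcvg.
  by rewrite /l (negbTE Gx); exact: cvg_cst.
have key m : (\int[mu]_x ((l x - v m x) ^+ 2)%:E <= ((2^-1 ^+ m) ^+ 2)%:E)%E.
  pose f k x := ((v k x - v m x) ^+ 2)%:E.
  have mf k : measurable_fun setT (f k).
    by apply/measurable_EFinP; apply: measurable_funX; exact: measurable_funB.
  have f0 k x : (0 <= f k x)%E by rewrite lee_fin sqr_ge0.
  apply: (@le_trans _ _ (\int[mu]_x limn_einf (f ^~ x))%E).
    apply: ae_ge0_le_integral => //.
    - by move=> x _; rewrite lee_fin sqr_ge0.
    - by apply/measurable_EFinP; apply: measurable_funX; exact: measurable_funB.
    - move=> x _; rewrite limn_einf_lim; apply: lime_ge; first exact: is_cvg_einfs.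
      by apply: nearW => n; apply: le_ereal_inf_tmp => _ [k _ <-].
    - rewrite /limn_einf; apply: measurableT_comp => //.
      by apply: measurable_fun_limn_esup => n; exact: measurableT_comp.
    apply: filterS aeG => x Gx _.
    have : f ^~ x @ \oo --> ((l x - v m x) ^+ 2)%:E.
      apply: cvg_EFin; first exact: nearW.
      apply: (@cvg_comp _ _ _ (fun k => v k x - v m x) (fun y => y ^+ 2)).
        by apply: cvgB; [exact: vcvg|exact: cvg_cst].
      exact: exprn_continuous.
    by move=> /cvg_limn_einf_sup[-> _].
  apply: (le_trans (fatou mu measurableT mf _)) => //.
  rewrite limn_einf_lim; apply: lime_le; first exact: is_cvg_einfs.
  apply: nearW => n.
  apply: (@le_trans _ _ (\int[mu]_x f (maxn n m) x)%E).
    by apply: ereal_inf_lbound; exists (maxn n m) => //=; exact: leq_maxl.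
  rewrite /f -sqn_E; last exact: (Lfun2B (lu _) (lu _)).
  by rewrite lee_fin; apply: N0P; [exact: pN|apply: pm; exact: leq_maxr].
have ldv m : L2 (fun x => l x - v m x).
  apply/Lfun2P; split; first exact: measurable_funB.
  apply/integrableP; split.
    by apply/measurable_EFinP; apply: measurable_funX; exact: measurable_funB.
  under eq_integral => x _ do rewrite gee0_abs ?lee_fin ?sqr_ge0 //.
  by apply: le_lt_trans (key m) _; exact: ltry.
have ll : L2 l.
  have := Lfun2_lin 1 1 (ldv 0%N) (lu (p 0%N)).
  by rewrite /L2; under eq_fun do rewrite !mul1r subrK.
exists l => // e e0.
have [m me] : exists m, 4 * (2^-1 ^+ m) ^+ 2 <= e.
  have : 4 * ((2^-1 ^+ 2) ^+ m : R) @[m --> \oo] --> (4 * 0 : R).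
    apply: cvgM; first exact: cvg_cst.
    by apply: cvg_expr; rewrite ger0_norm ?exprn_ge0 ?invr_ge0 //; lra.
  rewrite mulr0 => /cvgrPdist_le /(_ e e0)[m _ h]; exists m.
  have := h m (leqnn m); rewrite /= sub0r normrN => /(le_trans (ler_norm _)).
  by rewrite -!exprM mulnC.
exists (p m) => n pn.
have h1 : sqn (fun x => u n x - v m x) <= (2^-1 ^+ m) ^+ 2.
  by apply: N0P => //; exact: pN.
have h2 : sqn (fun x => l x - v m x) <= (2^-1 ^+ m) ^+ 2.
  by rewrite -lee_fin sqn_E.
have [_ i1] := (Lfun2P mu _).1 (Lfun2B (lu n) (lu (p m))).
have [_ i2] := (Lfun2P mu _).1 (ldv m).
have [_ i3] := (Lfun2P mu _).1 (Lfun2B (lu n) ll).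
have [i4 E] := Rint_lin 2 2 i1 i2.
have : sqn (fun x => u n x - l x) <= 2 * sqn (fun x => u n x - v m x) + 2 * sqn (fun x => l x - v m x).
  rewrite /sqn -E; apply: le_Rintegral => // x _.
  by have := sqr_ge0 (u n x - v m x + (l x - v m x)); rewrite /v; nra.
by move: me h1 h2; move: ((2^-1 ^+ m) ^+ 2) => q; lra.
Qed.

End RieszFischer.

(** * Riesz bases of L^2 by perturbation *)

Section L2Hilbert.
Context d (T : measurableType d) (R : realType).
Variable mu : {measure set T -> \bar R}.
Local Notation re := (@complex.Re R).
Local Notation im := (@complex.Im R).
Local Notation V := (L2fun mu).
Implicit Types f g : T -> R[i].

Let B (p q : T -> R) := \int[mu]_x (p x * q x).

Let B_lin (a b : R) (p q r : T -> R) : p \in Lfun mu 2%:E -> q \in Lfun mu 2%:E ->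
  r \in Lfun mu 2%:E -> B (fun x => a * p x + b * q x) r = a * B p r + b * B q r.
Proof.
move=> lp lq lr; have [_ <-] := Rint_lin a b (Lfun2_mul lp lr) (Lfun2_mul lq lr).
by apply: eq_Rintegral => x _; ring.
Qed.

Lemma L2dotE f g : L2 mu f -> L2 mu g -> L2dot mu f g =
  (B (re \o f) (re \o g) + B (im \o f) (im \o g)) +i*
  (B (im \o f) (re \o g) - B (re \o f) (im \o g)).
Proof.
move=> [rf jf] [rg jg]; rewrite /L2dot; congr (_ +i* _).
  have [_ E] := Rint_lin 1 1 (Lfun2_mul rf rg) (Lfun2_mul jf jg).
  rewrite !mul1r in E; rewrite -E; apply: eq_Rintegral => x _.
  by rewrite ReM ReJ ImJ; ring.
have [_ E] := Rint_lin 1 (-1) (Lfun2_mul jf rg) (Lfun2_mul rf jg).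
rewrite mul1r mulN1r in E; rewrite -E; apply: eq_Rintegral => x _.
by rewrite ImM ReJ ImJ; ring.
Qed.

Definition vdot (u v : V) : R[i] := L2dot mu (val u) (val v).

Lemma valL2 (u : V) : L2 mu (val u).
Proof. by apply/L2predP; exact: valP. Qed.

Definition toL2 f (h : L2 mu f) : V := exist _ f (introT (L2predP mu f) h).

Lemma val_lin (a : R[i]) (u v : V) : val (a *: u + v) = (fun x => a * val u x + val v x).
Proof. by []. Qed.

Lemma val_sum (J : Type) (s : seq J) (c : J -> R[i]) (u : J -> V) :
  val (\sum_(j <- s) c j *: u j) = (fun x => \sum_(j <- s) c j * val (u j) x).
Proof.
elim: s => [|j s IH]; first by apply/funext => x; rewrite !big_nil.
rewrite big_cons val_lin IH; apply/funext => x.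
by rewrite big_cons.
Qed.

Lemma L2_semi_inner : semi_inner vdot.
Proof.
have lin (a : R[i]) (u v w : V) : vdot (a *: u + v) w = a * vdot u w + vdot v w.
  rewrite /vdot !L2dotE; try exact: valL2.
  have [ru ju] := valL2 u; have [rv jv] := valL2 v; have [rw jw] := valL2 w.
  have E1 : re \o val (a *: u + v) =
      (fun x => 1 * (re a * re (val u x) + - im a * im (val u x)) + 1 * re (val v x)).
    by apply/funext => x; rewrite val_lin /= ReD ReM; ring.
  have E2 : im \o val (a *: u + v) =
      (fun x => 1 * (re a * im (val u x) + im a * re (val u x)) + 1 * im (val v x)).
    by apply/funext => x; rewrite val_lin /= ImD ImM; ring.
  have l1 := Lfun2_lin (re a) (- im a) ru ju; have l2 := Lfun2_lin (re a) (im a) ju ru.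
  rewrite E1 E2.
  rewrite !(B_lin 1 1 l1 rv) // !(B_lin 1 1 l2 jv) // !(B_lin _ _ ru ju) // !(B_lin _ _ ju ru) //.
  by apply/eqP; rewrite eq_complex ReD ReM ImD ImM /=; apply/andP; split; apply/eqP; ring.
split.
- by move=> u v w; rewrite -{1}(scale1r u) lin mul1r.
- move=> a u w; rewrite -{1}(addr0 (a *: u)) lin.
  suff -> : vdot 0 w = 0 by rewrite addr0.
  by rewrite -[0 in LHS](addNr w) -scaleN1r lin mulN1r addNr.
- move=> u v; rewrite /vdot !L2dotE; try exact: valL2.
  have BC p q : B p q = B q p by apply: eq_Rintegral => x _; rewrite mulrC.
  rewrite /= opprB (BC (re \o val v)) (BC (im \o val v)) (BC (re \o val v)).
  by rewrite (BC (im \o val v) (re \o val u)).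
- move=> u; rewrite /vdot /L2dot /=; apply: Rintegral_ge0 => x _.
  by rewrite Re_mulJ abs2_ge0.
Qed.

Lemma L2normE (u : V) : L2norm mu (val u) = nrm vdot u.
Proof. by []. Qed.

Let sq (p : T -> R) := \int[mu]_x (p x ^+ 2).

Lemma nrm2_L2 (u : V) : nrm vdot u ^+ 2 = sq (re \o val u) + sq (im \o val u).
Proof.
rewrite (nrm2 L2_semi_inner) /vdot L2dotE /=; [|exact: valL2..].
by congr (_ + _); apply: eq_Rintegral => x _; rewrite expr2.
Qed.

Lemma sq_ge0 (p : T -> R) : 0 <= sq p.
Proof. by apply: Rintegral_ge0 => x _; exact: sqr_ge0. Qed.

Lemma sq_eq0 (p : T -> R) : p \in Lfun mu 2%:E ->
  sq p = 0 <-> {ae mu, forall x, p x = 0}.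
Proof.
move=> lp; have [mp ip] := (Lfun2P mu p).1 lp.
have m2 : measurable_fun setT (EFin \o (fun x => p x ^+ 2)).
  by apply/measurable_EFinP; exact: measurable_funX.
have E : (\int[mu]_x `|(p x ^+ 2)%:E| = (sq p)%:E)%E.
  rewrite /sq /Rintegral fineK; last exact: integrable_fin_num.
  by apply: eq_integral => x _; rewrite gee0_abs // lee_fin sqr_ge0.
have [h1 h2] := ae_eq_integral_abs mu measurableT m2.
split=> [p0|p0].
  have : ae_eq mu setT (EFin \o (fun x => p x ^+ 2)) (cst 0%E) by apply: h1; rewrite E p0.
  by apply: filterS => x /(_ I) /= [] /eqP; rewrite sqrf_eq0 => /eqP.
have : (sq p)%:E = 0%E.
  rewrite -E; apply: h2; apply: filterS p0 => x px _.
  by rewrite /= px expr0n.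
by case.
Qed.

Lemma nrm_eq0_ae (u v : V) : nrm vdot (u - v) = 0 <-> (val u = val v %[ae mu]).
Proof.
have E : nrm vdot (u - v) = 0 <-> sq (re \o val (u - v)) = 0 /\ sq (im \o val (u - v)) = 0.
  have := nrm2_L2 (u - v); have := sq_ge0 (re \o val (u - v)); have := sq_ge0 (im \o val (u - v)).
  move=> h1 h2 h3; split=> [h|[h h']].
    by move: h3; rewrite h expr0n /=; split; lra.
  by apply/eqP; rewrite -sqrf_eq0 h3 h h' addr0.
have [r j] := valL2 (u - v).
rewrite E (sq_eq0 r) (sq_eq0 j).
have vE x : val (u - v) x = val u x - val v x by [].
split=> [[h1 h2]|h].
  apply: filterS2 h1 h2 => x /= h1 h2 _.
  have : val (u - v) x = 0 by apply/eqP; rewrite eq_complex; apply/andP; split; apply/eqP.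
  by rewrite vE => /eqP; rewrite subr_eq0 => /eqP.
have z : \forall x \ae mu, val (u - v) x = 0.
  by apply: filterS h => x /(_ I) hx; rewrite vE hx subrr.
split; apply: filterS z => x zx.
- by change (re (val (u - v) x) = 0); rewrite zx.
- by change (im (val (u - v) x) = 0); rewrite zx.
Qed.

Hypothesis mu_fin : (mu setT < +oo)%E.

Lemma L2_complete (x : nat -> V) : cauchy_nrm vdot x -> exists l, cvg_nrm vdot x l.
Proof.
move=> cx.
have part (p : (T -> R[i]) -> T -> R) :
    (forall u : V, p (val u) \in Lfun mu 2%:E) ->
    (forall u v : V, p (val (u - v)) = (fun t => p (val u) t - p (val v) t)) ->
    (forall u : V, sq (p (val u)) <= nrm vdot u ^+ 2) ->
    exists2 l, l \in Lfun mu 2%:E & forall e : R, 0 < e -> exists N, forall n, (N <= n)%N ->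
     sq (fun t => p (val (x n)) t - l t) <= e.
  move=> lp pB ps; apply: (L2_complete_real mu_fin) => // e e0.
  have [|N h] := cx (Num.sqrt e); first by rewrite sqrtr_gt0.
  exists N => m n Nm mn; rewrite -/(sq _) -pB; apply: (le_trans (ps _)).
  rewrite -(sqr_sqrtr (ltW e0)) ler_pXn2r ?nnegrE ?nrm_ge0 ?sqrtr_ge0 // ltW //.
  exact: h.
have [||| lr lrP lrc] := part (fun f => re \o f).
- by move=> u; have [] := valL2 u.
- by move=> u v; apply/funext => t; rewrite /= ReD ReN.
- by move=> u; rewrite nrm2_L2 lerDl sq_ge0.
have [||| li liP lic] := part (fun f => im \o f).
- by move=> u; have [] := valL2 u.
- by move=> u v; apply/funext => t; rewrite /= ImD ImN.
- by move=> u; rewrite nrm2_L2 lerDr sq_ge0.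
pose l t := lr t +i* li t.
have lP : L2 mu l by split.
exists (toL2 lP) => e e0.
have e2 : 0 < e ^+ 2 / 4 by rewrite divr_gt0 ?exprn_gt0.
have [N1 h1] := lrc _ e2; have [N2 h2] := lic _ e2.
exists (maxn N1 N2) => n nN.
rewrite -(ltr_pXn2r (n := 2)) ?nnegrE ?nrm_ge0 ?(ltW e0) // nrm2_L2.
have := h1 n (leq_trans (leq_maxl _ _) nN); have := h2 n (leq_trans (leq_maxr _ _) nN).
have -> : re \o val (x n - toL2 lP) = (fun t => re (val (x n) t) - lr t).
  by apply/funext => t; rewrite /= ReD ReN.
have -> : im \o val (x n - toL2 lP) = (fun t => im (val (x n) t) - li t).
  by apply/funext => t; rewrite /= ImD ImN.
rewrite /=; lra.
Qed.

(** Transports operators of the vector space of square-integrable functions to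
    operators on all functions, the form in which bounded operators of L^2 are
    described. *)
Definition lift_operator (U : V -> V) (f : T -> R[i]) : T -> R[i] :=
  if pselect (L2 mu f) is left h then val (U (toL2 h)) else f.

Lemma lift_operator_val U (u : V) : lift_operator U (val u) = val (U u).
Proof.
rewrite /lift_operator; case: pselect => [h|]; last by case; exact: valL2.
by congr (val (U _)); exact: val_inj.
Qed.

Lemma L2_ind (P : (T -> R[i]) -> Prop) : (forall u : V, P (val u)) -> forall f, L2 mu f -> P f.
Proof. by move=> h f lf; exact: h (toL2 lf). Qed.

Lemma lift_operator_bounded U : null_linear vdot U -> nrm_bounded vdot U -> bounded_operator mu (lift_operator U).
Proof.
move=> lU [C CU]; split.
- by apply: L2_ind => u; rewrite lift_operator_val; exact: valL2.
- move=> f g lf; move: f lf g; apply: L2_ind => u; apply: L2_ind => v.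
  move=> /nrm_eq0_ae h; rewrite !lift_operator_val; apply/nrm_eq0_ae.
  rewrite (null_eq L2_semi_inner (v := U (u - v))); last first.
    by rewrite nrmC; [exact: null_linearB|exact: L2_semi_inner].
  apply/le_anti; rewrite nrm_ge0 andbT (le_trans (CU _)) // h mulr0 //.
- move=> a f g lf; move: f lf g; apply: L2_ind => u; apply: L2_ind => v.
  by rewrite -(val_lin a u v) !lift_operator_val; apply/(nrm_eq0_ae _ (a *: U u + U v)); exact: lU.
- exists C; apply: L2_ind => u; rewrite lift_operator_val; exact: CU.
Qed.

Variables (I : eqType) (e fam : I -> T -> R[i]) (W : nat -> seq I) (k lam : R).
Hypothesis W_uniq : forall n, uniq (W n).
Hypothesis W_mono : forall m n, (m <= n)%N -> {subset W m <= W n}.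
Hypothesis W_exhaust : forall i, exists n, i \in W n.
Hypothesis k_gt0 : 0 < k.
Hypothesis lam_ge0 : 0 <= lam.
Hypothesis lam_lt1 : lam < 1.
Hypothesis eP : orthonormal_basis mu e.
Hypothesis famP : forall i, L2 mu (fam i).
Hypothesis close : forall (s : seq I) (c : I -> R[i]), uniq s ->
  L2norm mu (fun x => \sum_(i <- s) c i * (fam i x - k%:C * e i x)) <=
  lam * k * L2norm mu (fun x => \sum_(i <- s) c i * e i x).

(** The criterion of Paley and Wiener: fam is k times an orthonormal basis up to
    a relative error lam smaller than 1, in the sense of the norm of all finite
    combinations. *)
Theorem riesz_basis_perturbation : riesz_basis mu fam.
Proof.
have [le oe te] := eP.
split => //; exists e; split => //.
pose b i := toL2 (le i); pose f i := toL2 (famP i).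
have bP i j : vdot (b i) (b j) = (i == j)%:R by exact: oe.
have btot (u : V) (eps : R) : 0 < eps -> exists (s : seq I) (c : I -> R[i]),
    nrm vdot (u - \sum_(i <- s) c i *: b i) < eps.
  move=> e0; have [s [c h]] := te _ (valL2 u) eps e0; exists s, c.
  rewrite -L2normE (_ : val _ = (fun x => val u x - \sum_(i <- s) c i * e i x)) //.
  by apply/funext => x; rewrite -[RHS]/((val u - (fun y => \sum_(i <- s) c i * val (b i) y)) x) -val_sum.
have cl (s : seq I) (c : I -> R[i]) : uniq s ->
  nrm vdot (\sum_(i <- s) c i *: (f i - k%:C *: b i)) <= lam * k * nrm vdot (\sum_(i <- s) c i *: b i).
  by move=> us; have := close c us; rewrite -!L2normE !val_sum.
have [U [lU bU cU Ub]] := partial_synth_limit L2_semi_inner L2_complete bP btot W_uniq W_mono W_exhaust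
  k_gt0 lam_ge0 cl.
have [V' [lV bV VU UV]] := neumann_inverse L2_semi_inner L2_complete k_gt0 lam_ge0 lam_lt1 lU cU.
exists (lift_operator U); split; last first.
  by move=> i; rewrite (lift_operator_val U (b i)) -[fam i]/(val (f i)); apply/nrm_eq0_ae; exact: Ub.
split; first exact: lift_operator_bounded.
exists (lift_operator V'); split; first exact: lift_operator_bounded.
  by apply: L2_ind => u; rewrite !lift_operator_val; apply/nrm_eq0_ae; exact: VU.
by apply: L2_ind => u; rewrite !lift_operator_val; apply/nrm_eq0_ae; exact: UV.
Qed.

End L2Hilbert.

(** * Integration over a bounded interval *)

Section Interval.
Variable R : realType.
Variable T : R.
Hypothesis T_gt0 : 0 < T.
Local Notation leb := (@lebesgue_measure R).
Local Notation mu := (lebesgue_on 0 T).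
Local Notation D := (`]0, T[%classic : set (measurableTypeR R)).
Implicit Types f g F : R -> R.

Lemma lebesgue_onT : mu setT = T%:E.
Proof. by rewrite /= /mrestr setTI lebesgue_measure_itv /= lte_fin T_gt0 oppr0 adde0. Qed.

Lemma lebesgue_on_fin : (mu setT < +oo)%E.
Proof. by rewrite lebesgue_onT ltry. Qed.

Let mD : measurable D. Proof. exact: measurable_itv. Qed.

Lemma lebesgue_on_out : mu (~` D) = 0%E.
Proof. by rewrite /= /mrestr setIC setICr measure0. Qed.

Lemma ae_lebesgue_on (P : R -> Prop) : (forall x, 0 < x < T -> P x) -> \forall x \ae mu, P x.
Proof.
move=> h; exists (~` D); split; [exact: measurableC|exact: lebesgue_on_out|].
by move=> x /= nP xD; apply: nP; apply: h; rewrite in_itv/= in xD.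
Qed.

(** The measure lebesgue_on is carried by the interval, where it coincides with
    Lebesgue measure. *)
Lemma ge0_integral_lebesgue_on (f : R -> \bar R) : measurable_fun setT f -> (forall x, 0 <= f x)%E ->
  (\int[mu]_x f x = \int[leb]_(x in D) f x)%E.
Proof.
move=> mf f0; rewrite (ge0_negligible_integral (measurableC mD)) //; last exact: lebesgue_on_out.
rewrite setDE setCK setTI; apply: eq_measure_integral => A mA AD.
by rewrite /= /mrestr; congr (leb _); apply/setIidl.
Qed.

Lemma integral_lebesgue_on (f : R -> \bar R) : mu.-integrable setT f ->
  (\int[mu]_x f x = \int[leb]_(x in D) f x)%E.
Proof.
move=> fi; rewrite (negligible_integral (measurableC mD)) //; last exact: lebesgue_on_out.
rewrite setDE setCK setTI; apply: eq_measure_integral => A mA AD.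
by rewrite /= /mrestr; congr (leb _); apply/setIidl.
Qed.

Lemma integrable_lebesgue_on (f : R -> \bar R) : mu.-integrable setT f -> leb.-integrable D f.
Proof.
move=> /integrableP[mf fi]; apply/integrableP; split; first exact: measurable_funTS.
rewrite -ge0_integral_lebesgue_on //; first exact: measurableT_comp.
Qed.

End Interval.

Section Bounded.
Context d (X : measurableType d) (R : realType).
Variable mu : {measure set X -> \bar R}.
Hypothesis mu_fin : (mu setT < +oo)%E.

Lemma bounded_integrable (f : X -> R) M : measurable_fun setT f -> (forall x, `|f x| <= M) ->
  mu.-integrable setT (EFin \o f).
Proof.
move=> mf fM.
apply: (@le_integrable _ _ _ _ _ measurableT _ (EFin \o cst M)).
- exact/measurable_EFinP.
- by move=> x _; rewrite /= lee_fin (le_trans (fM x)) // ler_norm.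
- apply/integrableP; split; first by apply/measurable_EFinP; exact: measurable_cst.
  rewrite (eq_integral (cst `|M|%:E)) // integral_cst //.
  by rewrite lte_mul_pinfty // ?lee_fin.
Qed.

Lemma bounded_Lfun2 (f : X -> R) M : measurable_fun setT f -> (forall x, `|f x| <= M) ->
  f \in Lfun mu 2%:E.
Proof.
move=> mf fM; apply/Lfun2P; split => //.
apply: (@bounded_integrable _ (M ^+ 2)); first exact: measurable_funX.
by move=> x; rewrite normrX lerXn2r ?nnegrE // (le_trans _ (fM x)).
Qed.

End Bounded.

Section FTC.
Variable R : realType.
Variable T : R.
Hypothesis T_gt0 : 0 < T.
Local Notation mu := (lebesgue_on 0 T).

Lemma Rintegral_derivative (f F : R -> R) M : continuous f -> (forall x, `|f x| <= M) ->
  (forall x : R, is_derive x 1 F (f x)) -> \int[mu]_x f x = F T - F 0.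
Proof.
move=> cf fM dF.
have mf : measurable_fun setT f by exact: continuous_measurable_fun.
have fi : mu.-integrable setT (EFin \o f).
  by apply: (bounded_integrable (lebesgue_on_fin T_gt0)) => //; exact: fM.
rewrite /Rintegral integral_lebesgue_on // -(@integral_itv_bndoo _ 0 T _ true false); last first.
  by apply/measurable_EFinP; exact: measurable_funTS.
rewrite (@continuous_FTC2 _ f F 0 T T_gt0) //.
- exact: continuous_subspaceT.
- split.
  + by move=> x _; case: (dF x).
  + by apply: cvg_at_right_filter; exact: der_cont (dF 0).
  + by apply: cvg_at_left_filter; exact: der_cont (dF T).
- by move=> x _; rewrite derive1E; case: (dF x).
Qed.

End FTC.

(** * The trigonometric system *)

Section Expi.
Variable R : realType.
Implicit Types x y : R.

Lemma expiD x y : expi (x + y) = expi x * expi y.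
Proof. by rewrite /expi cosD sinD; apply/eqP; rewrite eq_complex ReM ImM /=; apply/andP; split; apply/eqP; ring. Qed.

Lemma expi0 : expi (0 : R) = 1.
Proof. by rewrite /expi cos0 sin0. Qed.

Lemma expiN x : expi (- x) = ((expi x)^*)%R.
Proof. by rewrite /expi cosN sinN. Qed.

Lemma conjcM (a b : R[i]) : ((a * b)^* = a^* * b^*)%R.
Proof. exact: rmorphM. Qed.

Lemma expi_2pi (n : int) : expi (2 * pi * n%:~R : R) = 1.
Proof.
have h (k : nat) : expi (2 * pi * k%:R : R) = 1.
  elim: k => [|k IH]; first by rewrite mulr0 expi0.
  by rewrite -[k.+1]addn1 natrD mulrDr expiD IH mul1r mulr1 mulr_natl /expi cos2pi sin2pi.
case: n => n; first exact: h.
by rewrite NegzE mulrNz mulrN expiN h; apply/eqP; rewrite eq_complex /= oppr0 !eqxx.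
Qed.

Lemma expi_period x (n : int) : expi (x + 2 * pi * n%:~R) = expi x.
Proof. by rewrite expiD expi_2pi mulr1. Qed.

Lemma continuous_expi (f : R -> R) : continuous f ->
  continuous (fun x => cos (f x)) /\ continuous (fun x => sin (f x)).
Proof.
move=> cf; split=> x.
  by apply: (@continuous_comp _ _ _ f (@cos R)); [exact: cf|exact: continuous_cos].
by apply: (@continuous_comp _ _ _ f (@sin R)); [exact: cf|exact: continuous_sin].
Qed.

End Expi.

Section L2Closure.
Context d (X : measurableType d) (R : realType).
Variable mu : {measure set X -> \bar R}.
Implicit Types f g : X -> R[i].

Lemma L2Z (a : R[i]) f : L2 mu f -> L2 mu (fun t => a * f t).
Proof.
move=> lf; have [h0 h] := L2_submod_closed mu.
have /L2predP := h a f 0 (introT (L2predP mu f) lf) h0.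
by rewrite addr0.
Qed.

Lemma L2D f g : L2 mu f -> L2 mu g -> L2 mu (fun x => f x + g x).
Proof.
move=> lf lg; have [_ h] := L2_submod_closed mu.
have /L2predP := h 1 f g (introT (L2predP mu f) lf) (introT (L2predP mu g) lg).
by rewrite scale1r.
Qed.

Lemma L2_sum (J : Type) (s : seq J) (f : J -> X -> R[i]) : (forall j, L2 mu (f j)) ->
  L2 mu (fun x => \sum_(j <- s) f j x).
Proof.
move=> lf; elim: s => [|j s IH].
  rewrite (_ : (fun x => _) = 0); last by apply/funext => x; rewrite big_nil.
  by have [/L2predP] := L2_submod_closed mu.
rewrite (_ : (fun x => _) = (fun x => f j x + \sum_(j <- s) f j x)); first exact: L2D.
by apply/funext => x; rewrite big_cons.
Qed.

End L2Closure.

Section Trig.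
Variable R : realType.
Variable T : R.
Hypothesis T_gt0 : 0 < T.
Local Notation mu := (lebesgue_on 0 T).
Variable th : int -> R.

Definition freq (n : int) t : R := 2 * pi * n%:~R * t / T + th n.
(** The phases th n multiply the Fourier basis by unimodular constants; they are
    chosen below so that the given exponentials are close to a multiple of this
    basis. *)
Definition trig (n : int) t : R[i] := (Num.sqrt T)^-1%:C * expi (freq n t).

Lemma continuous_affine (a b : R) : continuous (fun x : R => a * x + b).
Proof.
move=> x; have h : is_derive x 1 (fun x : R => a * x + b) (0 * x + a * 1 + 0) by derive.
exact: der_cont h.
Qed.

Lemma continuous_freq n : continuous (freq n).
Proof.
rewrite (_ : freq n = fun t : R => 2 * pi * n%:~R / T * t + th n); first exact: continuous_affine.
by apply/funext => t; rewrite /freq mulrAC.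
Qed.

Lemma L2_expi (f : R -> R) : continuous f -> L2 mu (fun t => expi (f t)).
Proof.
move=> cf; have [h1 h2] := continuous_expi cf.
split; apply: (@bounded_Lfun2 _ _ _ _ (lebesgue_on_fin T_gt0) _ 1).
- exact: continuous_measurable_fun.
- by move=> x; exact: cos_max.
- exact: continuous_measurable_fun.
- by move=> x; exact: sin_max.
Qed.

Lemma L2_trig n : L2 mu (trig n).
Proof. by apply: L2Z; apply: L2_expi; exact: continuous_freq. Qed.

(** A primitive of the integrand is periodic of period T. *)
Lemma integral_oscillation (n : int) (d : R) : n != 0 ->
  \int[mu]_t cos (2 * pi * n%:~R * t / T + d) = 0 /\
  \int[mu]_t sin (2 * pi * n%:~R * t / T + d) = 0.
Proof.
move=> n0; set a := 2 * pi * n%:~R / T.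
have a0 : a != 0.
  by rewrite /a !mulf_neq0 ?intr_eq0 ?invr_eq0 ?pnatr_eq0 // gt_eqF ?pi_gt0.
have E t : 2 * pi * n%:~R * t / T + d = a * t + d by rewrite /a mulrAC.
have [cc cs] := continuous_expi (@continuous_affine a d).
have aT : expi (a * T + d) = expi (a * 0 + d).
  by rewrite mulr0 add0r addrC /a mulfVK ?expi_period // gt_eqF.
case: aT => aTc aTs.
split; under eq_Rintegral => t _ do rewrite E.
- notypeclasses refine (etrans (@Rintegral_derivative R T T_gt0 _
    (fun t => a^-1 * sin (a * t + d)) 1 cc (fun x => cos_max _) _) _).
    by move=> x; derive; field.
  by rewrite aTs subrr.
- notypeclasses refine (etrans (@Rintegral_derivative R T T_gt0 _
    (fun t => - (a^-1 * cos (a * t + d))) 1 cs (fun x => sin_max _) _) _).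
    by move=> x; derive; field.
  by rewrite aTc subrr.
Qed.

Lemma trig_orthonormal n m : L2dot mu (trig n) (trig m) = (n == m)%:R.
Proof.
pose r : R := (Num.sqrt T)^-1 ^+ 2.
have r2 : r = T^-1 by rewrite /r exprVn sqr_sqrtr // ltW.
have E t : trig n t * ((trig m t)^*)%R = r%:C * expi (2 * pi * (n - m)%:~R * t / T + (th n - th m)).
  rewrite /trig conjcM -expiN mulrACA -expiD; congr (_ * expi _).
    by apply/eqP; rewrite eq_complex /= !oppr0 !(mulr0,mul0r,subr0,addr0) /r expr2 !eqxx.
  by rewrite /freq rmorphB /=; ring.
rewrite /L2dot.
under eq_Rintegral => t _ do rewrite E ReM /= mul0r subr0.
under [X in _ +i* X]eq_Rintegral => t _ do rewrite E ImM /= mul0r addr0.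
have [->|nm] := eqVneq n m.
  rewrite !subrr.
  under eq_Rintegral => t _ do rewrite mulr0 !mul0r addr0 cos0 mulr1.
  under [X in _ +i* X]eq_Rintegral => t _ do rewrite mulr0 !mul0r addr0 sin0 mulr0.
  rewrite !Rintegral_cst // lebesgue_onT //= r2 mul0r mulVf ?gt_eqF //.
have nm0 : n - m != 0 by rewrite subr_eq0.
have [I1 I2] := integral_oscillation (th n - th m) nm0.
have bi (f : R -> R) : measurable_fun setT f -> (forall x, `|f x| <= 1) ->
    mu.-integrable setT (EFin \o f).
  by move=> mf f1; apply: (bounded_integrable (lebesgue_on_fin T_gt0)) => //; exact: f1.
have [cc cs] : continuous (fun t : R => cos (2 * pi * (n - m)%:~R * t / T + (th n - th m))) /\
   continuous (fun t : R => sin (2 * pi * (n - m)%:~R * t / T + (th n - th m))).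
  apply: continuous_expi; under eq_fun do rewrite mulrAC; exact: continuous_affine.
rewrite !RintegralZl ?I1 ?I2 ?mulr0 //.
- by apply: bi; [exact: continuous_measurable_fun|move=> x; exact: sin_max].
- by apply: bi; [exact: continuous_measurable_fun|move=> x; exact: cos_max].
Qed.

End Trig.

(** * Fejer means from equispaced samples *)

Section Span.
Variables (R : realType) (X : Type) (I : eqType) (e : I -> X -> R[i]).

(** Finite combinations with repeated indices allowed, so that sums and
    multiples need no bookkeeping; in_span_comb collects the coefficients
    afterwards. *)
Definition in_span (f : X -> R[i]) :=
  exists l : seq (I * R[i]), forall x, f x = \sum_(p <- l) p.2 * e p.1 x.

Lemma in_spanD f g : in_span f -> in_span g -> in_span (fun x => f x + g x).
Proof. by move=> [l lE] [m mE]; exists (l ++ m) => x; rewrite big_cat lE mE. Qed.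

Lemma in_spanZ a f : in_span f -> in_span (fun x => a * f x).
Proof.
move=> [l lE]; exists [seq (p.1, a * p.2) | p <- l] => x.
by rewrite big_map lE mulr_sumr; apply: eq_bigr => p _ /=; rewrite mulrA.
Qed.

Lemma in_span_sum (J : Type) (s : seq J) (f : J -> X -> R[i]) :
  (forall j, in_span (f j)) -> in_span (fun x => \sum_(j <- s) f j x).
Proof.
move=> h; elim: s => [|j s IH]; first by exists [::] => x; rewrite !big_nil.
rewrite (_ : (fun x => _) = (fun x => f j x + \sum_(j <- s) f j x)); first exact: in_spanD.
by apply/funext => x; rewrite big_cons.
Qed.

Lemma in_span_scaled a i : in_span (fun x => a * e i x).
Proof. by exists [:: (i, a)] => x; rewrite big_seq1. Qed.

Lemma in_span_comb f : in_span f ->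
  exists (s : seq I) (c : I -> R[i]), forall x, f x = \sum_(i <- s) c i * e i x.
Proof.
move=> [l lE]; exists (undup (map fst l)), (fun i => \sum_(p <- l | p.1 == i) p.2) => x.
rewrite lE.
transitivity (\sum_(p <- l) \sum_(i <- undup (map fst l) | i == p.1) p.2 * e i x).
  apply: eq_big_seq => p pl.
  rewrite -big_filter (@filter_pred1_uniq _ _ p.1) ?undup_uniq ?big_seq1 //.
  by rewrite mem_undup map_f.
rewrite (exchange_big_dep xpredT) //=; apply: eq_bigr => i _.
by rewrite mulr_suml; apply: eq_bigl => p; rewrite eq_sym.
Qed.

End Span.

Section Fejer.
Variable R : realType.
Implicit Types x y u : R.

Lemma expi_eq1 u : 0 < `|u| -> `|u| < 2 * pi -> expi u != 1.
Proof.
wlog u0 : u / 0 < u.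
  move=> h u0 u1; have [up|un|u00] := ltgtP 0 u; first exact: h.
    have := h (- u); rewrite normrN oppr_gt0 expiN => /(_ un u0 u1); apply: contra => /eqP ->.
    by rewrite rmorph1.
  by rewrite -u00 normr0 ltxx in u0.
rewrite gtr0_norm // => _ u1; rewrite eq_complex negb_and /=; apply/orP; left.
have s0 : 0 < sin (u / 2) by apply: sin_gt0_pi; lra.
have -> : u = u / 2 + u / 2 by lra.
rewrite cosD lt_eqF //.
by have := cos2Dsin2 (u / 2); nra.
Qed.

Lemma expiX u (k : nat) : expi (k%:R * u) = expi u ^+ k.
Proof.
elim: k => [|k IH]; first by rewrite mul0r expi0.
by rewrite exprS -IH -expiD -natr1; congr expi; ring.
Qed.

(** The powers of a nontrivial N-th root of unity sum to 0. *)
Lemma sum_samples (N : nat) (k : int) y : (0 < N)%N -> (`|k| < N)%N ->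
  \sum_(j < N) expi (k%:~R * (y - 2 * pi * j%:R / N%:R)) = if k == 0 then N%:R else 0.
Proof.
move=> N0 kN.
have Nr : (N%:R : R) != 0 by rewrite pnatr_eq0 -lt0n.
have [->|k0] := eqVneq k 0.
  under eq_bigr => j _ do rewrite mul0r expi0.
  by rewrite sumr_const card_ord.
pose q : R[i] := expi (- (2 * pi * k%:~R / N%:R)).
under eq_bigr => j _.
  rewrite (_ : _ * _ = k%:~R * y + j%:R * - (2 * pi * k%:~R / N%:R)); last by field.
  rewrite expiD expiX -/q; over.
rewrite -mulr_sumr.
have qN : q ^+ N = 1.
  rewrite /q -expiX (_ : _ * _ = 2 * pi * (- k)%:~R) ?expi_2pi // rmorphN /=; field => //.
have q1 : q != 1.
  apply: expi_eq1; rewrite normrN.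
    by rewrite normr_gt0 !mulf_neq0 ?invr_eq0 ?intr_eq0 // gt_eqF // pi_gt0.
  rewrite normrM normfV (ger0_norm (ler0n _ N)) ltr_pdivrMr ?ltr0n // normrM.
  rewrite ger0_norm ?mulr_ge0 ?pi_ge0 // ltr_pM2l ?mulr_gt0 ?pi_gt0 //.
  by rewrite -intr_norm -abszE ltr_nat.
suff -> : \sum_(j < N) q ^+ j = 0 by rewrite mulr0.
have := subrX1 q N; rewrite qN subrr => /esym/eqP.
by rewrite mulf_eq0 subr_eq0 (negbTE q1) /= => /eqP.
Qed.

(** The Fejer kernel with p + 1 frequencies, written as a square to make it
    nonnegative. *)
Definition fejer (p : nat) u : R := abs2 (\sum_(m < p.+1) expi (m%:R * u)) / p.+1%:R.

Lemma fejer_ge0 p u : 0 <= fejer p u.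
Proof. by rewrite divr_ge0 // abs2_ge0. Qed.

Lemma fejerE p u : (fejer p u)%:C =
  p.+1%:R^-1%:C * \sum_(m < p.+1) \sum_(m' < p.+1) expi ((m%:Z - m'%:Z)%:~R * u).
Proof.
have abs2C (a : R[i]) : (abs2 a)%:C = (a * a^*)%R.
  by apply/eqP; rewrite eq_complex Re_mulJ ImM ReJ ImJ /=; apply/andP; split; apply/eqP; ring.
rewrite /fejer mulrC rmorphM /= abs2C; congr (_ * _).
rewrite rmorph_sum big_distrlr /=; apply: eq_bigr => m _; apply: eq_bigr => m' _.
by rewrite -expiN -expiD rmorphB /=; congr expi; rewrite mulrBl.
Qed.

(** With p + 2 samples none of the frequencies that occur is a nonzero multiple
    of p + 2, so the discrete sum extracts the Fourier coefficients: the
    coefficient of order k of the kernel is (p + 1 - k) / (p + 1). *)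
Lemma sum_fejer p (k : nat) y : (k <= 1)%N ->
  \sum_(j < p.+2) expi (k%:R * (y - 2 * pi * j%:R / p.+2%:R)) *
     (fejer p (y - 2 * pi * j%:R / p.+2%:R))%:C =
  (p.+2%:R * (p.+1 - k)%:R / p.+1%:R)%:C.
Proof.
move=> k1.
under eq_bigr => j _.
  rewrite fejerE mulrCA mulr_sumr.
  under eq_bigr => m _.
    rewrite mulr_sumr.
    under eq_bigr => m' _.
      rewrite -expiD -mulrDl -[k%:R]/((k%:Z)%:~R) -intrD; over.
    over.
  over.
rewrite -mulr_sumr exchange_big /=.
under eq_bigr => m _.
  rewrite exchange_big /=.
  under eq_bigr => m' _.
    rewrite sum_samples //; last by have := ltn_ord m; have := ltn_ord m'; lia.
    over.
  over.
have E (m : 'I_p.+1) : \sum_(i < p.+1) (if k%:Z + (m%:Z - i%:Z) == 0 then p.+2%:R else 0) =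
    (if (m < p.+1 - k)%N then p.+2%:R else 0) :> R[i].
  rewrite -big_mkcond /= (eq_bigl (fun i : 'I_p.+1 => (i : nat) == (m + k)%N)); last by move=> i; lia.
  rewrite (big_ord1_eq _ (fun=> p.+2%:R)); congr (if _ then _ else _); lia.
under eq_bigr => m _ do rewrite E.
rewrite -big_mkcond /=.
have -> : \sum_(m < p.+1 | (m < p.+1 - k)%N) (p.+2%:R : R[i]) = \sum_(m < p.+1 - k) p.+2%:R.
  by rewrite (big_ord_widen _ (fun=> p.+2%:R) (leq_subr k p.+1)).
rewrite sumr_const card_ord -mulr_natr !rmorphM /= !rmorph_nat mulrC; congr (_ * _).
by rewrite mulr_natr.
Qed.

Lemma fejer_mass p y : \sum_(j < p.+2) fejer p (y - 2 * pi * j%:R / p.+2%:R) = p.+2%:R.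
Proof.
have := congr1 (@complex.Re R) (@sum_fejer p 0 y isT).
rewrite subn0 mulfK ?pnatr_eq0 //= => h; rewrite -[RHS]h Re_sum; apply: eq_bigr => j _.
by rewrite mul0r expi0 mul1r.
Qed.

(** The kernel has mean 1 and first cosine moment p / (p + 1): its mass
    concentrates where the cosine is close to 1. *)
Lemma fejer_moment p y : \sum_(j < p.+2) (1 - cos (y - 2 * pi * j%:R / p.+2%:R)) *
  fejer p (y - 2 * pi * j%:R / p.+2%:R) = p.+2%:R / p.+1%:R.
Proof.
have := congr1 (@complex.Re R) (@sum_fejer p 1 y isT); rewrite Re_sum /=.
under eq_bigr => j _ do rewrite mulr0 subr0 mul1r.
move=> h; under eq_bigr => j _ do rewrite mulrBl mul1r.
by rewrite sumrB fejer_mass h subn1 /= (_ : p%:R = p.+1%:R - 1); [field|rewrite -natr1 addrK].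
Qed.

End Fejer.

Section FejerMean.
Variable R : realType.
Variable T : R.
Hypothesis T_gt0 : 0 < T.
Variable th : int -> R.
Local Notation mu := (lebesgue_on 0 T).
Implicit Types g : R -> R.

(** Fejer sum of g computed from p + 2 equispaced samples; using samples instead
    of integrals makes it a finite combination by definition. *)
Definition fejer_mean g (p : nat) x : R := p.+2%:R^-1 *
  \sum_(j < p.+2) g (j%:R * T / p.+2%:R) * fejer p (2 * pi * x / T - 2 * pi * j%:R / p.+2%:R).

Lemma in_span_fejer_mean g p : in_span (trig T th) (fun x => (fejer_mean g p x)%:C).
Proof.
rewrite (_ : (fun x => _) = (fun x => p.+2%:R^-1%:C * \sum_(j < p.+2)
   (g (j%:R * T / p.+2%:R))%:C * (p.+1%:R^-1%:C * \sum_(m < p.+1) \sum_(m' < p.+1)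
     (expi ((m%:Z - m'%:Z)%:~R * - (2 * pi * j%:R / p.+2%:R) - th (m%:Z - m'%:Z)) * (Num.sqrt T)%:C)
        * trig T th (m%:Z - m'%:Z) x))).
  apply: in_spanZ; apply: in_span_sum => j; apply: in_spanZ; apply: in_spanZ.
  apply: in_span_sum => m; apply: in_span_sum => m'; exact: in_span_scaled.
apply/funext => x; rewrite /fejer_mean rmorphM rmorph_sum; congr (_ * _).
apply: eq_bigr => j _; rewrite rmorphM /= fejerE; congr (_ * (_ * _)).
apply: eq_bigr => m _; apply: eq_bigr => m' _.
have sT : ((Num.sqrt T)%:C * (Num.sqrt T)^-1%:C = 1)%R.
  by rewrite -rmorphM /= divff // sqrtr_eq0 -ltNge.
rewrite /trig mulrA -(mulrA (expi _)) sT mulr1 -expiD; congr expi.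
by rewrite /freq; ring.
Qed.

(** The argument of Korovkin: the hypothesis is tested against the kernel, whose
    mass and moment are known. *)
Lemma fejer_mean_close g p x (e C : R) :
  (forall z : R, 0 <= z -> z < T -> `|g z - g x| <= e + C * (1 - cos (2 * pi * (x - z) / T))) ->
  `|fejer_mean g p x - g x| <= e + C / p.+1%:R.
Proof.
move=> h; rewrite /fejer_mean.
set N : R := p.+2%:R; set y := 2 * pi * x / T.
pose z (j : 'I_p.+2) := j%:R * T / N; pose u (j : 'I_p.+2) := y - 2 * pi * j%:R / N.
have N0 : 0 < N by rewrite ltr0n.
have F1 : \sum_j fejer p (u j) = N by exact: fejer_mass.
have F2 : \sum_j (1 - cos (u j)) * fejer p (u j) = N / p.+1%:R by exact: fejer_moment.
have N1 : N != 0 by rewrite gt_eqF.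
rewrite -[g x](mulKf N1) -mulrBr -[X in X * g x]F1 mulr_suml -sumrB normrM gtr0_norm ?invr_gt0 //.
rewrite mulrC ler_pdivrMr //.
have -> : (e + C / p.+1%:R) * N = \sum_j (e + C * (1 - cos (u j))) * fejer p (u j).
  under eq_bigr => j _ do rewrite mulrDl -mulrA.
  by rewrite big_split /= -!mulr_sumr F1 F2 mulrDl mulrAC mulrA.
apply: (le_trans (ler_norm_sum _ _ _)); apply: ler_sum => j _.
rewrite -/(z j) -/(u j) [fejer _ _ * g x]mulrC -mulrBl normrM (ger0_norm (fejer_ge0 _ _)).
rewrite ler_wpM2r ?fejer_ge0 // (_ : u j = 2 * pi * (x - z j) / T).
  apply: h; first by rewrite !mulr_ge0 ?invr_ge0 ?ler0n ?ltW.
  by rewrite /z ltr_pdivrMr // mulrC ltr_pM2l // ltr_nat.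
by rewrite /u /y /z; field; rewrite !gt_eqF.
Qed.

End FejerMean.

(** * Density in L^2 of the interval *)

Section Density.
Variable R : realType.
Variable T : R.
Hypothesis T_gt0 : 0 < T.
Local Notation mu := (lebesgue_on 0 T).
Implicit Types f g : R -> R.

Lemma fejer_mean_bound g p x (M : R) : (forall y, `|g y| <= M) -> `|fejer_mean T g p x| <= M.
Proof.
move=> gM; rewrite /fejer_mean normrM gtr0_norm ?invr_gt0 ?ltr0n // mulrC ler_pdivrMr ?ltr0n //.
rewrite -[X in _ <= _ * X](fejer_mass p (2 * pi * x / T)) mulr_sumr.
apply: (le_trans (ler_norm_sum _ _ _)); apply: ler_sum => j _.
by rewrite normrM (ger0_norm (fejer_ge0 _ _)) ler_wpM2r ?fejer_ge0.
Qed.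

(** For fixed x inside the interval, the points z of [0, T) at distance at least
    d from x satisfy |x - z| <= T - b with b > 0, so that 1 - cos (2 pi (x - z)
    / T) is bounded below and absorbs the oscillation of g. *)
Lemma fejer_mean_cvg g x (M : R) : {for x, continuous g} -> (forall y, `|g y| <= M) ->
  0 < x < T -> fejer_mean T g p x @[p --> \oo] --> g x.
Proof.
move=> cg gM /andP[x0 xT].
apply/cvgrPdist_le => e e0.
have e2 : 0 < e / 2 by lra.
move: cg => /cvgrPdist_le/(_ _ e2)/nbhs_ballP[d /= d0 dP].
pose b := Num.min d (Num.min x (T - x)).
have b0 : 0 < b by rewrite !lt_min d0 x0 subr_gt0.
have bx : b <= x by rewrite !ge_min lexx orbT.
have bT : b <= T - x by rewrite !ge_min lexx !orbT.
have bd : b <= d by rewrite ge_min lexx.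
have Tn : T != 0 by rewrite gt_eqF.
pose a := pi * b / T.
have pi0 := pi_gt0 R.
have a0 : 0 < a by rewrite !mulr_gt0 ?invr_gt0.
have aE : a * T = pi * b by rewrite /a mulfVK.
have sa : 0 < sin a by apply: sin_gt0_pi => //; rewrite -(ltr_pM2r T_gt0) aE; nra.
have M0 : 0 <= M := le_trans (normr_ge0 _) (gM x).
pose C := M / sin a ^+ 2.
have C0 : 0 <= C by rewrite divr_ge0 // sqr_ge0.
have key (z : R) : 0 <= z -> z < T -> `|g z - g x| <= e / 2 + C * (1 - cos (2 * pi * (x - z) / T)).
  move=> z0 zT.
  have c1 := cos_le1 (2 * pi * (x - z) / T).
  have [zd|zd] := ltP `|x - z| d.
    have := dP z zd; rewrite distrC => h.
    have : 0 <= C * (1 - cos (2 * pi * (x - z) / T)) by rewrite mulr_ge0 // subr_ge0.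
    by move: h => /=; lra.
  pose w := pi * `|x - z| / T.
  have wE : w * T = pi * `|x - z| by rewrite /w mulfVK.
  have xz : `|x - z| <= T - b by rewrite ler_norml; apply/andP; split; lra.
  have sw : sin a <= sin w.
    apply: sin_le_between; first exact: ltW.
      by rewrite -(ler_pM2r T_gt0) aE wE; nra.
    by rewrite -(ler_pM2r T_gt0) wE mulrBl aE; nra.
  have -> : cos (2 * pi * (x - z) / T) = 1 - 2 * sin w ^+ 2.
    have -> : cos (2 * pi * (x - z) / T) = cos (w + w).
      rewrite /w; have [h|h] := ger0P (x - z); first by congr cos; ring.
      by rewrite -cosN; congr cos; ring.
    by rewrite cosD -!expr2 -[cos w ^+ 2](addrK (sin w ^+ 2)) cos2Dsin2; ring.
  have CE : C * sin a ^+ 2 = M by rewrite /C divfK // expf_eq0 gt_eqF.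
  have s2 : sin a ^+ 2 <= sin w ^+ 2 by nra.
  have : `|g z - g x| <= M + M by apply: (le_trans (ler_normB _ _)); rewrite lerD.
  have : C * sin a ^+ 2 <= C * sin w ^+ 2 by rewrite ler_wpM2l.
  rewrite CE; lra.
have : C / p.+1%:R @[p --> \oo] --> C * 0.
  by apply: cvgM; [exact: cvg_cst|exact: cvg_harmonic].
rewrite mulr0 => /cvgrPdist_le/(_ _ e2); apply: filterS => p.
rewrite sub0r normrN distrC => h.
apply: (le_trans (fejer_mean_close T_gt0 p key)).
by rewrite [leRHS]splitr lerD2l (le_trans (ler_norm _)).
Qed.

(** Dominated convergence to 0, read as an existence statement. *)
Lemma exists_small (f_ : nat -> R -> R) (G : R -> R) : (forall n, measurable_fun setT (f_ n)) ->
  (forall n x, 0 <= f_ n x <= G x) -> mu.-integrable setT (EFin \o G) ->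
  (forall x, 0 < x < T -> f_ n x @[n --> \oo] --> (0 : R)) ->
  forall e : R, 0 < e -> exists n, \int[mu]_x f_ n x < e.
Proof.
move=> mf fG iG f0 e e0.
have [||||_ _] := @dominated_convergence _ _ _ mu setT measurableT (fun n => EFin \o f_ n) (cst 0%E)
    (EFin \o G) _ _ _ iG.
- move=> n; apply/measurable_EFinP; exact: mf.
- exact: measurable_cst.
- apply: ae_lebesgue_on => // x x0 _; apply: cvg_EFin; first exact: nearW.
  exact: f0.
- by apply: nearW => x n _; rewrite lee_fin ger0_norm; case/andP: (fG n x).
rewrite integral0 => /fine_cvgP[_] /cvgrPdist_lt/(_ e e0)[n _ /(_ n (leqnn n))] /=.
rewrite sub0r normrN => h; exists n; apply: le_lt_trans h; exact: ler_norm.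
Qed.

Definition clip (M y : R) : R := Num.max (- M) (Num.min M y).

Lemma clip_bound M y : 0 <= M -> `|clip M y| <= M.
Proof. by move=> M0; rewrite /clip ler_norml le_max lexx ge_max ge_min lexx andbT; lra. Qed.

Lemma clip_id M y : `|y| <= M -> clip M y = y.
Proof. by rewrite ler_norml => /andP[h1 h2]; rewrite /clip min_r // max_r. Qed.

Lemma clip_lip M y z : `|clip M y - clip M z| <= `|y - z|.
Proof.
rewrite /clip /Num.min /Num.max; move: (ler_norm (y - z)) (ler_norm (z - y)); rewrite [`|z - y|]distrC => h1 h2.
by do ![case: ifPn; rewrite -?leNgt]; move=> *; rewrite ler_norml; apply/andP; split; lra.
Qed.

Lemma clip_sub M y : 0 <= M -> `|y - clip M y| <= `|y|.
Proof.
rewrite /clip /Num.min /Num.max; move: (ler_norm y) (ler_norm (- y)); rewrite normrN => h1 h2 M0.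
by do ![case: ifPn; rewrite -?leNgt]; move=> *; rewrite ler_norml; apply/andP; split; lra.
Qed.

Lemma continuous_clip M g : continuous g -> continuous (fun x => clip M (g x)).
Proof.
move=> cg x; apply/cvgrPdist_le => e e0.
have /cvgrPdist_le/(_ e e0) := cg x; apply: filterS => y; exact: le_trans (clip_lip _ _ _).
Qed.

Lemma measurable_clip M g : measurable_fun setT g -> measurable_fun setT (fun x => clip M (g x)).
Proof.
by move=> mg; apply: measurable_maxr; [exact: measurable_cst|apply: measurable_minr => //; exact: measurable_cst].
Qed.

Local Notation sqn f := (\int[mu]_x (f x ^+ 2)).

Lemma measurable_fejer_mean g p : measurable_fun setT (fejer_mean T g p).
Proof.
apply: measurable_funM => //; apply: measurable_sum => j; apply: measurable_funM => //.
rewrite /fejer /abs2; apply: measurable_funM => //.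
have mt (m : nat) : continuous (fun x : R => m%:R * (2 * pi * x / T - 2 * pi * j%:R / p.+2%:R)).
  under eq_fun do rewrite mulrBr [2 * pi * _ / _]mulrAC mulrA; exact: continuous_affine.
apply: measurable_funD; apply: measurable_funX.
- under eq_fun do rewrite Re_sum; apply: measurable_sum => m.
  by apply: continuous_measurable_fun; exact: (continuous_expi (mt m)).1.
- under eq_fun do rewrite Im_sum; apply: measurable_sum => m.
  by apply: continuous_measurable_fun; exact: (continuous_expi (mt m)).2.
Qed.

Lemma approx_clip f (e : R) : f \in Lfun mu 2%:E -> 0 < e ->
  exists2 M : R, 0 < M & sqn (fun x => f x - clip M (f x)) < e.
Proof.
move=> lf e0; have [mf fi] := (Lfun2P mu f).1 lf.
have [|n x|x _|n nP] := @exists_small (fun n x => (f x - clip n.+1%:R (f x)) ^+ 2) _ _ _ fi _ e e0.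
- by move=> n; apply: measurable_funX; apply: measurable_funB => //; exact: measurable_clip.
- by rewrite sqr_ge0 -[leLHS]real_normK ?num_real // -[leRHS]real_normK ?num_real // lerXn2r ?nnegrE ?clip_sub.
- apply: cvg_near_cst; exists (Num.truncn `|f x|) => // n /= xn.
  rewrite clip_id ?subrr ?expr0n //.
  by rewrite (le_trans (ltW (truncnS_gt _))) // ler_nat ltnS.
by exists n.+1%:R.
Qed.

(** Approximation in L^1 by a continuous function suffices: after truncating it
    at M the squared error is at most 2 M times the error. *)
Lemma approx_continuous f (M e : R) : 0 < M -> measurable_fun setT f -> (forall x, `|f x| <= M) -> 0 < e ->
  exists g : R -> R, [/\ continuous g, forall x, `|g x| <= M & sqn (fun x => f x - g x) < e].
Proof.
move=> M0 mf fM e0.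
have fi : mu.-integrable setT (EFin \o f).
  by apply: (bounded_integrable (lebesgue_on_fin T_gt0)) => //; exact: fM.
have DT : (@lebesgue_measure R `]0%R, T[%classic < +oo)%E.
  by rewrite lebesgue_measure_itv /= lte_fin T_gt0 ltry.
have [g_ [cg gi gf]] := approximation_continuous_integrable (measurable_itv _) DT
  (integrable_lebesgue_on fi).
have e1 : 0 < e / (2 * M) by rewrite divr_gt0 // mulr_gt0.
move: gf => /fine_cvgP[_] /cvgrPdist_lt/(_ _ e1)[n _ /(_ n (leqnn n))] /=.
rewrite sub0r normrN => h.
have mg : measurable_fun setT (g_ n) by exact: continuous_measurable_fun.
have mc : measurable_fun setT (fun x => clip M (g_ n x)) by exact: measurable_clip.
have ma : measurable_fun setT (EFin \o (fun x => `|f x - g_ n x|)).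
  by apply/measurable_EFinP; apply: measurableT_comp => //; exact: measurable_funB.
have E : (\int[mu]_x `|f x - g_ n x|%:E)%E = (\int[lebesgue_measure]_(x in `]0%R, T[) `|f x - g_ n x|%:E)%E.
  by apply: ge0_integral_lebesgue_on => // x; rewrite lee_fin.
have E' : (\int[mu]_x `|f x - g_ n x|%:E < +oo)%E.
  have fD := integrable_lebesgue_on fi.
  rewrite E; have /integrableP[_] : (@lebesgue_measure R).-integrable `]0%R, T[%classic
      ((EFin \o f) \- (EFin \o g_ n))%E by apply: integrableB.
  by [].
have i1 : mu.-integrable setT (EFin \o (fun x => `|f x - g_ n x|)).
  by apply/integrableP; split => //; under eq_integral => x _ do rewrite /= normr_id.
exists (fun x => clip M (g_ n x)); split.
- exact: continuous_clip.
- by move=> x; exact: clip_bound (ltW M0).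
apply: (@le_lt_trans _ _ (\int[mu]_x (2 * M * `|f x - g_ n x|))).
  apply: le_Rintegral => //.
  + apply: (@bounded_integrable _ _ _ _ (lebesgue_on_fin T_gt0) _ ((M + M) ^+ 2)).
      by apply: measurable_funX; exact: measurable_funB.
    move=> x; rewrite normrX lerXn2r ?nnegrE ?addr_ge0 ?(ltW M0) //.
    by rewrite (le_trans (ler_normB _ _)) // lerD // clip_bound // ltW.
  + exact: integrable_scale.
  + move=> x _; rewrite -[leLHS]real_normK ?num_real // expr2 ler_pM //.
      by rewrite (le_trans (ler_normB _ _)) // mulr2n mulrDl mul1r lerD // clip_bound // ltW.
    by rewrite -{1}(clip_id (fM x)) clip_lip.
rewrite RintegralZl //.
rewrite -ltr_pdivlMl ?mulr_gt0 // mulrC; apply: le_lt_trans h; rewrite /Rintegral E.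
exact: ler_norm.
Qed.

Lemma approx_fejer g (M e : R) : continuous g -> (forall x, `|g x| <= M) -> 0 < e ->
  exists p, sqn (fun x => g x - fejer_mean T g p x) < e.
Proof.
move=> cg gM e0.
have mg : measurable_fun setT g by exact: continuous_measurable_fun.
apply: (@exists_small (fun p x => (g x - fejer_mean T g p x) ^+ 2) (fun=> (M + M) ^+ 2)) => //.
- by move=> n; apply: measurable_funX; apply: measurable_funB => //; exact: measurable_fejer_mean.
- move=> n x; rewrite sqr_ge0 -[leLHS]real_normK ?num_real // lerXn2r ?nnegrE //.
    by rewrite addr_ge0 // (le_trans _ (gM x)).
  by rewrite (le_trans (ler_normB _ _)) // lerD // fejer_mean_bound.
- apply: (@bounded_integrable _ _ _ _ (lebesgue_on_fin T_gt0) _ ((M + M) ^+ 2)); first exact: measurable_cst.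
  by move=> x; rewrite ger0_norm ?sqr_ge0.
- move=> x x0.
  have h : (fun p => g x - fejer_mean T g p x) @ \oo --> g x - g x.
    by apply: cvgB; [exact: cvg_cst|exact: (@fejer_mean_cvg g x M (cg x) gM x0)].
  have := @cvg_comp _ _ _ _ (fun y : R => y ^+ 2) _ _ _ h (@exprn_continuous R 2 _).
  by rewrite subrr expr0n.
Qed.

End Density.

(** * Completeness of the trigonometric system *)

Section TrigBasis.
Variable R : realType.
Variable T : R.
Hypothesis T_gt0 : 0 < T.
Variable th : int -> R.
Local Notation mu := (lebesgue_on 0 T).
Local Notation sqn f := (\int[mu]_x (f x ^+ 2)).

Lemma approx_real f (e : R) : f \in Lfun mu 2%:E -> 0 < e -> exists h : R -> R,
  [/\ in_span (trig T th) (fun x => (h x)%:C), h \in Lfun mu 2%:E & sqn (fun x => f x - h x) < e].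
Proof.
move=> lf e0; (* three errors, and (a + b + c)^2 <= 3 (a^2 + b^2 + c^2) *)
have e9 : 0 < e / 9 by lra.
have mf := Lfun2_measurable lf.
have [M M0 h1] := approx_clip lf e9.
have mc : measurable_fun setT (fun x => clip M (f x)) by exact: measurable_clip.
have cM x : `|clip M (f x)| <= M by exact: clip_bound (ltW M0).
have [g [cg gM h2]] := approx_continuous T_gt0 M0 mc cM e9.
have [p h3] := approx_fejer T_gt0 cg gM e9.
have b2 (u : R -> R) : measurable_fun setT u -> (forall x, `|u x| <= M) -> u \in Lfun mu 2%:E.
  by move=> mu_ uM; apply: (bounded_Lfun2 (lebesgue_on_fin T_gt0)) => //; exact: uM.
have lc := b2 _ mc cM.
have lg : g \in Lfun mu 2%:E by apply: b2 => //; exact: continuous_measurable_fun.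
have lh : fejer_mean T g p \in Lfun mu 2%:E.
  by apply: b2; [exact: measurable_fejer_mean|move=> x; exact: fejer_mean_bound].
exists (fejer_mean T g p); split => //; first exact: in_span_fejer_mean.
have sub (u w : R -> R) : u \in Lfun mu 2%:E -> w \in Lfun mu 2%:E ->
    mu.-integrable setT (EFin \o (fun x => (u x - w x) ^+ 2)).
  by move=> lu lw; have /Lfun2P[] := Lfun2B lu lw.
have i1 := sub _ _ lf lc; have i2 := sub _ _ lc lg; have i3 := sub _ _ lg lh.
have [i12 E12] := Rint_lin 3 3 i1 i2; have [i123 E] := Rint_lin 1 3 i12 i3.
apply: (@le_lt_trans _ _ (1 * (3 * sqn (fun x => f x - clip M (f x)) +
   3 * sqn (fun x => clip M (f x) - g x)) + 3 * sqn (fun x => g x - fejer_mean T g p x))); last lra.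
rewrite -E12 -E; apply: le_Rintegral => //; first exact: sub.
move=> x _.
move: (f x) (clip M (f x)) (g x) (fejer_mean T g p x) => a b c d.
have := sqr_ge0 (a - b - (b - c)); have := sqr_ge0 (b - c - (c - d)); have := sqr_ge0 (a - b - (c - d)).
nra.
Qed.

Lemma trig_basis : orthonormal_basis mu (trig T th).
Proof.
split; [exact: L2_trig|exact: trig_orthonormal|].
move=> f [rf jf] e e0.
have e2 : 0 < e ^+ 2 / 2 by rewrite divr_gt0 // exprn_gt0.
have [p [sp lp hp]] := approx_real rf e2; have [q [sq lq hq]] := approx_real jf e2.
have [s [c E]] := in_span_comb (in_spanD sp (in_spanZ (0 +i* 1) sq)).
exists s, c.
have sub (u w : R -> R) : u \in Lfun mu 2%:E -> w \in Lfun mu 2%:E ->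
    mu.-integrable setT (EFin \o (fun x => (u x - w x) ^+ 2)).
  by move=> lu lw; have /Lfun2P[] := Lfun2B lu lw.
have [_ I] := Rint_lin 1 1 (sub _ _ rf lp) (sub _ _ jf lq).
rewrite /L2norm /L2dot /= -[ltRHS](gtr0_norm e0) -sqrtr_sqr ltr_sqrt ?exprn_gt0 //.
under eq_Rintegral => x _.
  rewrite Re_mulJ -E (_ : abs2 _ = 1 * (complex.Re (f x) - p x) ^+ 2 + 1 * (complex.Im (f x) - q x) ^+ 2).
    over.
  rewrite /abs2 !mul1r ReD ImD ReN ImN /=; congr (_ ^+ 2 + _ ^+ 2); ring.
by rewrite I; lra.
Qed.

End TrigBasis.

(** * Ordered multipliers of an orthonormal family *)

Section Multiplier.
Context d (X : measurableType d) (R : realType).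
Variable mu : {measure set X -> \bar R}.
Implicit Types f g : X -> R[i].

Lemma L2normD f g : L2 mu f -> L2 mu g ->
  L2norm mu (fun x => f x + g x) <= L2norm mu f + L2norm mu g.
Proof. by move=> lf lg; exact: (nrmD (L2_semi_inner mu) (toL2 lf) (toL2 lg)). Qed.

Lemma L2normZ a (k : R) f : 0 <= k -> abs2 a = k ^+ 2 -> L2 mu f ->
  L2norm mu (fun x => a * f x) = k * L2norm mu f.
Proof.
move=> k0 ak lf; apply/eqP; rewrite -(@eqrXn2 _ 2) ?mulr_ge0 ?sqrtr_ge0 // exprMn -ak.
by rewrite -(nrm2Z (L2_semi_inner mu) a (toL2 lf)).
Qed.

Lemma L2_mult (m : X -> R) (K : R) f : measurable_fun setT m -> (forall x, `|m x| <= K) -> L2 mu f ->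
  L2 mu (fun x => (m x)%:C * f x).
Proof.
move=> mm mK.
have key (p : X -> R) : p \in Lfun mu 2%:E -> (fun x => m x * p x) \in Lfun mu 2%:E.
  move=> /Lfun2P[mp ip]; have mmp : measurable_fun setT (fun x => m x * p x) by exact: measurable_funM.
  apply/Lfun2P; split => //.
  have iK : mu.-integrable setT (EFin \o (fun x => K ^+ 2 * p x ^+ 2)).
    exact: integrable_scale.
  apply: (le_integrable measurableT _ _ iK).
    by apply/measurable_EFinP; exact: measurable_funX.
  move=> x _; rewrite /= lee_fin -exprMn !normrX lerXn2r ?nnegrE // !normrM ler_wpM2r //.
  exact: le_trans (mK x) (ler_norm _).
move=> [rf jf]; split.
  by rewrite (_ : (fun x => _) = (fun x => m x * complex.Re (f x))); [exact: key|apply/funext => x; rewrite ReM /= mul0r subr0].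
by rewrite (_ : (fun x => _) = (fun x => m x * complex.Im (f x))); [exact: key|apply/funext => x; rewrite ImM /= mul0r addr0].
Qed.

Lemma L2_abs2_integrable f : L2 mu f -> mu.-integrable setT (EFin \o (fun x => abs2 (f x))).
Proof.
move=> [/Lfun2P[_ i1] /Lfun2P[_ i2]]; have [h _] := Rint_lin 1 1 i1 i2.
by move: h; under eq_fun do rewrite !mul1r.
Qed.

(** Multiplication by a function bounded by K almost everywhere has norm at most
    K. *)
Lemma L2norm_le_ae (K : R) f g : 0 <= K -> L2 mu f -> L2 mu g ->
  (\forall x \ae mu, abs2 (f x) <= K ^+ 2 * abs2 (g x)) -> L2norm mu f <= K * L2norm mu g.
Proof.
move=> K0 lf lg h.
have E u : L2norm mu u = Num.sqrt (\int[mu]_x abs2 (u x)).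
  by rewrite /L2norm /L2dot /=; under eq_Rintegral do rewrite Re_mulJ.
have I (u : X -> R[i]) : 0 <= \int[mu]_x abs2 (u x) by apply: Rintegral_ge0 => x _; exact: abs2_ge0.
have i1 := L2_abs2_integrable lf; have i2 := L2_abs2_integrable lg.
rewrite !E -[K](ger0_norm K0) -sqrtr_sqr -sqrtrM ?sqr_ge0 // ler_sqrt ?mulr_ge0 ?sqr_ge0 //.
rewrite -RintegralZl // -lee_fin /Rintegral.
have i3 : mu.-integrable setT (EFin \o (fun x => K ^+ 2 * abs2 (g x))).
  exact: integrable_scale.
rewrite !fineK ?integrable_fin_num //.
apply: ae_ge0_le_integral => //.
- by move=> x _; rewrite lee_fin abs2_ge0.
- by case/integrableP: i1.
- by move=> x _; rewrite lee_fin mulr_ge0 ?sqr_ge0 ?abs2_ge0.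
- by case/integrableP: i3.
- by apply: filterS h => x hx _; rewrite lee_fin.
Qed.

Variables (I : eqType) (e : I -> X -> R[i]).
Hypothesis le : forall i, L2 mu (e i).
Hypothesis oe : forall i j, L2dot mu (e i) (e j) = (i == j)%:R.

Lemma L2norm_comb (s : seq I) (c : I -> R[i]) : uniq s ->
  L2norm mu (fun x => \sum_(i <- s) c i * e i x) ^+ 2 = \sum_(i <- s) abs2 (c i).
Proof.
move=> us; pose b i := toL2 (le i).
have bP i j : vdot (b i) (b j) = (i == j)%:R by exact: oe.
by rewrite -(nrm2_comb (L2_semi_inner mu) bP c us) -L2normE val_sum.
Qed.

Variables (x : X -> R) (g : R -> R -> R) (G : R -> R) (b : I -> R) (B : R).
Hypothesis x_le1 : \forall t \ae mu, `|x t| <= 1.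
Hypothesis g_meas : forall s, measurable_fun setT (fun t => g s (x t)).
Hypothesis g_bnd : forall s y, `|g s y| <= 2.
Hypothesis g_lip : forall s' s y, 0 <= s' -> s' <= s -> s <= B -> `|y| <= 1 ->
  `|g s y - g s' y| <= G s - G s'.
Hypothesis b_bnd : forall i, 0 <= b i <= B.
Local Notation comb c s := (L2norm mu (fun t => \sum_(i <- s) c i * e i t)).

Let lc (c : I -> R[i]) (l : seq I) : L2 mu (fun t => \sum_(i <- l) c i * e i t).
Proof. by apply: L2_sum => i; exact: L2Z. Qed.

Let lm (s1 s2 : R) f : L2 mu f -> L2 mu (fun t => (g s1 (x t) - g s2 (x t))%:C * f t).
Proof.
apply: (@L2_mult _ (2 + 2)); first exact: measurable_funB.
by move=> y; rewrite (le_trans (ler_normB _ _)) // lerD.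
Qed.

Let lms (c : I -> R[i]) (l : seq I) (s : R) :
  L2 mu (fun t => \sum_(i <- l) (g (b i) (x t) - g s (x t))%:C * (c i * e i t)).
Proof. by apply: L2_sum => i; apply: lm; exact: L2Z. Qed.

(** Summation by parts. Let n be the index with the least node b n in the list.
    The sum relative to s is the sum relative to b n, in which n no longer
    contributes, plus (g (b n) - g s) times the whole combination; the bounds G
    B - G (b n) and G (b n) - G s add up to G B - G s. *)
Lemma multiplier_telescope (c : I -> R[i]) (l : seq I) (s : R) : uniq l -> 0 <= s ->
  all (fun i => s <= b i) l -> sorted (fun i j => b i <= b j) l -> s <= B ->
  L2norm mu (fun t => \sum_(i <- l) (g (b i) (x t) - g s (x t))%:C * (c i * e i t)) <=
    (G B - G s) * comb c l.
Proof.
have GB (s1 s2 : R) : 0 <= s1 -> s1 <= s2 -> s2 <= B -> 0 <= G s2 - G s1.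
  by move=> h1 h2 h3; apply: (le_trans (normr_ge0 _) (g_lip h1 h2 h3 (y := 0) _)); rewrite normr0.
elim: l s => [|n l IH] s.
  move=> _ s0 _ _ sB; apply: le_trans (_ : 0 <= _); last by rewrite mulr_ge0 ?GB ?sqrtr_ge0.
  apply: le_trans (L2norm_le_ae (K := 0) _ (lms c [::] s) (lms c [::] s) _) _; rewrite ?mul0r //.
  by apply: nearW => t; rewrite big_nil /abs2 /= expr0n mul0r addr0.
move=> /= /andP[nl ul] s0 /andP[snb al] pl sB.
have /andP[bn0 bnB] := b_bnd n.
have tr : transitive (fun i j => b i <= b j) by move=> ? ? ?; exact: le_trans.
have := IH (b n) ul bn0 (order_path_min tr pl) (path_sorted pl) bnB.
set f1 := (fun t => \sum_(i <- l) _) => h1.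
pose f2 t := (g (b n) (x t) - g s (x t))%:C * (\sum_(i <- n :: l) c i * e i t).
have l2 : L2 mu f2 by apply: lm.
rewrite (_ : (fun t => _) = (fun t => f1 t + f2 t)); last first.
  apply/funext => t; rewrite /f1 /f2 mulr_sumr !big_cons addrCA -big_split /=; congr (_ + _).
  apply: eq_bigr => i _; rewrite -mulrDl -rmorphD /=; congr (_%:C * _); ring.
apply: (le_trans (L2normD (lms c l (b n)) l2)).
have h2 : L2norm mu f2 <= (G (b n) - G s) * comb c (n :: l).
  apply: L2norm_le_ae => //; first exact: GB.
  apply: filterS x_le1 => t xt; rewrite /f2 abs2M ler_wpM2r ?abs2_ge0 //.
  rewrite /abs2 /= expr0n addr0 -[leLHS]real_normK ?num_real // lerXn2r ?nnegrE ?GB //.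
  exact: g_lip.
have h3 : comb c l <= comb c (n :: l).
  rewrite -(@ler_pXn2r _ 2) ?nnegrE ?sqrtr_ge0 // !L2norm_comb //= ?nl //.
  by rewrite big_cons lerDr abs2_ge0.
have h4 := ler_wpM2l (GB _ _ bn0 bnB (lexx B)) h3.
lra.
Qed.

Lemma multiplier_bound (c : I -> R[i]) (l : seq I) : uniq l -> 0 <= B -> (forall y, g 0 y = 0) ->
  let f t := \sum_(i <- l) (g (b i) (x t))%:C * (c i * e i t) in
  L2 mu f /\ L2norm mu f <= (G B - G 0) * comb c l.
Proof.
move=> ul B0 g0 f; pose l' := sort (fun i j => b i <= b j) l.
have pl : perm_eq l l' by rewrite perm_sym perm_sort.
have fE : f = (fun t => \sum_(i <- l') (g (b i) (x t) - g 0 (x t))%:C * (c i * e i t)).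
  by apply/funext => t; rewrite -(perm_big _ pl); apply: eq_bigr => i _; rewrite g0 subr0.
split; first by rewrite fE.
have -> : comb c l = comb c l' by congr L2norm; apply/funext => t; exact: perm_big.
rewrite fE; apply: multiplier_telescope => //; first by rewrite sort_uniq.
  by apply/allP => i _; case/andP: (b_bnd i).
by apply: sort_sorted => i j; exact: le_total.
Qed.

End Multiplier.

(** * The bound of Kadec *)

Section Kadec.
Variable R : realType.
Implicit Types s x y : R.

Lemma pi4_lt1 : pi / 4 < 1 :> R.
Proof. by have := @pihalf_lt2 R; lra. Qed.

Lemma sin_lt_cos y : 0 <= y -> y < pi / 4 -> sin y < cos y.
Proof.
move=> y0 y4; have p := @pi_gt0 R.
have c0 : 0 < cos (pi / 4) :> R by apply: cos_gt0_pihalf; lra.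
by rewrite -subr_gt0 -(pmulr_rgt0 _ c0) cos_sub_sin; apply: sin_gt0_pi; lra.
Qed.

Lemma sin_le_cos y : 0 <= y -> y <= pi / 4 -> sin y <= cos y.
Proof.
move=> y0; rewrite le_eqVlt => /predU1P[->|y4]; first by rewrite cos_pi4.
by rewrite ltW // sin_lt_cos.
Qed.

(** x cos (s x) increases in x on [0, 1], because y sin y <= cos y for 0 <= y <=
    pi / 4. *)
Lemma xcos_le s x : 0 <= s -> s <= pi / 4 -> 0 <= x -> x <= 1 -> x * cos (s * x) <= cos s.
Proof.
move=> s0 s4 x0 x1.
have h : x * cos (s * x) <= 1 * cos (s * 1).
  apply: (@der_ge0_le _ (fun y : R => y * cos (s * y)) (fun y : R => cos (s * y) - y * s * sin (s * y))) => //.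
    by move=> y _; derive; ring.
  move=> y /andP[y0 y1]; have sy0 : 0 <= s * y by nra.
  have sy4 : s * y <= pi / 4 by nra.
  have := sin_le_cos sy0 sy4; have := pi4_lt1.
  have : 0 <= sin (s * y) by apply: sin_ge0_pi; have := @pi_gt0 R; lra.
  by rewrite subr_ge0 (mulrC y s); move: (s * y) sy0 sy4 => z z0 z4 ? ? ?; nra.
by rewrite !mul1r mulr1 in h.
Qed.

(** sin s - sin (s y) is nondecreasing in s on [0, pi / 4], by xcos_le. *)
Lemma sin_lip s' s y : 0 <= s' -> s' <= s -> s <= pi / 4 -> `|y| <= 1 ->
  `|sin (s * y) - sin (s' * y)| <= sin s - sin s'.
Proof.
wlog y0 : y / 0 <= y.
  move=> h h1 h2 h3 h4; have [|y0] := leP 0 y; first by move=> ?; exact: h.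
  have := h (- y); rewrite normrN !mulrN !sinN -opprD normrN; apply => //; lra.
move=> s'0 s's s4; rewrite ger0_norm // => y1.
have m1 : sin (s' * y) <= sin (s * y).
  apply: (@der_ge0_le _ (fun t : R => sin (t * y)) (fun t : R => y * cos (t * y))) => //.
    by move=> t _; derive; ring.
  move=> t /andP[t0 t1]; apply: mulr_ge0 => //; apply: cos_ge0_pihalf.
  have t4 : 0 <= t * y <= pi / 4 by nra.
  by have := @pi_gt0 R; lra.
have m2 : sin s' - sin (s' * y) <= sin s - sin (s * y).
  apply: (@der_ge0_le _ (fun t : R => sin t - sin (t * y)) (fun t : R => cos t - y * cos (t * y))) => //.
    by move=> t _; derive; ring.
  by move=> t /andP[t0 t1]; rewrite subr_ge0 xcos_le //; lra.
by rewrite ger0_norm ?subr_ge0 //; lra.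
Qed.

Lemma cos_lip s' s y : 0 <= s' -> s' <= s -> s <= pi / 4 -> `|y| <= 1 ->
  `|cos (s * y) - cos (s' * y)| <= cos s' - cos s.
Proof.
wlog y0 : y / 0 <= y.
  move=> h h1 h2 h3 h4; have [|y0] := leP 0 y; first by move=> ?; exact: h.
  have := h (- y); rewrite normrN !mulrN !cosN; apply => //; lra.
move=> s'0 s's s4; rewrite ger0_norm // => y1.
have p := @pi_gt0 R.
have m1 : cos (s * y) <= cos (s' * y).
  apply: (@der_le0_le _ (fun t : R => cos (t * y)) (fun t : R => - (y * sin (t * y)))) => //.
    by move=> t _; derive; ring.
  move=> t /andP[t0 t1]; rewrite oppr_le0; apply: mulr_ge0 => //; apply: sin_ge0_pi.
  have t4 : 0 <= t * y <= pi / 4 by nra.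
  lra.
have m2 : cos s - cos (s * y) <= cos s' - cos (s' * y).
  apply: (@der_le0_le _ (fun t : R => cos t - cos (t * y)) (fun t : R => y * sin (t * y) - sin t)) => //.
    by move=> t _; derive; ring.
  move=> t /andP[t0 t1]; rewrite subr_le0.
  have ty : 0 <= t * y <= t by nra.
  have : sin (t * y) <= sin t.
    apply: (@der_ge0_le _ (@sin R) (@cos R)); first by case/andP: ty.
    by move=> u /andP[u0 u1]; apply: cos_ge0_pihalf; lra.
  have : 0 <= sin (t * y) by apply: sin_ge0_pi; lra.
  nra.
by rewrite ler0_norm ?subr_le0 //; lra.
Qed.

End Kadec.

Section KadecBound.
Variable R : realType.
Variables (T : R) (th : int -> R) (B : R).
Hypothesis T_gt0 : 0 < T.
Hypothesis B_lt : B < pi / 4.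
Hypothesis th_le : forall n, `|th n| <= B.
Local Notation mu := (lebesgue_on 0 T).
Local Notation e := (trig T th).

Definition centered (t : R) : R := 2 / T * t + - 1.

(** The exponentials of the theorem, with the phase of trig exposed. *)
Definition perturbed (n : int) (t : R) : R[i] := expi (freq T th n t + th n * centered t).

Let sT : (Num.sqrt T)%:C * (Num.sqrt T)^-1%:C = 1 :> R[i].
Proof. by rewrite -rmorphM /= divff // sqrtr_eq0 -ltNge. Qed.

Lemma perturbed_trig n t : perturbed n t = (Num.sqrt T)%:C * (e n t * expi (th n * centered t)).
Proof. by rewrite /perturbed /trig expiD 2!(mulrA (_%:C)) sT mul1r. Qed.

Lemma continuous_centered : continuous centered.
Proof. exact: continuous_affine. Qed.

(** The imaginary part uses sin (|beta| x); the sign of beta is moved into the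
    coefficients, which does not change their norm. *)
Lemma kadec_bound (l : seq int) (c : int -> R[i]) : uniq l ->
  L2norm mu (fun t => \sum_(n <- l) c n * (perturbed n t - (Num.sqrt T)%:C * e n t)) <=
  (1 - cos B + sin B) * Num.sqrt T * L2norm mu (fun t => \sum_(n <- l) c n * e n t).
Proof.
move=> ul.
have B0 : 0 <= B := le_trans (normr_ge0 _) (th_le 0).
have le := L2_trig T_gt0 th; have oe := trig_orthonormal T_gt0 th.
have b_bnd n : 0 <= `|th n| <= B by rewrite normr_ge0 th_le.
have x1 : \forall t \ae mu, `|centered t| <= 1.
  apply: ae_lebesgue_on => // t /andP[t0 tT].
  have tE : t / T * T = t by rewrite mulfVK // gt_eqF.
  have -> : centered t = 2 * (t / T) - 1 by rewrite /centered; ring.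
  have : 0 <= t / T <= 1 by rewrite divr_ge0 ?(ltW t0) ?(ltW T_gt0) //= ler_pdivrMr // mul1r ltW.
  by move=> ?; rewrite ler_norml; lra.
have cont s : continuous (fun t => s * centered t).
  move=> t; apply: (@cvgM _ _ _ _ (fun=> s) centered); [exact: cvg_cst|exact: continuous_centered].
(* sin (beta x) = sg * sin (|beta| x) *)
pose sg n : R := if 0 <= th n then 1 else -1.
have sgE n : abs2 (sg n)%:C = 1 by rewrite /abs2 /sg /=; case: ifP; rewrite ?sqrrN !expr1n expr0n addr0.
have h1 := @multiplier_bound _ _ _ mu _ e le oe centered (fun s y => cos (s * y) - 1)
  (fun s => 1 - cos s) (fun n => `|th n|) B x1.
have h2 := @multiplier_bound _ _ _ mu _ e le oe centered (fun s y => sin (s * y))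
  (fun s => sin s) (fun n => `|th n|) B x1.
pose p t := \sum_(n <- l) (cos (`|th n| * centered t) - 1)%:C * (c n * e n t).
pose q t := \sum_(n <- l) (sin (`|th n| * centered t))%:C * ((sg n)%:C * c n * e n t).
have {h1}[lp h1] : L2 mu p /\ L2norm mu p <=
    (1 - cos B - (1 - cos 0)) * L2norm mu (fun t => \sum_(n <- l) c n * e n t).
  apply: h1 => //.
  - move=> s; apply: measurable_funB => //; apply: continuous_measurable_fun.
    exact: (continuous_expi (cont s)).1.
  - move=> s y; have := cos_max (s * y); rewrite !ler_norml; lra.
  - move=> s' s y s0 ss sB y1.
    rewrite [in leLHS](_ : _ - _ = cos (s * y) - cos (s' * y)); last by ring.
    rewrite [leRHS](_ : _ = cos s' - cos s); last by ring.
    by apply: cos_lip => //; rewrite (le_trans sB) // ltW.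
  - by move=> y; rewrite mul0r cos0 subrr.
have {h2}[lq h2] : L2 mu q /\ L2norm mu q <=
    (sin B - sin 0) * L2norm mu (fun t => \sum_(n <- l) (sg n)%:C * c n * e n t).
  apply: h2 => //.
  - move=> s; apply: continuous_measurable_fun.
    exact: (continuous_expi (cont s)).2.
  - move=> s y; have := sin_max (s * y); rewrite !ler_norml; lra.
  - by move=> s' s y s0 ss sB; apply: sin_lip => //; rewrite (le_trans sB) // ltW.
  - by move=> y; rewrite mul0r sin0.
have h3 : L2norm mu (fun t => \sum_(n <- l) (sg n)%:C * c n * e n t) =
    L2norm mu (fun t => \sum_(n <- l) c n * e n t).
  apply/eqP; rewrite -(@eqrXn2 _ 2) ?sqrtr_ge0 // !L2norm_comb //.
  by apply/eqP; apply: eq_bigr => n _; rewrite abs2M sgE mul1r.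
move: h1 h2; rewrite h3 cos0 sin0 subrr !subr0.
move=> h1 h2.
rewrite (_ : (fun t => _) = (fun t => (Num.sqrt T)%:C * (p t + (0 +i* 1) * q t))); last first.
  apply/funext => t; rewrite /p /q mulr_sumr -big_split /= mulr_sumr.
  apply: eq_bigr => n _; rewrite perturbed_trig.
  have -> : expi (th n * centered t) = (cos (`|th n| * centered t))%:C +
      (0 +i* 1) * ((sg n)%:C * (sin (`|th n| * centered t))%:C).
    rewrite /expi /sg; case: ifP => th0; apply/eqP; rewrite eq_complex ?ReD ?ImD ?ReM ?ImM /=.
      by rewrite ger0_norm //; apply/andP; split; apply/eqP; ring.
    rewrite ltr0_norm ?mulNr ?cosN ?sinN; last by rewrite ltNge th0.
    by apply/andP; split; apply/eqP; ring.
  rewrite rmorphB /=; ring.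
have lpq : L2 mu (fun t => p t + (0 +i* 1) * q t) by apply: L2D => //; exact: L2Z.
rewrite (L2normZ (k := Num.sqrt T)) ?sqrtr_ge0 //; last by rewrite /abs2 /= expr0n addr0.
rewrite [_ * Num.sqrt T]mulrC -mulrA ler_wpM2l ?sqrtr_ge0 // (le_trans (L2normD lp (L2Z _ lq))) //.
rewrite (L2normZ (k := 1)) //; last by rewrite /abs2 /= expr0n add0r.
rewrite mul1r mulrDl; exact: lerD.
Qed.

(** This is where pi / 4 enters: sin B < cos B. *)
Lemma kadec_constant_lt1 : 0 <= 1 - cos B + sin B < 1.
Proof.
have B0 : 0 <= B := le_trans (normr_ge0 _) (th_le 0).
have := sin_lt_cos B0 B_lt; have := cos_le1 B.
have : 0 <= sin B by apply: sin_ge0_pi; have := @pi_gt0 R; move: B0 B_lt; lra.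
lra.
Qed.

End KadecBound.

(** * Nonharmonic exponentials *)

(** The integers from - N to N. *)
Definition window (N : nat) : seq int := [seq i%:Z - N%:Z | i <- iota 0 N.*2.+1].

Lemma mem_window N (n : int) : (n \in window N) = (`|n| <= N)%N.
Proof.
apply/mapP/idP => [h|nN].
  by case: h => i; rewrite mem_iota => iN ->; lia.
exists (absz (n + N%:Z)); last lia.
by rewrite mem_iota; lia.
Qed.

Lemma window_uniq N : uniq (window N).
Proof. by rewrite map_inj_uniq ?iota_uniq // => i j /addIr; case. Qed.

(** Kadec's 1/4 theorem on (0, T): the frequencies are pi (n + delta_n) * 2 / T
    with |delta_n| <= B / pi < 1/4. *)
Lemma riesz_basis_exponentials (R : realType) (T B : R) (om : int -> R) : 0 < T -> B < pi / 4 ->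
  (forall n, `|om n * (T / 2) - pi * n%:~R| <= B) ->
  riesz_basis (lebesgue_on 0 T) (fun n t => expi (om n * t)).
Proof.
move=> T0 B4 omB; pose th n := om n * (T / 2) - pi * n%:~R.
have perturbedE : (fun n t => expi (om n * t)) = perturbed T th.
  apply/funext => n; apply/funext => t; rewrite /perturbed /freq /centered /th; congr expi.
  by field; rewrite gt_eqF.
rewrite perturbedE; have [lam0 lam1] := andP (kadec_constant_lt1 B4 omB).
apply: (@riesz_basis_perturbation _ _ _ _ (lebesgue_on_fin T0) _ (trig T th) _ window
  (Num.sqrt T) (1 - cos B + sin B)) => //.
- exact: window_uniq.
- by move=> m n mn i; rewrite !mem_window => /leq_trans; apply.
- by move=> i; exists `|i|%N; rewrite mem_window.
- by rewrite sqrtr_gt0.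
- exact: trig_basis.
- move=> n; rewrite -perturbedE; apply: L2_expi => //.
  suff : continuous (fun t : R => om n * t + 0) by under eq_fun do rewrite addr0.
  exact: continuous_affine.
- by move=> s c us; exact: kadec_bound.
Qed.

Theorem lemma8p1 (R : realType) (alpha : R) (halpha : 0 <= alpha < 1) :
  let T0 : R := 4 / (2 - alpha) in
  riesz_basis (lebesgue_on 0 T0)
    (fun (n : int) (t : R) => expi (omega alpha n * t)).
Proof.
move=> T0; case/andP: halpha => a0 a1.
pose nu := (2 - alpha)^-1.
have d0 : 0 < 2 - alpha by lra.
have nuE : nu * (2 - alpha) = 1 by rewrite /nu mulVf // gt_eqF.
have nu1 : nu < 1 by rewrite invf_lt1 //; lra.
have nu2 : 1 / 2 <= nu by rewrite mul1r lef_pV2 ?posrE //; lra.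
have [B B4 jB] := bessel_zero_bounds nu2 nu1.
apply: (riesz_basis_exponentials (B := B)) => //; first by rewrite divr_gt0.
have hT : (2 - alpha) / 2 * (T0 / 2) = 1 by rewrite /T0; field; rewrite gt_eqF.
have pos (k : nat) : (0 < k)%N -> Num.sqrt (lambda alpha k) * (T0 / 2) = bessel_zero nu k.
  move=> k0; have [j0 _] := jB k k0.
  rewrite /lambda -exprMn sqrtr_sqr ger0_norm; last by rewrite mulr_ge0 // ltW // divr_gt0.
  by rewrite mulrAC hT mul1r.
move=> n; rewrite /omega; have [->|n0] := eqVneq n 0.
  by rewrite mul0r mulr0 subr0 normr0; have [_ /andP[]] := jB 1%N isT; exact: le_trans.
have k0 : (0 < `|n|)%N by rewrite absz_gt0.
have [_ /andP[b1 b2]] := jB _ k0.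
have [np|nn] := ltP 0 n.
  have nE : n%:~R = `|n|%N%:R :> R by rewrite -[in LHS](gtz0_abs np).
  by rewrite pos // nE [pi * _]mulrC ger0_norm.
have nE : n%:~R = - `|n|%N%:R :> R by rewrite -[in LHS](opprK n) -(lez0_abs nn) rmorphN.
by rewrite mulNr pos // nE mulrN opprK addrC [pi * _]mulrC -opprB normrN ger0_norm.
Qed.
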